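(* Let $q,w\in L^1[-1,1]$ be real-valued with $w(x)\ne0$ for a.e. $x\in[-1,1]$, $q(x)=q(-x)$ and $w(-x)=-w(x)$ for a.e. $x$. Suppose the Dirichlet problem $-y''+q(x)y=\lambda y$, $y(-1)=y(1)=0$, has exactly one negative eigenvalue and all its other eigenvalues are positive. Then the problem $-y''+qy=\lambda wy$, $y(-1)=y(1)=0$, has exactly two non-real eigenvalues, and they are purely imaginary (of the form $\pm i\alpha$ with $\alpha>0$).
   Context: A number $\lambda\in\mathbb{C}$ is an eigenvalue of $-y''+qy=\lambda wy$, $y(-1)=y(1)=0$, if there is a nontrivial function $y$ with $y,y'$ absolutely continuous on $[-1,1]$ satisfying $-y''+qy=\lambda wy$ a.e. on $[-1,1]$ and $y(-1)=y(1)=0$ (similarly with $w\equiv1$). *)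

(* Defs.v *)
From Stdlib Require Import Reals.
Open Scope R_scope.

Definition in_I (x : R) : Prop := -1 <= x <= 1.

Fixpoint rsum (f : nat -> R) (n : nat) : R :=
  match n with
  | O => 0
  | S k => rsum f k + f k
  end.

Definition null_set (S : R -> Prop) : Prop :=
  forall eps, 0 < eps ->
    exists a b : nat -> R,
      (forall n, a n <= b n) /\
      (forall x, S x -> exists n, a n < x < b n) /\
      (forall N, rsum (fun n => b n - a n) N <= eps).

Definition ae (P : R -> Prop) : Prop :=
  null_set (fun x => in_I x /\ ~ P x).

Definition abs_cont (f : R -> R) : Prop :=
  forall eps, 0 < eps ->
    exists delta, 0 < delta /\
      forall (n : nat) (a b : nat -> R),
        (forall i, (i < n)%nat -> -1 <= a i /\ a i <= b i /\ b i <= 1) ->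
        (forall i, (S i < n)%nat -> b i <= a (S i)) ->
        rsum (fun i => b i - a i) n < delta ->
        rsum (fun i => Rabs (f (b i) - f (a i))) n < eps.

(* f in L^1[-1,1] (Riesz / Daniell construction): f is the a.e. limit on
   [-1,1] of a sequence of continuous functions that is Cauchy for the
   L^1[-1,1] norm. *)
Definition L1 (f : R -> R) : Prop :=
  exists g : nat -> R -> R,
    (forall n, continuity (g n)) /\
    (forall eps, 0 < eps -> exists N : nat, forall n m : nat,
        (N <= n)%nat -> (N <= m)%nat ->
        forall pr : Riemann_integrable (fun x => Rabs (g n x - g m x)) (-1) 1,
          RiemannInt pr < eps) /\
    ae (fun x => Un_cv (fun n => g n x) (f x)).

(* lambda = a + i b is an eigenvalue of -y'' + q y = lambda w y,
   y(-1) = y(1) = 0.  The complex-valued eigenfunction is y = u + i v,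
   with y' = u1 + i v1; y and y' absolutely continuous on [-1,1];
   the equation holds a.e. (written as real and imaginary parts). *)
Definition is_eigenvalue (q w : R -> R) (a b : R) : Prop :=
  exists u v u1 v1 : R -> R,
    abs_cont u /\ abs_cont v /\ abs_cont u1 /\ abs_cont v1 /\
    (forall x, -1 < x < 1 ->
       derivable_pt_lim u x (u1 x) /\ derivable_pt_lim v x (v1 x)) /\
    u (-1) = 0 /\ u 1 = 0 /\ v (-1) = 0 /\ v 1 = 0 /\
    (exists x, in_I x /\ (u x <> 0 \/ v x <> 0)) /\
    ae (fun x => exists du dv : R,
          derivable_pt_lim u1 x du /\ derivable_pt_lim v1 x dv /\
          - du + q x * u x = w x * (a * u x - b * v x) /\
          - dv + q x * v x = w x * (a * v x + b * u x)).

(* Main.v *)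
Require Import Defs.
From Stdlib Require Import Reals Lra Lia Psatz Classical ClassicalEpsilon Arith.
From Coquelicot Require Import Coquelicot.
Open Scope R_scope.

(* At most two non-real eigenvalues: since [-y'' + q y] has one negative eigenvalue, its Dirichlet
   solution [psi] at energy 0 has a single zero [c] in (-1,1), so by Jacobi's factorisation the
   energy form is positive on functions vanishing at -1, [c] and 1.  Eigenfunctions [y], [z] for
   non-real [lam], [mu] with [mu] not in {lam, conj lam} span an isotropic plane, and some
   combination of them vanishes at [c]: contradiction.

   Existence of [i al]: by PT symmetry take [y = f + i g] with [f] even and [g] odd, so that
   [f'' = q f + al w g], [g'' = q g - al w f] and [f' = g = 0] at 0.  Let [D (al, x)] be the determinant
   of the values [(f, g)] at [x] of two independent such solutions.  Then [D (0, 1) < 0] because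
   [psi 1 < 0].  For [al] large [D (al, .)] has no zero in (0,1]: a zero gives a solution of
   energy 1, which must be of a certain size on some fixed small interval, and there
   [al w f = q g - g''] is too large when tested against a bump.  Hence [D (al, 1) > 0] for large [al], and
   [D (al, 1)] vanishes for some [al > 0]. *)

(** * Null sets *)

(** Integrals of L1 functions appear only through primitives: [acd a b F f] says that [F] is one of
    [f], and integral identities and inequalities become statements on increments. They rest on
    [ac_nondecreasing] and on [L1_primitive], the latter a form of Lebesgue's differentiation
    theorem.

    The plane is isotropic because Green's identity gives [(lam - conj mu) int w y conj z = 0], and
    also [int w |y|^2 = 0] when [lam] is non-real. The energy of a combination is a sum of such
    weighted integrals. Vanishing at [c] is one complex condition on two complex coefficients, hence
    always solvable.

    In the existence part [D (al, x)] behaves like [x] near 0, so a determinant without zeros in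
    (0,1] is positive at 1. The obstacle is that [w] is only integrable and may change sign inside
    (0,1), so no asymptotics for large [al] are at hand. The bump argument asks only for one point
    in each of finitely many cells at which [w] is nonzero and the primitives of [w] and [|w|] are
    differentiable. *)

Lemma rsum_ext f g n : (forall i, (i < n)%nat -> f i = g i) -> rsum f n = rsum g n.
Proof.
  induction n as [|n IH]; intros H; simpl; [easy|].
  rewrite IH by (intros; apply H; lia). rewrite H by lia. easy.
Qed.

Lemma rsum_le f g n : (forall i, (i < n)%nat -> f i <= g i) -> rsum f n <= rsum g n.
Proof.
  induction n as [|n IH]; intros H; simpl; [lra|].
  apply Rplus_le_compat; [apply IH; intros; apply H; lia | apply H; lia].
Qed.

Lemma rsum_plus f g n : rsum (fun i => f i + g i) n = rsum f n + rsum g n.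
Proof. induction n as [|n IH]; simpl; [|rewrite IH]; ring. Qed.

Lemma rsum_scal c f n : rsum (fun i => c * f i) n = c * rsum f n.
Proof. induction n as [|n IH]; simpl; [|rewrite IH]; ring. Qed.

Lemma rsum_zero f n : (forall i, (i < n)%nat -> f i = 0) -> rsum f n = 0.
Proof.
  induction n as [|n IH]; intros H; simpl; [easy|].
  rewrite IH by (intros; apply H; lia). rewrite H by lia. ring.
Qed.

Lemma rsum_nonneg f n : (forall i, (i < n)%nat -> 0 <= f i) -> 0 <= rsum f n.
Proof.
  intros H. rewrite <- (rsum_zero (fun _ => 0) n) by easy. now apply rsum_le.
Qed.

Lemma rsum_app f n m : rsum f (n + m) = rsum f n + rsum (fun i => f (n + i)%nat) m.
Proof.
  induction m as [|m IH]; simpl.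
  - rewrite Nat.add_0_r. ring.
  - rewrite Nat.add_succ_r. simpl. rewrite IH. ring.
Qed.

Lemma rsum_mono f n m : (forall i, 0 <= f i) -> (n <= m)%nat -> rsum f n <= rsum f m.
Proof.
  intros H Hnm. replace m with (n + (m - n))%nat by lia. rewrite rsum_app.
  pose proof (rsum_nonneg (fun i => f (n + i)%nat) (m - n) (fun i _ => H _)). lra.
Qed.

Lemma rsum_double f n :
  rsum f (2 * n) = rsum (fun i => f (2 * i)%nat + f (S (2 * i))) n.
Proof.
  induction n as [|n IH]; [easy|].
  replace (2 * S n)%nat with (S (S (2 * n))) by lia.
  cbn [rsum]. rewrite IH. ring.
Qed.

Lemma null_set_subset (S T : R -> Prop) : (forall x, S x -> T x) -> null_set T -> null_set S.
Proof.
  intros HST HT eps He. destruct (HT eps He) as (a & b & H1 & H2 & H3).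
  exists a, b. repeat split; auto.
Qed.

Lemma null_set_union (S T : R -> Prop) :
  null_set S -> null_set T -> null_set (fun x => S x \/ T x).
Proof.
  intros HS HT eps He.
  destruct (HS (eps / 2)) as (a & b & A1 & A2 & A3); [lra|].
  destruct (HT (eps / 2)) as (c & d & C1 & C2 & C3); [lra|].
  exists (fun n => if Nat.even n then a (Nat.div2 n) else c (Nat.div2 n)),
         (fun n => if Nat.even n then b (Nat.div2 n) else d (Nat.div2 n)).
  split; [|split].
  - intros n. destruct (Nat.even n); auto.
  - intros x [Hx | Hx].
    + destruct (A2 x Hx) as [n Hn]. exists (2 * n)%nat.
      now rewrite Nat.even_even, Nat.div2_double.
    + destruct (C2 x Hx) as [n Hn]. exists (Datatypes.S (2 * n))%nat.
      rewrite Nat.even_succ, Nat.odd_even, Nat.div2_succ_double. easy.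
  - intros N.
    (* The merged cover alternates between the two given ones; passing from [N] to [2 * N] terms
       makes the partial sum split evenly between them. *)
    apply Rle_trans with (rsum (fun n => (if Nat.even n then b (Nat.div2 n) else d (Nat.div2 n))
       - (if Nat.even n then a (Nat.div2 n) else c (Nat.div2 n))) (2 * N)).
    + apply rsum_mono; [|lia].
      intros i; specialize (A1 (Nat.div2 i)); specialize (C1 (Nat.div2 i)).
      destruct (Nat.even i); lra.
    + rewrite rsum_double.
      rewrite (rsum_ext _ (fun i => (b i - a i) + (d i - c i))).
      * rewrite rsum_plus. specialize (A3 N). specialize (C3 N). lra.
      * intros i _. rewrite Nat.even_even, Nat.div2_double.
        rewrite Nat.even_succ, Nat.odd_even, Nat.div2_succ_double. ring.
Qed.

Lemma null_set_point c : null_set (fun x => x = c).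
Proof.
  intros eps He.
  (* Membership in the cover is strict, so one interval must have positive length; the others are
     degenerate. *)
  exists (fun n => match n with O => c - eps / 2 | _ => c end),
         (fun n => match n with O => c + eps / 2 | _ => c end).
  split; [|split].
  - intros [|n]; lra.
  - intros x ->. exists O. lra.
  - intros [|N]; [simpl; lra|].
    replace (Datatypes.S N) with (1 + N)%nat by lia. rewrite rsum_app.
    rewrite (rsum_zero _ N) by (intros; simpl; ring). simpl. lra.
Qed.

Lemma null_set_reflect S : null_set S -> null_set (fun x => S (- x)).
Proof.
  intros HS eps He. destruct (HS eps He) as (a & b & H1 & H2 & H3).
  exists (fun n => - b n), (fun n => - a n). split; [|split].
  - intros n. specialize (H1 n). lra.
  - intros x Hx. destruct (H2 _ Hx) as [n Hn]. exists n. lra.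
  - intros N. rewrite (rsum_ext _ (fun n => b n - a n)); [auto|]. intros; ring.
Qed.

Lemma ae_mp (P Q : R -> Prop) : ae P -> (forall x, in_I x -> P x -> Q x) -> ae Q.
Proof.
  intros HP H. apply null_set_subset with (2 := HP). intros x [Hx HQ]. split; auto.
Qed.

Lemma ae_and (P Q : R -> Prop) : ae P -> ae Q -> ae (fun x => P x /\ Q x).
Proof.
  intros HP HQ. apply null_set_subset with (2 := null_set_union _ _ HP HQ).
  intros x [Hx H]. destruct (classic (P x)); [right | left]; tauto.
Qed.

Lemma ae_mp2 (P Q T : R -> Prop) :
  ae P -> ae Q -> (forall x, in_I x -> P x -> Q x -> T x) -> ae T.
Proof.
  intros HP HQ H. apply ae_mp with (1 := ae_and _ _ HP HQ). intros x Hx [? ?]; auto.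
Qed.

Lemma ae_neq c : ae (fun x => x <> c).
Proof.
  apply null_set_subset with (2 := null_set_point c). intros x [_ H]. now apply NNPP.
Qed.

Lemma ae_all (P : R -> Prop) : (forall x, in_I x -> P x) -> ae P.
Proof. intros H. apply ae_mp with (1 := ae_neq 0). auto. Qed.

Lemma ae_reflect P : ae P -> ae (fun x => P (- x)).
Proof.
  intros HP. apply null_set_subset with (2 := null_set_reflect _ HP).
  intros x [Hx H]. split; [unfold in_I in *; lra | easy].
Qed.

Lemma ae_interior : ae (fun x => -1 < x < 1).
Proof.
  apply ae_mp2 with (1 := ae_neq (-1)) (2 := ae_neq 1).
  unfold in_I. intros x Hx ? ?. lra.
Qed.

(** * Rules for pointwise derivatives *)

Lemma dpl_eq f x l l' : derivable_pt_lim f x l -> l = l' -> derivable_pt_lim f x l'.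
Proof. now intros H <-. Qed.

(** In these rules the derivative is free up to an equation, so that [eapply] follows the shape of
    the function and leaves the algebra to [ring]. *)
Lemma dpl_plus f g x a b l : derivable_pt_lim f x a -> derivable_pt_lim g x b ->
  l = a + b -> derivable_pt_lim (fun y => f y + g y) x l.
Proof. intros H1 H2 ->. exact (derivable_pt_lim_plus f g x a b H1 H2). Qed.

Lemma dpl_minus f g x a b l : derivable_pt_lim f x a -> derivable_pt_lim g x b ->
  l = a - b -> derivable_pt_lim (fun y => f y - g y) x l.
Proof. intros H1 H2 ->. exact (derivable_pt_lim_minus f g x a b H1 H2). Qed.

Lemma dpl_mult f g x a b l : derivable_pt_lim f x a -> derivable_pt_lim g x b ->
  l = a * g x + f x * b -> derivable_pt_lim (fun y => f y * g y) x l.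
Proof. intros H1 H2 ->. exact (derivable_pt_lim_mult f g x a b H1 H2). Qed.

Lemma dpl_scal c f x a l : derivable_pt_lim f x a ->
  l = c * a -> derivable_pt_lim (fun y => c * f y) x l.
Proof. intros H1 ->. exact (derivable_pt_lim_scal f c x a H1). Qed.

Lemma dpl_const c x : derivable_pt_lim (fun _ => c) x 0.
Proof. exact (derivable_pt_lim_const c x). Qed.

Lemma dpl_id x : derivable_pt_lim (fun y => y) x 1.
Proof. exact (derivable_pt_lim_id x). Qed.

Lemma dpl_local f g x l d : 0 < d -> (forall y, Rabs (y - x) < d -> g y = f y) ->
  derivable_pt_lim f x l -> derivable_pt_lim g x l.
Proof.
  intros Hd He Hf eps Heps. destruct (Hf eps Heps) as [dl H].
  assert (Hm : 0 < Rmin d dl) by (apply Rmin_pos; [easy|apply cond_pos]).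
  exists (mkposreal _ Hm). simpl. intros h Hh Hl.
  assert (Rabs h < d) by (eapply Rlt_le_trans; [exact Hl | apply Rmin_l]).
  rewrite (He (x + h)) by (replace (x + h - x) with h by ring; easy).
  rewrite (He x) by (rewrite Rminus_diag, Rabs_R0; easy).
  apply H; auto. eapply Rlt_le_trans; [exact Hl | apply Rmin_r].
Qed.

Lemma dpl_on_interval f g x l a b : a < x < b -> (forall y, a < y < b -> g y = f y) ->
  derivable_pt_lim f x l -> derivable_pt_lim g x l.
Proof.
  intros Hx He. apply dpl_local with (d := Rmin (x - a) (b - x)).
  - apply Rmin_pos; lra.
  - intros y Hy. apply He.
    pose proof (Rmin_l (x - a) (b - x)). pose proof (Rmin_r (x - a) (b - x)).
    apply Rabs_def2 in Hy. lra.
Qed.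

Lemma dpl_bound f x l eps : derivable_pt_lim f x l -> 0 < eps ->
  exists d, 0 < d /\ forall y, Rabs (y - x) < d ->
    Rabs (f y - f x - l * (y - x)) <= eps * Rabs (y - x).
Proof.
  intros H He. destruct (H eps He) as [d Hd]. exists d. split; [apply cond_pos|].
  intros y Hy. destruct (Req_dec y x) as [->|Hn].
  - rewrite !Rminus_diag. rewrite Rmult_0_r, Rminus_0_r, Rabs_R0. lra.
  - specialize (Hd (y - x)). replace (x + (y - x)) with y in Hd by ring.
    replace (f y - f x - l * (y - x)) with (((f y - f x) / (y - x) - l) * (y - x)) by (field; lra).
    rewrite Rabs_mult. apply Rmult_le_compat_r; [apply Rabs_pos|].
    left. apply Hd; [lra | easy].
Qed.

(** * Absolute continuity and monotonicity *)

(** For [lo = -1] and [hi = 1] this unfolds to the same proposition as [abs_cont], so eigenfunctions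
    enter and leave this form by conversion. *)
Definition abs_cont_on (lo hi : R) (f : R -> R) : Prop :=
  forall eps, 0 < eps ->
    exists delta, 0 < delta /\
      forall (n : nat) (a b : nat -> R),
        (forall i, (i < n)%nat -> lo <= a i /\ a i <= b i /\ b i <= hi) ->
        (forall i, (S i < n)%nat -> b i <= a (S i)) ->
        rsum (fun i => b i - a i) n < delta ->
        rsum (fun i => Rabs (f (b i) - f (a i))) n < eps.

Lemma ac_sub lo hi lo' hi' f :
  lo <= lo' -> hi' <= hi -> abs_cont_on lo hi f -> abs_cont_on lo' hi' f.
Proof.
  intros H1 H2 H eps He. destruct (H eps He) as (d & Hd & Hf).
  exists d. split; [easy|]. intros n a b Ha Hb Hs. apply Hf; auto.
  intros i Hi. specialize (Ha i Hi). lra.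
Qed.

(** Two dominating functions are enough for sums and products; multiples, compositions and inverses
    below also reduce to such a pointwise estimate of increments. *)
Lemma ac_dom lo hi F G1 G2 C :
  abs_cont_on lo hi G1 -> abs_cont_on lo hi G2 ->
  (forall x y, lo <= x -> x <= y -> y <= hi ->
     Rabs (F y - F x) <= C * (Rabs (G1 y - G1 x) + Rabs (G2 y - G2 x))) ->
  abs_cont_on lo hi F.
Proof.
  intros H1 H2 HF eps He.
  (* [C] may be zero or negative; [C'] is a positive constant above it. *)
  set (C' := Rabs C + 1).
  assert (HC' : 0 < C') by (unfold C'; pose proof (Rabs_pos C); lra).
  assert (He' : 0 < eps / (2 * C')) by (apply Rdiv_lt_0_compat; lra).
  destruct (H1 _ He') as (d1 & Hd1 & K1). destruct (H2 _ He') as (d2 & Hd2 & K2).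
  exists (Rmin d1 d2). split; [now apply Rmin_pos|].
  intros n a b Ha Hb Hs.
  pose proof (Rmin_l d1 d2). pose proof (Rmin_r d1 d2).
  specialize (K1 n a b Ha Hb ltac:(lra)). specialize (K2 n a b Ha Hb ltac:(lra)).
  apply Rle_lt_trans with
    (C' * (rsum (fun i => Rabs (G1 (b i) - G1 (a i))) n + rsum (fun i => Rabs (G2 (b i) - G2 (a i))) n)).
  - rewrite <- rsum_plus, <- rsum_scal. apply rsum_le. intros i Hi.
    destruct (Ha i Hi) as (? & ? & ?).
    apply Rle_trans with (1 := HF (a i) (b i) ltac:(easy) ltac:(easy) ltac:(easy)).
    apply Rmult_le_compat_r.
    + pose proof (Rabs_pos (G1 (b i) - G1 (a i))). pose proof (Rabs_pos (G2 (b i) - G2 (a i))). lra.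
    + unfold C'. pose proof (Rle_abs C). lra.
  - apply Rlt_le_trans with (C' * (eps / (2 * C') + eps / (2 * C'))).
    + apply Rmult_lt_compat_l; lra.
    + right. field. lra.
Qed.

Lemma ac_id lo hi : abs_cont_on lo hi (fun x => x).
Proof.
  intros eps He. exists eps. split; [easy|]. intros n a b Ha Hb Hs.
  rewrite (rsum_ext _ (fun i => b i - a i)); [easy|].
  intros i Hi. specialize (Ha i Hi). apply Rabs_pos_eq. lra.
Qed.

Lemma ac_lipschitz lo hi F C :
  (forall x y, lo <= x -> x <= y -> y <= hi -> Rabs (F y - F x) <= C * (y - x)) ->
  abs_cont_on lo hi F.
Proof.
  intros H. apply ac_dom with (G1 := fun x => x) (G2 := fun x => x) (C := C / 2).
  - apply ac_id.
  - apply ac_id.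
  - intros x y Hx Hxy Hy. apply Rle_trans with (1 := H x y Hx Hxy Hy).
    rewrite Rabs_pos_eq by lra. lra.
Qed.

Lemma ac_const lo hi c : abs_cont_on lo hi (fun _ => c).
Proof.
  apply ac_lipschitz with (C := 0). intros. rewrite Rminus_diag, Rabs_R0. lra.
Qed.

Lemma ac_unif lo hi F : abs_cont_on lo hi F ->
  forall eps, 0 < eps -> exists d, 0 < d /\ forall x y, lo <= x <= hi -> lo <= y <= hi ->
    Rabs (y - x) < d -> Rabs (F y - F x) < eps.
Proof.
  intros H eps He. destruct (H eps He) as (d & Hd & K). exists d. split; [easy|].
  assert (W : forall x y, lo <= x -> x <= y -> y <= hi -> y - x < d -> Rabs (F y - F x) < eps).
  { intros x y Hx Hxy Hy Hl.
    specialize (K 1%nat (fun _ => x) (fun _ => y)). simpl in K.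
    rewrite !Rplus_0_l in K. apply K; auto. intros; lia. }
  intros x y Hx Hy Hl. apply Rabs_def2 in Hl.
  destruct (Rle_dec x y).
  - apply W; lra.
  - rewrite Rabs_minus_sym. apply W; lra.
Qed.

(* Completeness replaces compactness: the supremum of the points reached from [a] is its own tag. *)
Lemma cousin (P : R -> R -> Prop) a b : a <= b ->
  (forall c d e, a <= c -> c <= d -> d <= e -> e <= b -> P c d -> P d e -> P c e) ->
  (forall x, a <= x <= b -> exists dl, 0 < dl /\ forall c d, a <= c -> c <= x -> x <= d -> d <= b ->
     x - dl < c -> d < x + dl -> P c d) ->
  P a b.
Proof.
  intros Hab Hadd Hloc.
  set (E := fun x => a <= x <= b /\ P a x).
  assert (Ea : E a).
  { split; [lra|]. destruct (Hloc a) as (dl & Hdl & H); [lra|]. apply H; lra. }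
  destruct (completeness E) as [s [Hub Hlub]].
  { exists b. intros x [Hx _]. lra. }
  { now exists a. }
  assert (Has : a <= s) by now apply Hub.
  assert (Hsb : s <= b) by (apply Hlub; intros x [Hx _]; lra).
  destruct (Hloc s) as (dl & Hdl & H); [lra|].
  assert (Hx : exists x, E x /\ s - dl < x).
  { apply NNPP. intros Hn. assert (s <= s - dl); [|lra].
    apply Hlub. intros x Ex. apply Rnot_lt_le. intros Hlt. apply Hn. now exists x. }
  destruct Hx as (x & Ex & Hxs). pose proof (Hub x Ex) as Hxs'. destruct Ex as [Hx HP].
  assert (Ps : P a s).
  { apply Hadd with x; try lra; auto. apply H; lra. }
  destruct (Req_dec s b) as [<-|Hne]; [easy|].
  set (t := Rmin b (s + dl / 2)).
  assert (Ht : s < t) by (apply Rmin_glb_lt; lra).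
  assert (Htb : t <= b) by apply Rmin_l.
  assert (Hts : t <= s + dl / 2) by apply Rmin_r.
  assert (E t).
  { split; [lra|]. apply Hadd with s; try lra; auto. apply H; lra. }
  pose proof (Hub t H0). lra.
Qed.

(** [F] is controlled on the interval only and may be discontinuous at its ends as a function on the
    line, so the bound comes from [cousin] and uniform continuity inside the interval. *)
Lemma ac_bounded lo hi F : lo <= hi -> abs_cont_on lo hi F ->
  exists B, 0 < B /\ forall x, lo <= x <= hi -> Rabs (F x) <= B.
Proof.
  intros Hl H. destruct (ac_unif lo hi F H 1) as (d & Hd & K); [lra|].
  apply (cousin (fun c e => exists B, 0 < B /\ forall x, c <= x <= e -> Rabs (F x) <= B) lo hi Hl).
  - intros c e f _ _ _ _ (B1 & H1 & K1) (B2 & H2 & K2). exists (Rmax B1 B2). split.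
    + eapply Rlt_le_trans; [exact H1 | apply Rmax_l].
    + intros x Hx. destruct (Rle_dec x e).
      * eapply Rle_trans; [apply K1; lra | apply Rmax_l].
      * eapply Rle_trans; [apply K2; lra | apply Rmax_r].
  - intros x Hx. exists d. split; [easy|]. intros c e Hc Hcx Hxe He Hxd Hed.
    exists (Rabs (F x) + 1). split; [pose proof (Rabs_pos (F x)); lra|].
    intros y Hy. assert (Rabs (F y - F x) < 1) by (apply K; try apply Rabs_def1; lra).
    replace (F y) with (F x + (F y - F x)) by ring.
    eapply Rle_trans; [apply Rabs_triang|]. lra.
Qed.

Lemma ac_plus lo hi F G : abs_cont_on lo hi F -> abs_cont_on lo hi G ->
  abs_cont_on lo hi (fun x => F x + G x).
Proof.
  intros HF HG. apply ac_dom with (G1 := F) (G2 := G) (C := 1); auto.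
  intros x y _ _ _. rewrite Rmult_1_l.
  replace (F y + G y - (F x + G x)) with ((F y - F x) + (G y - G x)) by ring.
  apply Rabs_triang.
Qed.

Lemma ac_scal lo hi c F : abs_cont_on lo hi F -> abs_cont_on lo hi (fun x => c * F x).
Proof.
  intros HF. apply ac_dom with (G1 := F) (G2 := F) (C := Rabs c); auto.
  intros x y _ _ _. rewrite <- Rmult_minus_distr_l, Rabs_mult.
  apply Rmult_le_compat_l; [apply Rabs_pos|]. pose proof (Rabs_pos (F y - F x)). lra.
Qed.

Lemma ac_mult lo hi F G : lo <= hi -> abs_cont_on lo hi F -> abs_cont_on lo hi G ->
  abs_cont_on lo hi (fun x => F x * G x).
Proof.
  intros Hl HF HG.
  destruct (ac_bounded lo hi F Hl HF) as (B1 & P1 & K1).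
  destruct (ac_bounded lo hi G Hl HG) as (B2 & P2 & K2).
  apply ac_dom with (G1 := F) (G2 := G) (C := B1 + B2); auto.
  intros x y Hx Hxy Hy.
  replace (F y * G y - F x * G x) with ((F y - F x) * G y + F x * (G y - G x)) by ring.
  eapply Rle_trans; [apply Rabs_triang|]. rewrite !Rabs_mult.
  pose proof (Rabs_pos (F y - F x)). pose proof (Rabs_pos (G y - G x)).
  pose proof (K2 y ltac:(lra)). pose proof (K1 x ltac:(lra)).
  pose proof (Rabs_pos (F x)). pose proof (Rabs_pos (G y)). nra.
Qed.

Lemma deriv_incr_bound f f' a b B : a <= b ->
  (forall x, a <= x <= b -> derivable_pt_lim f x (f' x)) ->
  (forall x, a <= x <= b -> Rabs (f' x) <= B) -> Rabs (f b - f a) <= B * (b - a).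
Proof.
  intros [Hab | <-] Hd HB.
  - destruct (MVT_cor2 f f' a b Hab Hd) as (c & -> & Hc).
    rewrite Rabs_mult, (Rabs_pos_eq (b - a)) by lra.
    apply Rmult_le_compat_r; [lra|]. apply HB. lra.
  - rewrite !Rminus_diag, Rabs_R0. lra.
Qed.

Lemma ac_comp lo hi F h h' : lo <= hi -> abs_cont_on lo hi F ->
  (forall x, derivable_pt_lim h x (h' x)) -> continuity h' ->
  abs_cont_on lo hi (fun x => h (F x)).
Proof.
  intros Hl HF Hh Hc. destruct (ac_bounded lo hi F Hl HF) as (B & HB & K).
  destruct (continuity_ab_maj (fun x => Rabs (h' x)) (-B) B) as (M & HM & _); [lra|..].
  { intros c _. apply (continuity_pt_comp h' Rabs); [apply Hc | apply Rcontinuity_abs]. }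
  apply ac_dom with (G1 := F) (G2 := F) (C := Rabs (h' M)); auto.
  intros x y Hx Hxy Hy.
  pose proof (Rabs_pos (F y - F x)) as HP. pose proof (Rabs_pos (h' M)) as HP'.
  assert (Hx' := K x ltac:(lra)). assert (Hy' := K y ltac:(lra)).
  apply Rabs_le_between in Hx'. apply Rabs_le_between in Hy'.
  apply Rle_trans with (Rabs (h' M) * Rabs (F y - F x)); [|nra].
  destruct (Rle_dec (F x) (F y)).
  - rewrite (Rabs_pos_eq (F y - F x)) by lra.
    apply deriv_incr_bound with h'; auto. intros z Hz. apply HM. lra.
  - rewrite (Rabs_minus_sym (h _)), (Rabs_minus_sym (F y)), (Rabs_pos_eq (F x - F y)) by lra.
    apply deriv_incr_bound with h'; auto; [lra|]. intros z Hz. apply HM. lra.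
Qed.

Lemma ac_C1 lo hi f f' : lo <= hi -> (forall x, derivable_pt_lim f x (f' x)) -> continuity f' ->
  abs_cont_on lo hi f.
Proof.
  intros Hl Hd Hc. exact (ac_comp lo hi (fun x => x) f f' Hl (ac_id lo hi) Hd Hc).
Qed.

Lemma ac_ext lo hi f g : (forall x, lo <= x <= hi -> f x = g x) ->
  abs_cont_on lo hi f -> abs_cont_on lo hi g.
Proof.
  intros He Hf. apply ac_dom with (G1 := f) (G2 := f) (C := 1); auto.
  intros x y Hx Hxy Hy. rewrite !He by lra. pose proof (Rabs_pos (g y - g x)). lra.
Qed.

(** The projection onto [[a, b]]. It extends functions known on an interval continuously to the
    line; moreover its increment over another interval is the length of the overlap with
    [[a, b]]. *)
Definition clamp (a b x : R) : R := Rmax a (Rmin b x).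

Lemma clamp_in a b x : a <= b -> a <= clamp a b x <= b.
Proof.
  intros H. unfold clamp. split; [apply Rmax_l|]. apply Rmax_lub; [easy|apply Rmin_l].
Qed.

Lemma clamp_id a b x : a <= x <= b -> clamp a b x = x.
Proof. intros H. unfold clamp. rewrite Rmin_right, Rmax_right; lra. Qed.

Lemma clamp_le a b x y : x <= y -> clamp a b x <= clamp a b y.
Proof.
  intros H. unfold clamp. apply Rle_max_compat_l. apply Rle_min_compat_l. easy.
Qed.

Lemma clamp_lip a b x y : Rabs (clamp a b y - clamp a b x) <= Rabs (y - x).
Proof.
  unfold clamp, Rmax, Rmin.
  repeat destruct Rle_dec; unfold Rabs; repeat destruct Rcase_abs; lra.
Qed.

(* The points of the exceptional null set are tagged with one of the covering intervals; the total
   increment of [F] over those is small by absolute continuity. *)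
Lemma ac_nondecreasing F a b : -1 <= a -> a <= b -> b <= 1 -> abs_cont_on a b F ->
  ae (fun x => a < x < b -> exists l, derivable_pt_lim F x l /\ 0 <= l) ->
  F a <= F b.
Proof.
  intros Ha Hab Hb HAC Hae.
  apply Rnot_lt_le. intros Hlt.
  (* [eps * (b - a + 1)] is half of the supposed drop: [eps] per unit length from the good points,
     and one more [eps] for the increments over the bad intervals. *)
  set (eps := (F a - F b) / (2 * (b - a + 1))).
  assert (He : 0 < eps) by (apply Rdiv_lt_0_compat; lra).
  destruct (HAC eps He) as (dl & Hdl & HF).
  (* The ends [a] and [b] join the exceptional set, since nothing is known about a derivative
     there. *)
  assert (Hae' : ae (fun x => exists l, a < x < b /\ derivable_pt_lim F x l /\ 0 <= l \/ (x < a \/ x > b))).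
  { apply ae_mp2 with (1 := Hae) (2 := ae_and _ _ (ae_neq a) (ae_neq b)).
    intros x _ H [Hna Hnb]. destruct (Rlt_dec x a); [exists 0; lra|]. destruct (Rlt_dec b x); [exists 0; lra|].
    destruct (H ltac:(lra)) as (l & Hl). exists l. left. split; [lra|easy]. }
  destruct (Hae' (dl / 2)) as (A & B & HAB & Hcov & Hsum); [lra|].
  (* An increment of [Phi N] over an interval adds up its overlaps with the first [N] intervals of
     the cover. *)
  set (Phi := fun N x => rsum (fun k => clamp (A k) (B k) x) N).
  assert (Phi_incr : forall N M c d, c <= d -> (N <= M)%nat -> Phi N d - Phi N c <= Phi M d - Phi M c).
  { intros N M c d Hcd HNM. unfold Phi.
    assert (E : forall K, rsum (fun k => clamp (A k) (B k) d) K - rsum (fun k => clamp (A k) (B k) c) K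
              = rsum (fun k => clamp (A k) (B k) d - clamp (A k) (B k) c) K).
    { induction K; simpl; lra. }
    rewrite !E. apply rsum_mono; auto. intros k.
    pose proof (clamp_le (A k) (B k) c d Hcd). lra. }
  (* [F] loses at most [eps] per unit length on [[c, d]], apart from finitely many ordered
     subintervals whose total length is paid for by the cover. In this form the property is
     additive, as [cousin] requires. *)
  set (P := fun c d => exists (n : nat) (u v : nat -> R) (N : nat),
    (forall i, (i < n)%nat -> c <= u i /\ u i <= v i /\ v i <= d) /\
    (forall i, (S i < n)%nat -> v i <= u (S i)) /\
    rsum (fun i => v i - u i) n <= Phi N d - Phi N c /\
    - eps * (d - c) - rsum (fun i => Rabs (F (v i) - F (u i))) n <= F d - F c).
  assert (HP : P a b).
  { apply cousin; auto.
    - intros c d e Hc Hcd Hde He' (n1 & u1 & v1 & N1 & A1 & A2 & A3 & A4)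
        (n2 & u2 & v2 & N2 & B1 & B2 & B3 & B4).
      exists (n1 + n2)%nat, (fun i => if Nat.ltb i n1 then u1 i else u2 (i - n1)%nat),
        (fun i => if Nat.ltb i n1 then v1 i else v2 (i - n1)%nat), (Nat.max N1 N2).
      split; [|split; [|split]].
      + intros i Hi. destruct (Nat.ltb_spec i n1).
        * specialize (A1 i ltac:(easy)). lra.
        * specialize (B1 (i - n1)%nat ltac:(lia)). lra.
      + intros i Hi. destruct (Nat.ltb_spec i n1); destruct (Nat.ltb_spec (S i) n1).
        * auto.
        * specialize (A1 i ltac:(easy)). specialize (B1 (S i - n1)%nat ltac:(lia)). lra.
        * lia.
        * replace (S i - n1)%nat with (S (i - n1)) by lia. apply B2. lia.
      + rewrite rsum_app.
        rewrite (rsum_ext _ (fun i => v1 i - u1 i)).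
        2:{ intros i Hi. destruct (Nat.ltb_spec i n1); [easy|lia]. }
        rewrite (rsum_ext _ (fun i => v2 i - u2 i) n2).
        2:{ intros i Hi. destruct (Nat.ltb_spec (n1 + i) n1); [lia|].
            now replace (n1 + i - n1)%nat with i by lia. }
        pose proof (Phi_incr N1 (Nat.max N1 N2) c d Hcd ltac:(lia)).
        pose proof (Phi_incr N2 (Nat.max N1 N2) d e Hde ltac:(lia)). lra.
      + rewrite rsum_app.
        rewrite (rsum_ext _ (fun i => Rabs (F (v1 i) - F (u1 i)))).
        2:{ intros i Hi. destruct (Nat.ltb_spec i n1); [easy|lia]. }
        rewrite (rsum_ext _ (fun i => Rabs (F (v2 i) - F (u2 i))) n2).
        2:{ intros i Hi. destruct (Nat.ltb_spec (n1 + i) n1); [lia|].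
            now replace (n1 + i - n1)%nat with i by lia. }
        lra.
    - intros x Hx.
      destruct (classic (exists l, a < x < b /\ derivable_pt_lim F x l /\ 0 <= l \/ (x < a \/ x > b)))
        as [(l & [(Hx' & Hl & Hl0) | ?]) | Hbad]; [|lra|].
      + destruct (dpl_bound F x l eps Hl He) as (d & Hd & K). exists d. split; [easy|].
        intros c e Hc Hcx Hxe Heb Hdc Hed.
        exists O, (fun _ => 0), (fun _ => 0), O.
        split; [intros; lia|]. split; [intros; lia|]. split; [simpl; unfold Phi; simpl; lra|].
        simpl. assert (K1 := K c ltac:(apply Rabs_def1; lra)). assert (K2 := K e ltac:(apply Rabs_def1; lra)).
        rewrite (Rabs_minus_sym c), (Rabs_pos_eq (x - c)) in K1 by lra.
        rewrite (Rabs_pos_eq (e - x)) in K2 by lra.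
        apply Rabs_le_between in K1. apply Rabs_le_between in K2. nra.
      + destruct (Hcov x) as [k Hk]. { split; [unfold in_I; lra | easy]. }
        exists (Rmin (x - A k) (B k - x)). split; [apply Rmin_pos; lra|].
        intros c e Hc Hcx Hxe Heb Hdc Hed.
        pose proof (Rmin_l (x - A k) (B k - x)). pose proof (Rmin_r (x - A k) (B k - x)).
        exists 1%nat, (fun _ => c), (fun _ => e), (S k).
        split; [intros; lra|]. split; [intros; lia|]. split.
        * unfold Phi. simpl. rewrite (clamp_id _ _ e), (clamp_id _ _ c) by lra.
          assert (rsum (fun k0 => clamp (A k0) (B k0) c) k <= rsum (fun k0 => clamp (A k0) (B k0) e) k).
          { apply rsum_le. intros. apply clamp_le. lra. }
          lra.
        * simpl. pose proof (Rle_abs (- (F e - F c))). rewrite Rabs_Ropp in H1. nra. }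
  destruct HP as (n & u & v & N & A1 & A2 & A3 & A4).
  assert (rsum (fun i => Rabs (F (v i) - F (u i))) n < eps).
  { apply HF; auto. apply Rle_lt_trans with (1 := A3).
    apply Rle_lt_trans with (dl / 2); [|lra]. apply Rle_trans with (2 := Hsum N).
    unfold Phi. clear - HAB. induction N; simpl; [lra|].
    pose proof (clamp_in (A N) (B N) a (HAB N)). pose proof (clamp_in (A N) (B N) b (HAB N)). lra. }
  assert (eps * (b - a + 1) = (F a - F b) / 2) by (unfold eps; field; lra).
  lra.
Qed.

(* [F] is a primitive of [f]: every integral below is an increment of such an [F]. *)
Definition acd (a b : R) (F f : R -> R) : Prop :=
  abs_cont_on a b F /\ ae (fun x => a < x < b -> derivable_pt_lim F x (f x)).

Lemma acd_sub a b a' b' F f : a <= a' -> b' <= b -> acd a b F f -> acd a' b' F f.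
Proof.
  intros H1 H2 [HA HD]. split; [now apply ac_sub with a b|].
  apply ae_mp with (1 := HD). intros x _ H Hx. apply H. lra.
Qed.

Lemma acd_eq_deriv a b F f g : acd a b F f -> ae (fun x => a < x < b -> f x = g x) -> acd a b F g.
Proof.
  intros [HA HD] He. split; auto. apply ae_mp2 with (1 := HD) (2 := He).
  intros x _ H1 H2 Hx. rewrite <- H2 by easy. auto.
Qed.

Lemma acd_eq_deriv' a b F f g : acd a b F f -> (forall x, f x = g x) -> acd a b F g.
Proof. intros H He. apply acd_eq_deriv with (1 := H). apply ae_all. auto. Qed.

Lemma acd_eq_fun a b F G f : acd a b F f -> (forall x, a <= x <= b -> G x = F x) -> acd a b G f.
Proof.
  intros [HA HD] He. split; [apply ac_ext with (2 := HA); intros; symmetry; auto|].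
  apply ae_mp with (1 := HD). intros x _ H Hx.
  apply dpl_on_interval with (f := F) (a := a) (b := b); auto. intros. apply He. lra.
Qed.

Lemma acd_const a b c : acd a b (fun _ => c) (fun _ => 0).
Proof. split; [apply ac_const|]. apply ae_all. intros. apply dpl_const. Qed.

Lemma acd_id a b : acd a b (fun x => x) (fun _ => 1).
Proof. split; [apply ac_id|]. apply ae_all. intros. apply dpl_id. Qed.

Lemma acd_plus a b F G f g : acd a b F f -> acd a b G g ->
  acd a b (fun x => F x + G x) (fun x => f x + g x).
Proof.
  intros [A1 D1] [A2 D2]. split; [now apply ac_plus|].
  apply ae_mp2 with (1 := D1) (2 := D2). intros x _ H1 H2 Hx. eapply dpl_plus; eauto.
Qed.

Lemma acd_scal a b c F f : acd a b F f -> acd a b (fun x => c * F x) (fun x => c * f x).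
Proof.
  intros [A1 D1]. split; [now apply ac_scal|].
  apply ae_mp with (1 := D1). intros x _ H1 Hx. eapply dpl_scal; eauto.
Qed.

Lemma acd_minus a b F G f g : acd a b F f -> acd a b G g ->
  acd a b (fun x => F x - G x) (fun x => f x - g x).
Proof.
  intros H1 H2. apply acd_eq_fun with (F := fun x => F x + (-1) * G x).
  - apply acd_eq_deriv' with (f := fun x => f x + (-1) * g x).
    + apply acd_plus; auto. now apply acd_scal.
    + intros; ring.
  - intros; ring.
Qed.

Lemma acd_mult a b F G f g : a <= b -> acd a b F f -> acd a b G g ->
  acd a b (fun x => F x * G x) (fun x => f x * G x + F x * g x).
Proof.
  intros Hab [A1 D1] [A2 D2]. split; [now apply ac_mult|].
  apply ae_mp2 with (1 := D1) (2 := D2). intros x _ H1 H2 Hx. eapply dpl_mult; eauto.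
Qed.

Lemma acd_comp a b F f h h' : a <= b -> acd a b F f ->
  (forall x, derivable_pt_lim h x (h' x)) -> continuity h' ->
  acd a b (fun x => h (F x)) (fun x => h' (F x) * f x).
Proof.
  intros Hab [A1 D1] Hh Hc. split; [now apply ac_comp with h'|].
  apply ae_mp with (1 := D1). intros x _ H1 Hx.
  exact (derivable_pt_lim_comp F h x _ _ (H1 Hx) (Hh (F x))).
Qed.

Lemma acd_C1 a b f f' : a <= b -> (forall x, derivable_pt_lim f x (f' x)) -> continuity f' ->
  acd a b f f'.
Proof.
  intros Hab Hd Hc. split; [now apply ac_C1 with f'|]. apply ae_all. auto.
Qed.

Lemma acd_le a b F G f g : -1 <= a -> a <= b -> b <= 1 -> acd a b F f -> acd a b G g ->
  ae (fun x => a < x < b -> f x <= g x) -> F b - F a <= G b - G a.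
Proof.
  intros Ha Hab Hb HF HG Hle. destruct (acd_minus _ _ _ _ _ _ HG HF) as [HA HD].
  assert (G a - F a <= G b - F b); [|lra].
  apply (ac_nondecreasing (fun x => G x - F x) a b Ha Hab Hb HA).
  apply ae_mp2 with (1 := HD) (2 := Hle). intros x _ H1 H2 Hx.
  exists (g x - f x). split; auto. specialize (H2 Hx). lra.
Qed.

Lemma acd_same a b F G f g : -1 <= a -> a <= b -> b <= 1 -> acd a b F f -> acd a b G g ->
  ae (fun x => a < x < b -> f x = g x) -> F b - F a = G b - G a.
Proof.
  intros Ha Hab Hb HF HG He. apply Rle_antisym.
  - apply acd_le with f g; auto. apply ae_mp with (1 := He). intros x _ H Hx. rewrite H; auto. lra.
  - apply acd_le with g f; auto. apply ae_mp with (1 := He). intros x _ H Hx. rewrite H; auto. lra.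
Qed.

Lemma acd_nonneg a b F f : -1 <= a -> a <= b -> b <= 1 -> acd a b F f ->
  ae (fun x => a < x < b -> 0 <= f x) -> F a <= F b.
Proof.
  intros Ha Hab Hb HF Hle.
  pose proof (acd_le a b _ _ _ _ Ha Hab Hb (acd_const a b 0) HF Hle). lra.
Qed.

Lemma acd_zero a b F f : -1 <= a -> a <= b -> b <= 1 -> acd a b F f ->
  ae (fun x => a < x < b -> f x = 0) -> F b = F a.
Proof.
  intros Ha Hab Hb HF Hle.
  pose proof (acd_same a b _ _ _ _ Ha Hab Hb HF (acd_const a b 0) Hle). lra.
Qed.

Lemma acd_abs_le a b F G f g : -1 <= a -> a <= b -> b <= 1 -> acd a b F f -> acd a b G g ->
  ae (fun x => a < x < b -> Rabs (f x) <= g x) -> Rabs (F b - F a) <= G b - G a.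
Proof.
  intros Ha Hab Hb HF HG Hle. apply Rabs_le. split.
  - pose proof (acd_le a b _ _ _ _ Ha Hab Hb (acd_scal _ _ (-1) _ _ HF) HG) as H. simpl in H.
    assert (-1 * F b - -1 * F a <= G b - G a); [|lra]. apply H.
    apply ae_mp with (1 := Hle). intros x _ K Hx. specialize (K Hx). apply Rabs_le_between in K. lra.
  - apply acd_le with f g; auto. apply ae_mp with (1 := Hle). intros x _ K Hx.
    specialize (K Hx). apply Rabs_le_between in K. lra.
Qed.

(** If [P] failed throughout the interval, [- x] would vacuously have a nonnegative derivative a.e.
    there, hence be nondecreasing. This is how an interval is seen not to be null. *)
Lemma ae_exists a b P : -1 <= a -> a < b -> b <= 1 -> ae P -> exists x, a < x < b /\ P x.
Proof.
  intros Ha Hab Hb HP. apply NNPP. intros Hn.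
  assert (-1 * a <= -1 * b); [|lra].
  apply (ac_nondecreasing (fun x => -1 * x) a b); try lra.
  - apply ac_scal, ac_id.
  - apply ae_mp with (1 := HP). intros x _ Hx Hab'. exfalso. apply Hn. now exists x.
Qed.

Lemma ae_zero_cont F a b : -1 <= a -> a < b -> b <= 1 -> continuity F ->
  ae (fun x => a < x < b -> F x = 0) -> forall x, a <= x <= b -> F x = 0.
Proof.
  intros Ha Hab Hb Hc Hae x Hx. apply NNPP. intros Hn.
  destruct (Hc x (Rabs (F x))) as (d & Hd & K); [now apply Rabs_pos_lt|].
  set (c := Rmax a (x - d)). set (e := Rmin b (x + d)).
  assert (a <= c /\ x - d <= c) by (split; [apply Rmax_l|apply Rmax_r]).
  assert (e <= b /\ e <= x + d) by (split; [apply Rmin_l|apply Rmin_r]).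
  assert (c < e).
  { unfold c, e, Rmax, Rmin. repeat destruct Rle_dec; lra. }
  destruct (ae_exists c e _ ltac:(lra) H1 ltac:(lra) Hae) as (y & Hy & HFy).
  specialize (HFy ltac:(lra)).
  destruct (Req_dec x y) as [->|Hne]; [easy|].
  specialize (K y). simpl in K. unfold Rdist in K. rewrite HFy in K.
  rewrite Rminus_0_l, Rabs_Ropp in K. apply (Rlt_irrefl (Rabs (F x))). apply K.
  split; [now split|]. apply Rabs_def1; lra.
Qed.

(** * Covering the points of steep increase *)

(** Dyadic intervals of [[-1, 1]]: generation [m] has [2 ^ m] of them, and the parent of number [j]
    is number [Nat.div2 j] of the generation before. *)
Definition dy_len (m : nat) : R := 2 / 2 ^ m.
Definition dy_left (m j : nat) : R := -1 + INR j * dy_len m.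
Definition dy_incr (H : R -> R) (m j : nat) : R := H (dy_left m (S j)) - H (dy_left m j).
(** The mean slope of [H] exceeds [K / 4]. The factor 4 is the price of passing from an arbitrary
    interval with slope above [K] to a dyadic one, see [steep_near]. *)
Definition steep (H : R -> R) (K : R) (m j : nat) : Prop := K * dy_len m < 4 * dy_incr H m j.
(** A stopping rule over the proper ancestors. The steep intervals that pass it do not overlap, so
    the increments of [H] over them add up to at most its total increment. *)
Fixpoint no_steep_above (H : R -> R) (K : R) (m j : nat) : Prop :=
  match m with
  | O => True
  | S m' => ~ steep H K m' (Nat.div2 j) /\ no_steep_above H K m' (Nat.div2 j)
  end.
Definition maximal_steep H K m j : Prop := no_steep_above H K m j /\ steep H K m j.
Definition select (P : Prop) (x : R) : R := if excluded_middle_informative P then x else 0.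

Lemma select_true P x : P -> select P x = x.
Proof. intros H. unfold select. now destruct excluded_middle_informative. Qed.

Lemma select_false (P : Prop) x : ~ P -> select P x = 0.
Proof. intros H. unfold select. now destruct excluded_middle_informative. Qed.

Lemma dy_len_pos m : 0 < dy_len m.
Proof. unfold dy_len. apply Rdiv_lt_0_compat; [lra|]. apply pow_lt. lra. Qed.

Lemma dy_len_S m : dy_len m = 2 * dy_len (S m).
Proof. unfold dy_len. simpl. assert (2 ^ m <> 0) by (apply pow_nonzero; lra). field. easy. Qed.

Lemma dy_left_even m i : dy_left (S m) (2 * i) = dy_left m i.
Proof. unfold dy_left. rewrite (dy_len_S m), mult_INR. simpl. ring. Qed.

Lemma dy_left_S m j : dy_left m (S j) = dy_left m j + dy_len m.
Proof. unfold dy_left. rewrite S_INR. ring. Qed.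

Lemma dy_left_in m j : (j <= 2 ^ m)%nat -> -1 <= dy_left m j <= 1.
Proof.
  intros Hj. unfold dy_left. pose proof (dy_len_pos m) as Hp. pose proof (pos_INR j).
  apply le_INR in Hj. rewrite pow_INR in Hj. change (INR 2) with 2 in Hj.
  assert (E : dy_len m * 2 ^ m = 2).
  { unfold dy_len. assert (2 ^ m <> 0) by (apply pow_nonzero; lra). now field. }
  split; nra.
Qed.

Lemma div2_lt_pow m j : (j < 2 ^ S m)%nat -> (Nat.div2 j < 2 ^ m)%nat.
Proof. intros H. rewrite Nat.div2_div. apply Nat.Div0.div_lt_upper_bound. exact H. Qed.

Lemma dy_parent m j :
  dy_left m (Nat.div2 j) <= dy_left (S m) j /\
  dy_left (S m) j + dy_len (S m) <= dy_left m (Nat.div2 j) + dy_len m.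
Proof.
  rewrite <- (dy_left_even m (Nat.div2 j)), (dy_len_S m). unfold dy_left.
  pose proof (dy_len_pos (S m)) as Hp.
  assert (E : INR j = INR (2 * Nat.div2 j) + INR (Nat.b2n (Nat.odd j))).
  { rewrite <- plus_INR. f_equal. apply Nat.div2_odd. }
  rewrite E. destruct (Nat.odd j); split; cbn [Nat.b2n INR]; lra.
Qed.

Lemma maximal_steep_above H K m j : (j < 2 ^ m)%nat -> ~ no_steep_above H K m j ->
  exists m' j', (j' < 2 ^ m')%nat /\ maximal_steep H K m' j' /\
    dy_left m' j' <= dy_left m j /\ dy_left m j + dy_len m <= dy_left m' j' + dy_len m'.
Proof.
  revert j. induction m as [|m IH]; intros j Hj Hn.
  { exfalso. apply Hn. exact I. }
  pose proof (div2_lt_pow m j Hj) as Hd. pose proof (dy_parent m j) as [P1 P2].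
  destruct (classic (no_steep_above H K m (Nat.div2 j))) as [Hc|Hc].
  - exists m, (Nat.div2 j). split; [easy|]. split; [|split; lra]. split; [easy|].
    apply NNPP. intros Hs. apply Hn. now split.
  - destruct (IH _ Hd Hc) as (m' & j' & A1 & A2 & A3 & A4).
    exists m', j'. split; [easy|]. split; [easy|]. split; lra.
Qed.

Lemma maximal_steep_or_self H K m j : (j < 2 ^ m)%nat -> steep H K m j ->
  exists m' j', (j' < 2 ^ m')%nat /\ maximal_steep H K m' j' /\
    dy_left m' j' <= dy_left m j /\ dy_left m j + dy_len m <= dy_left m' j' + dy_len m'.
Proof.
  intros Hj Hs. destruct (classic (no_steep_above H K m j)) as [Hc|Hc].
  - exists m, j. split; [easy|]. split; [easy|]. split; lra.
  - now apply maximal_steep_above.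
Qed.

Section Cover.

Variables (H : R -> R) (K : R).
Hypothesis Hmono : forall x y, -1 <= x -> x <= y -> y <= 1 -> H x <= H y.
Hypothesis HK : 0 < K.

Lemma dy_incr_nonneg m j : (j < 2 ^ m)%nat -> 0 <= dy_incr H m j.
Proof.
  intros Hj. unfold dy_incr. pose proof (dy_left_in m j ltac:(lia)). pose proof (dy_left_in m (S j) ltac:(lia)).
  pose proof (dy_len_pos m). pose proof (dy_left_S m j).
  pose proof (Hmono (dy_left m j) (dy_left m (S j)) ltac:(lra) ltac:(lra) ltac:(lra)). lra.
Qed.

(** The increment of [H] is conserved: an interval not yet stopped either stops in generation [M] or
    hands its increment on to its two children. *)
Lemma maximal_steep_total M :
  rsum (fun m => rsum (fun j => select (maximal_steep H K m j) (dy_incr H m j)) (2 ^ m)) M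
  + rsum (fun j => select (no_steep_above H K M j) (dy_incr H M j)) (2 ^ M) = H 1 - H (-1).
Proof.
  induction M as [|M IH].
  - simpl. rewrite select_true by easy. unfold dy_incr, dy_left, dy_len. simpl.
    replace (-1 + 1 * (2 / 1)) with 1 by field. replace (-1 + 0 * (2 / 1)) with (-1) by field. ring.
  - rewrite <- IH. cbn [rsum]. rewrite Rplus_assoc. f_equal.
    rewrite (Nat.pow_succ_r' 2 M), rsum_double, <- rsum_plus. apply rsum_ext. intros i Hi.
    cbn [no_steep_above]. rewrite Nat.div2_double, Nat.div2_succ_double.
    unfold dy_incr. replace (S (S (2 * i))) with (2 * S i)%nat by lia. rewrite !dy_left_even.
    destruct (classic (no_steep_above H K M i)) as [Hc|Hc].
    + rewrite (select_true (no_steep_above H K M i)) by easy.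
      destruct (classic (steep H K M i)) as [Hs|Hs].
      * rewrite select_true by now split. rewrite !select_false by tauto. ring.
      * rewrite select_false by (unfold maximal_steep; tauto).
        rewrite !select_true by tauto. ring.
    + rewrite select_false by (unfold maximal_steep; tauto). rewrite !select_false by tauto. ring.
Qed.

Lemma maximal_steep_length M :
  rsum (fun m => rsum (fun j => select (maximal_steep H K m j) (dy_len m)) (2 ^ m)) M
  <= 4 * (H 1 - H (-1)) / K.
Proof.
  rewrite <- (maximal_steep_total M).
  assert (0 <= rsum (fun j => select (no_steep_above H K M j) (dy_incr H M j)) (2 ^ M)).
  { apply rsum_nonneg. intros j Hj. unfold select. destruct excluded_middle_informative; [|lra].
    now apply dy_incr_nonneg. }
  apply Rmult_le_reg_l with K; [easy|].
  replace (K * (4 * _ / K)) with (4 * rsum (fun m => rsum (fun j => select (maximal_steep H K m j) (dy_incr H m j)) (2 ^ m)) M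
     + 4 * rsum (fun j => select (no_steep_above H K M j) (dy_incr H M j)) (2 ^ M)) by (field; lra).
  assert (K * rsum (fun m => rsum (fun j => select (maximal_steep H K m j) (dy_len m)) (2 ^ m)) M <=
    4 * rsum (fun m => rsum (fun j => select (maximal_steep H K m j) (dy_incr H m j)) (2 ^ m)) M); [|lra].
  rewrite <- !rsum_scal. apply rsum_le. intros m _. rewrite <- !rsum_scal. apply rsum_le. intros j Hj.
  destruct (classic (maximal_steep H K m j)) as [Hs|Hs].
  - rewrite !select_true by easy. destruct Hs as [_ Hs]. unfold steep in Hs. lra.
  - rewrite !select_false by easy. lra.
Qed.

(** Binary heap numbering: [n + 1 = 2 ^ m + j] runs through all pairs with [j < 2 ^ m], which turns
    the tree of intervals into the single sequence that [null_set] asks for. *)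
Lemma heap_sum (g : nat -> nat -> R) M :
  rsum (fun n => g (Nat.log2 (S n)) (S n - 2 ^ Nat.log2 (S n))%nat) (2 ^ M - 1)
  = rsum (fun m => rsum (fun j => g m j) (2 ^ m)) M.
Proof.
  induction M as [|M IH]; [easy|].
  assert (Hp : (2 ^ M <> 0)%nat) by (apply Nat.pow_nonzero; lia).
  replace (2 ^ S M - 1)%nat with ((2 ^ M - 1) + 2 ^ M)%nat by (simpl; lia).
  rewrite rsum_app, IH. cbn [rsum]. f_equal. apply rsum_ext. intros j Hj.
  replace (S (2 ^ M - 1 + j)) with (2 ^ M + j)%nat by lia.
  assert (E : Nat.log2 (2 ^ M + j) = M).
  { apply Nat.log2_unique; [lia|]. simpl. lia. }
  rewrite E. f_equal. lia.
Qed.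

Lemma dyadic_scale d : 0 < d <= 2 -> exists m, d <= dy_len m < 2 * d.
Proof.
  intros Hd. apply NNPP. intros Hn.
  assert (Hall : forall m, 2 * d <= dy_len m).
  { induction m as [|m IH].
    - apply Rnot_lt_le. intros Hl. apply Hn. exists O. unfold dy_len in *. simpl in *. lra.
    - apply Rnot_lt_le. intros Hl. apply Hn. exists (S m). rewrite (dy_len_S m) in IH. lra. }
  destruct (pow_lt_1_zero (1 / 2)) with (y := d) as [N HN].
  - rewrite Rabs_pos_eq; lra.
  - easy.
  - specialize (HN N (le_n _)). specialize (Hall N). unfold dy_len in Hall.
    rewrite Rabs_pos_eq in HN by (apply pow_le; lra).
    replace (1 / 2) with (/ 2) in HN by lra. rewrite pow_inv in HN. unfold Rdiv in Hall. lra.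
Qed.

(** At a dyadic scale between [y - x] and twice that, two neighbouring intervals contain [[x, y]].
    Together they carry more than [K * (y - x)], which exceeds half of [K] times the dyadic length,
    so one of them carries more than a quarter. *)
Lemma steep_near x y : -1 <= x -> x < y -> y <= 1 -> K * (y - x) < H y - H x ->
  exists m j, (j < 2 ^ m)%nat /\ steep H K m j /\
    dy_left m j - dy_len m <= x /\ y <= dy_left m j + 2 * dy_len m.
Proof.
  intros Hx Hxy Hy Hs.
  destruct (dyadic_scale (y - x)) as [m [Hm1 Hm2]]; [lra|].
  pose proof (dy_len_pos m) as Hp.
  destruct (nfloor_ex ((x + 1) / dy_len m)) as [j [Hj1 Hj2]].
  { apply Rdiv_le_0_compat; lra. }
  apply (Rmult_le_compat_r (dy_len m)) in Hj1; [|lra].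
  apply (Rmult_lt_compat_r (dy_len m)) in Hj2; [|lra].
  replace ((x + 1) / dy_len m * dy_len m) with (x + 1) in Hj1, Hj2 by (field; lra).
  assert (E : dy_len m * 2 ^ m = 2).
  { unfold dy_len. assert (2 ^ m <> 0) by (apply pow_nonzero; lra). now field. }
  assert (Hlt : forall i, dy_left m i < 1 -> (i < 2 ^ m)%nat).
  { intros i Hi. apply INR_lt. rewrite pow_INR. change (INR 2) with 2. unfold dy_left in Hi.
    apply Rmult_lt_reg_r with (dy_len m); [easy|]. lra. }
  assert (L1 : dy_left m j <= x) by (unfold dy_left; lra).
  assert (L2 : x < dy_left m j + dy_len m) by (unfold dy_left; lra).
  assert (Hj : (j < 2 ^ m)%nat) by (apply Hlt; lra).
  pose proof (dy_left_in m j ltac:(lia)). pose proof (dy_left_in m (S j) ltac:(lia)).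
  pose proof (dy_left_S m j) as ES.
  destruct (Rle_dec y (dy_left m (S j))) as [Hc|Hc].
  - exists m, j. split; [easy|]. split; [|split; lra].
    unfold steep, dy_incr.
    pose proof (Hmono (dy_left m j) x ltac:(lra) ltac:(lra) ltac:(lra)).
    pose proof (Hmono y (dy_left m (S j)) ltac:(lra) ltac:(lra) ltac:(lra)). nra.
  - assert (HSj : (S j < 2 ^ m)%nat) by (apply Hlt; lra).
    pose proof (dy_left_in m (S (S j)) ltac:(lia)). pose proof (dy_left_S m (S j)) as ESS.
    pose proof (Hmono (dy_left m j) x ltac:(lra) ltac:(lra) ltac:(lra)).
    pose proof (Hmono y (dy_left m (S (S j))) ltac:(lra) ltac:(lra) ltac:(lra)).
    destruct (Rlt_dec (K * dy_len m) (4 * dy_incr H m j)) as [Hd|Hd].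
    + exists m, j. split; [easy|]. split; [easy|]. split; lra.
    + exists m, (S j). split; [easy|]. split; [|split; lra].
      unfold steep, dy_incr in *. nra.
Qed.

(** A maximal inequality of weak type. Maximal steep intervals are enlarged to five times their
    length so as to contain both points strictly, and the constant 20 is this 5 times the 4 of
    [steep]. Both points are covered because the exceptional point in [finite_quotient_ae] can be
    either of them. *)
Lemma steep_cover :
  exists a b : nat -> R, (forall n, a n <= b n) /\
    (forall x y, -1 <= x -> x < y -> y <= 1 -> K * (y - x) < H y - H x ->
       (exists n, a n < x < b n) /\ (exists n, a n < y < b n)) /\
    (forall N, rsum (fun n => b n - a n) N <= 20 * (H 1 - H (-1)) / K).
Proof.
  set (lo := fun m j => select (maximal_steep H K m j) (dy_left m j - 2 * dy_len m)).
  set (hi := fun m j => select (maximal_steep H K m j) (dy_left m j + 3 * dy_len m)).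
  assert (E : forall m j, hi m j - lo m j = 5 * select (maximal_steep H K m j) (dy_len m)).
  { intros m j. unfold hi, lo, select. destruct excluded_middle_informative; ring. }
  assert (Hpos : forall m j, 0 <= select (maximal_steep H K m j) (dy_len m)).
  { intros m j. unfold select. pose proof (dy_len_pos m). destruct excluded_middle_informative; lra. }
  exists (fun n => lo (Nat.log2 (S n)) (S n - 2 ^ Nat.log2 (S n))%nat),
         (fun n => hi (Nat.log2 (S n)) (S n - 2 ^ Nat.log2 (S n))%nat).
  split; [|split].
  - intros n. pose proof (E (Nat.log2 (S n)) (S n - 2 ^ Nat.log2 (S n))%nat).
    pose proof (Hpos (Nat.log2 (S n)) (S n - 2 ^ Nat.log2 (S n))%nat). lra.
  - intros x y Hx Hxy Hy Hs.
    destruct (steep_near x y Hx Hxy Hy Hs) as (m & j & Hj & Hst & L1 & L2).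
    destruct (maximal_steep_or_self H K m j Hj Hst) as (m' & j' & Hj' & Hmax & I1 & I2).
    pose proof (dy_len_pos m). pose proof (dy_len_pos m').
    assert (W : forall z, dy_left m j - dy_len m <= z <= dy_left m j + 2 * dy_len m ->
      exists n, lo (Nat.log2 (S n)) (S n - 2 ^ Nat.log2 (S n))%nat < z <
                hi (Nat.log2 (S n)) (S n - 2 ^ Nat.log2 (S n))%nat).
    { intros z Hz. exists (2 ^ m' + j' - 1)%nat.
      assert (Hp : (2 ^ m' <> 0)%nat) by (apply Nat.pow_nonzero; lia).
      replace (S (2 ^ m' + j' - 1)) with (2 ^ m' + j')%nat by lia.
      assert (El : Nat.log2 (2 ^ m' + j') = m').
      { apply Nat.log2_unique; [lia|]. simpl. lia. }
      rewrite El. replace (2 ^ m' + j' - 2 ^ m')%nat with j' by lia.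
      unfold lo, hi. rewrite !select_true by easy. lra. }
    split; apply W; lra.
  - intros N. apply Rle_trans with (rsum (fun n =>
      hi (Nat.log2 (S n)) (S n - 2 ^ Nat.log2 (S n))%nat - lo (Nat.log2 (S n)) (S n - 2 ^ Nat.log2 (S n))%nat) (2 ^ N - 1)).
    + apply rsum_mono.
      * intros i. rewrite E. specialize (Hpos (Nat.log2 (S i)) (S i - 2 ^ Nat.log2 (S i))%nat). lra.
      * pose proof (Nat.pow_gt_lin_r 2 N ltac:(lia)). lia.
    + rewrite (heap_sum (fun m j => hi m j - lo m j)).
      rewrite (rsum_ext _ (fun m => 5 * rsum (fun j => select (maximal_steep H K m j) (dy_len m)) (2 ^ m))).
      * rewrite rsum_scal. pose proof (maximal_steep_length N). unfold Rdiv in *. lra.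
      * intros m _. rewrite <- rsum_scal. apply rsum_ext. intros; apply E.
Qed.

End Cover.

(** * Primitives of L1 functions *)

(** Restated with explicit abstractions, so that the tactic [cont] can match them. *)
Lemma cont_plus f g : continuity f -> continuity g -> continuity (fun x => f x + g x).
Proof. exact (continuity_plus f g). Qed.
Lemma cont_minus f g : continuity f -> continuity g -> continuity (fun x => f x - g x).
Proof. exact (continuity_minus f g). Qed.
Lemma cont_mult f g : continuity f -> continuity g -> continuity (fun x => f x * g x).
Proof. exact (continuity_mult f g). Qed.
Lemma cont_opp f : continuity f -> continuity (fun x => - f x).
Proof. exact (continuity_opp f). Qed.
Lemma cont_const c : continuity (fun _ => c).
Proof. intros x. apply continuity_pt_const. intros ? ?; easy. Qed.
Lemma cont_id : continuity (fun x => x).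
Proof. intros x. apply derivable_continuous_pt, derivable_pt_id. Qed.
Lemma cont_abs f : continuity f -> continuity (fun x => Rabs (f x)).
Proof. intros H. exact (continuity_comp f Rabs H Rcontinuity_abs). Qed.
Lemma cont_pow f n : continuity f -> continuity (fun x => f x ^ n).
Proof.
  intros H. induction n as [|n IH]; simpl; [apply cont_const|now apply cont_mult].
Qed.

Ltac cont := repeat first
  [ assumption | apply cont_const | apply cont_id | apply cont_plus | apply cont_minus | apply cont_mult
  | apply cont_opp | apply cont_abs | apply cont_pow ].

Lemma cont_dpl f f' : (forall x, derivable_pt_lim f x (f' x)) -> continuity f.
Proof. intros H x. apply derivable_continuous_pt. exists (f' x). apply H. Qed.

Lemma cont_clamp a b F : a <= b -> abs_cont_on a b F -> continuity (fun x => F (clamp a b x)).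
Proof.
  intros Hab HF x eps He. destruct (ac_unif a b F HF eps He) as (d & Hd & K).
  exists d. split; [easy|]. intros y [_ Hy]. simpl in *. unfold Rdist in *.
  apply K; try now apply clamp_in. eapply Rle_lt_trans; [apply clamp_lip|easy].
Qed.

(** A total function, whereas the integral in [L1] carries a proof of integrability; it is used for
    continuous integrands. *)
Definition prim0 (h : R -> R) (x : R) : R := RInt h (-1) x.

Lemma cont_coq h x : continuity h -> continuous h x.
Proof. intros Hc. apply continuity_pt_filterlim, Hc. Qed.

Lemma prim0_derive h : continuity h -> forall x, derivable_pt_lim (prim0 h) x (h x).
Proof.
  intros Hc x. apply is_derive_Reals. apply is_derive_RInt with (-1).
  - apply filter_forall. intros y. apply (RInt_correct h (-1) y), (ex_RInt_continuous (V := R_CompleteNormedModule)).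
    intros; now apply cont_coq.
  - now apply cont_coq.
Qed.

Lemma prim0_start h : prim0 h (-1) = 0.
Proof. exact (RInt_point (-1) h). Qed.

Lemma prim0_acd h a b : a <= b -> continuity h -> acd a b (prim0 h) h.
Proof. intros Hab Hc. apply acd_C1; auto. now apply prim0_derive. Qed.

Lemma prim0_Riemann h (pr : Riemann_integrable h (-1) 1) : prim0 h 1 = RiemannInt pr.
Proof. apply RInt_Reals. Qed.

Lemma prim0_dom h k1 k2 c1 c2 : continuity h -> continuity k1 -> continuity k2 ->
  (forall x, in_I x -> h x <= c1 * k1 x + c2 * k2 x) ->
  prim0 h 1 <= c1 * prim0 k1 1 + c2 * prim0 k2 1.
Proof.
  intros H0 H1 H2 Hle.
  pose proof (acd_le (-1) 1 _ _ _ _ ltac:(lra) ltac:(lra) ltac:(lra)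
    (prim0_acd h (-1) 1 ltac:(lra) H0)
    (acd_plus _ _ _ _ _ _ (acd_scal _ _ c1 _ _ (prim0_acd k1 (-1) 1 ltac:(lra) H1))
      (acd_scal _ _ c2 _ _ (prim0_acd k2 (-1) 1 ltac:(lra) H2)))) as K. cbv beta in K.
  simpl in K. rewrite !prim0_start in K. 
  assert (K' := K ltac:(apply ae_all; intros; auto)). lra.
Qed.

Definition L1_seq (g : nat -> R -> R) (p : R -> R) : Prop :=
  (forall n, continuity (g n)) /\
  (forall eps, 0 < eps -> exists N : nat, forall n m : nat, (N <= n)%nat -> (N <= m)%nat ->
     prim0 (fun x => Rabs (g n x - g m x)) 1 < eps) /\
  ae (fun x => Un_cv (fun n => g n x) (p x)).

Lemma L1_seq_iff p : L1 p <-> exists g, L1_seq g p.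
Proof.
  split; intros (g & Hc & HC & Hae); exists g; (split; [easy|]; split; [|easy]);
    intros eps He; destruct (HC eps He) as [N HN]; exists N; intros n m Hn Hm.
  - assert (Hcc : continuity (fun x => Rabs (g n x - g m x))) by (pose proof (Hc n); pose proof (Hc m); cont).
    assert (pr : Riemann_integrable (fun x => Rabs (g n x - g m x)) (-1) 1).
    { apply continuity_implies_RiemannInt; [lra|]. intros; apply Hcc. }
    rewrite (prim0_Riemann _ pr). now apply HN.
  - intros pr. rewrite <- (prim0_Riemann _ pr). now apply HN.
Qed.

Lemma L1_cont u : continuity u -> L1 u.
Proof.
  intros Hu. apply L1_seq_iff. exists (fun _ => u). split; [easy|]. split.
  - intros eps He. exists O. intros n m _ _.
    pose proof (prim0_dom (fun x => Rabs (u x - u x)) u u 0 0 ltac:(cont) Hu Hu) as K. cbv beta in K.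
    assert (K' := K ltac:(intros; rewrite Rminus_diag, Rabs_R0; lra)). lra.
  - apply ae_all. intros x _ eps He. exists O. intros. unfold Rdist. now rewrite Rminus_diag, Rabs_R0.
Qed.

Lemma L1_plus p r : L1 p -> L1 r -> L1 (fun x => p x + r x).
Proof.
  intros Hp Hr. apply L1_seq_iff in Hp. apply L1_seq_iff in Hr. apply L1_seq_iff.
  destruct Hp as (g & Gc & GC & Gae). destruct Hr as (h & Kc & KC & Kae).
  exists (fun n x => g n x + h n x). split; [|split].
  - intros n. specialize (Gc n). specialize (Kc n). cont.
  - intros eps He. destruct (GC (eps / 2)) as [N1 H1]; [lra|]. destruct (KC (eps / 2)) as [N2 H2]; [lra|].
    exists (Nat.max N1 N2). intros n m Hn Hm.
    specialize (H1 n m ltac:(lia) ltac:(lia)). specialize (H2 n m ltac:(lia) ltac:(lia)).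
    pose proof (Gc n). pose proof (Gc m). pose proof (Kc n). pose proof (Kc m).
    pose proof (prim0_dom (fun x => Rabs (g n x + h n x - (g m x + h m x)))
      (fun x => Rabs (g n x - g m x)) (fun x => Rabs (h n x - h m x)) 1 1
      ltac:(cont) ltac:(cont) ltac:(cont)) as K. cbv beta in K.
    assert (K' := K ltac:(intros x _;
      replace (g n x + h n x - (g m x + h m x)) with ((g n x - g m x) + (h n x - h m x)) by ring;
      pose proof (Rabs_triang (g n x - g m x) (h n x - h m x)); lra)). lra.
  - apply ae_mp2 with (1 := Gae) (2 := Kae). intros x _ A B. now apply CV_plus.
Qed.

Lemma L1_mult_cont p u : continuity u -> L1 p -> L1 (fun x => p x * u x).
Proof.
  intros Hu Hp. apply L1_seq_iff in Hp. apply L1_seq_iff. destruct Hp as (g & Gc & GC & Gae).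
  destruct (continuity_ab_maj (fun x => Rabs (u x)) (-1) 1 ltac:(lra)) as (M & HM & _).
  { intros c _. assert (Hcc : continuity (fun x => Rabs (u x))) by cont. apply Hcc. }
  set (B := Rabs (u M) + 1). assert (HB : 0 < B) by (unfold B; pose proof (Rabs_pos (u M)); lra).
  exists (fun n x => g n x * u x). split; [|split].
  - intros n. specialize (Gc n). cont.
  - intros eps He. destruct (GC (eps / B)) as [N1 H1]; [now apply Rdiv_lt_0_compat|].
    exists N1. intros n m Hn Hm. specialize (H1 n m Hn Hm). pose proof (Gc n). pose proof (Gc m).
    pose proof (prim0_dom (fun x => Rabs (g n x * u x - g m x * u x))
      (fun x => Rabs (g n x - g m x)) (fun x => Rabs (g n x - g m x)) B 0
      ltac:(cont) ltac:(cont) ltac:(cont)) as K. cbv beta in K.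
    assert (K' : prim0 (fun x => Rabs (g n x * u x - g m x * u x)) 1 <=
      B * prim0 (fun x => Rabs (g n x - g m x)) 1 + 0 * prim0 (fun x => Rabs (g n x - g m x)) 1).
    { apply K. intros x Hx. rewrite <- Rmult_minus_distr_r, Rabs_mult.
      specialize (HM x Hx). pose proof (Rabs_pos (g n x - g m x)). pose proof (Rabs_pos (u x)).
      unfold B. nra. }
    apply Rmult_lt_compat_l with (r := B) in H1; [|easy].
    replace (B * (eps / B)) with eps in H1 by (field; lra). lra.
  - apply ae_mp with (1 := Gae). intros x _ A. apply (CV_mult _ (fun _ => u x)); auto.
    intros eps He. exists O. intros. unfold Rdist. now rewrite Rminus_diag, Rabs_R0.
Qed.

Lemma L1_abs p : L1 p -> L1 (fun x => Rabs (p x)).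
Proof.
  intros Hp. apply L1_seq_iff in Hp. apply L1_seq_iff. destruct Hp as (g & Gc & GC & Gae).
  exists (fun n x => Rabs (g n x)). split; [|split].
  - intros n. specialize (Gc n). cont.
  - intros eps He. destruct (GC eps He) as [N1 H1].
    exists N1. intros n m Hn Hm. specialize (H1 n m Hn Hm). pose proof (Gc n). pose proof (Gc m).
    pose proof (prim0_dom (fun x => Rabs (Rabs (g n x) - Rabs (g m x)))
      (fun x => Rabs (g n x - g m x)) (fun x => Rabs (g n x - g m x)) 1 0
      ltac:(cont) ltac:(cont) ltac:(cont)) as K. cbv beta in K.
    assert (K' := K ltac:(intros x _; pose proof (Rabs_triang_inv2 (g n x) (g m x)); lra)). lra.
  - apply ae_mp with (1 := Gae). intros x _ A. now apply cv_cvabs.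
Qed.

Lemma L1_scal c p : L1 p -> L1 (fun x => c * p x).
Proof.
  intros Hp. pose proof (L1_mult_cont p (fun _ => c) (cont_const c) Hp) as H.
  apply L1_seq_iff in H. apply L1_seq_iff. destruct H as (g & A & B & C).
  exists g. split; [easy|]. split; [easy|]. apply ae_mp with (1 := C). intros x _ Hx.
  now rewrite Rmult_comm.
Qed.

Lemma L1_eq p r : (forall x, p x = r x) -> L1 p -> L1 r.
Proof.
  intros He Hp. apply L1_seq_iff in Hp. apply L1_seq_iff. destruct Hp as (g & A & B & C).
  exists g. split; [easy|]. split; [easy|]. apply ae_mp with (1 := C). intros x _ Hx. now rewrite <- He.
Qed.

(** The rate [(1 / 4) ^ k] leaves a convergent series even after multiplication by the weights
    [2 ^ k] of [L1_primitive]. *)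
Lemma L1_fast_seq p : L1 p -> exists g : nat -> R -> R, (forall n, continuity (g n)) /\
  (forall k, prim0 (fun x => Rabs (g (S k) x - g k x)) 1 <= (1 / 4) ^ k) /\
  ae (fun x => Un_cv (fun n => g n x) (p x)).
Proof.
  intros Hp. apply L1_seq_iff in Hp. destruct Hp as (g & Gc & GC & Gae).
  assert (HN : forall k, exists N : nat, forall n m : nat, (N <= n)%nat -> (N <= m)%nat ->
     prim0 (fun x => Rabs (g n x - g m x)) 1 < (1 / 4) ^ k).
  { intros k. apply GC. apply pow_lt. lra. }
  set (N := fun k => proj1_sig (constructive_indefinite_description _ (HN k))).
  assert (HN' : forall k n m, (N k <= n)%nat -> (N k <= m)%nat ->
     prim0 (fun x => Rabs (g n x - g m x)) 1 < (1 / 4) ^ k).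
  { intros k. exact (proj2_sig (constructive_indefinite_description _ (HN k))). }
  (* The indices dominate [N k], for the rate, and [k], for convergence along the subsequence. *)
  set (phi := fix phi k := match k with O => N O | S k' => (phi k' + N (S k') + 1)%nat end).
  assert (P1 : forall k, (N k <= phi k)%nat) by (intros [|k]; simpl; lia).
  assert (P2 : forall k, (k <= phi k)%nat) by (induction k; simpl; lia).
  exists (fun k => g (phi k)). split; [auto|]. split.
  - intros k. left. apply HN'; [|apply P1]. specialize (P1 k). simpl. lia.
  - apply ae_mp with (1 := Gae). intros x _ A eps He. destruct (A eps He) as [M HM].
    exists M. intros n Hn. apply HM. specialize (P2 n). lia.
Qed.

Lemma Un_cv_bound u l c B n : Un_cv u l -> (forall m, Rabs (u (n + m)%nat - c) <= B) -> Rabs (l - c) <= B.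
Proof.
  intros Hu HB. apply Rnot_lt_le. intros Hlt.
  destruct (Hu (Rabs (l - c) - B)) as [N HN]; [lra|].
  specialize (HN (n + N)%nat ltac:(lia)). specialize (HB N). unfold Rdist in HN.
  rewrite Rabs_minus_sym in HN.
  pose proof (Rabs_triang (l - u (n + N)%nat) (u (n + N)%nat - c)) as T.
  replace (l - u (n + N)%nat + (u (n + N)%nat - c)) with (l - c) in T by ring. lra.
Qed.

(** A weak form of Lebesgue's theorem on monotone functions. Points with unbounded quotients are
    steep for every [K], hence lie in covers of arbitrarily small total length. *)
Lemma finite_quotient_ae (H : R -> R) :
  (forall x y, -1 <= x -> x <= y -> y <= 1 -> H x <= H y) ->
  ae (fun x => exists K, 0 < K /\ forall y, in_I y -> Rabs (H y - H x) <= K * Rabs (y - x)).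
Proof.
  intros Hm eps He.
  (* The added 1 keeps [K] positive when [H] is constant. *)
  set (K := 20 * (H 1 - H (-1) + 1) / eps).
  pose proof (Hm (-1) 1 ltac:(lra) ltac:(lra) ltac:(lra)).
  assert (HK : 0 < K) by (apply Rdiv_lt_0_compat; lra).
  destruct (steep_cover H K Hm HK) as (a & b & A1 & A2 & A3).
  exists a, b. split; [easy|]. split.
  - intros x [Hx Hn].
    assert (Hy : exists y, in_I y /\ K * Rabs (y - x) < Rabs (H y - H x)).
    { apply NNPP. intros Hc. apply Hn. exists K. split; [easy|]. intros y Hy.
      apply Rnot_lt_le. intros Hlt. apply Hc. now exists y. }
    destruct Hy as (y & Hy & Hlt). unfold in_I in *.
    destruct (Rtotal_order x y) as [Hxy | [<- | Hxy]].
    + pose proof (Hm x y ltac:(lra) ltac:(lra) ltac:(lra)).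
      rewrite !Rabs_pos_eq in Hlt by lra.
      apply (A2 x y); lra.
    + rewrite !Rminus_diag, Rabs_R0 in Hlt. lra.
    + pose proof (Hm y x ltac:(lra) ltac:(lra) ltac:(lra)).
      rewrite (Rabs_minus_sym y), (Rabs_minus_sym (H y)) in Hlt.
      rewrite !Rabs_pos_eq in Hlt by lra.
      apply (A2 y x); lra.
  - intros N. apply Rle_trans with (1 := A3 N).
    apply Rmult_le_reg_r with K; [easy|]. unfold Rdiv at 1. rewrite Rmult_assoc, Rinv_l, Rmult_1_r by lra.
    unfold K. replace (eps * _) with (20 * (H 1 - H (-1) + 1)) by (field; lra). lra.
Qed.

Lemma rsum_incr_le (H : R -> R) lo hi n (a b : nat -> R) :
  (forall x y, lo <= x -> x <= y -> y <= hi -> H x <= H y) -> lo <= hi ->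
  (forall i, (i < n)%nat -> lo <= a i /\ a i <= b i /\ b i <= hi) ->
  (forall i, (S i < n)%nat -> b i <= a (S i)) ->
  rsum (fun i => H (b i) - H (a i)) n <= H hi - H lo.
Proof.
  intros Hm Hl Ha Hb.
  assert (W : forall k, (k <= n)%nat -> rsum (fun i => H (b i) - H (a i)) k <=
     H (match k with O => lo | S j => b j end) - H lo).
  { induction k as [|k IH]; intros Hk; [simpl; lra|].
    specialize (IH ltac:(lia)). cbn [rsum]. destruct (Ha k ltac:(lia)) as (A1 & A2 & A3).
    destruct k as [|k].
    - pose proof (Hm lo (a O) ltac:(lra) ltac:(lra) ltac:(lra)). simpl in *. lra.
    - pose proof (Hb k ltac:(lia)). pose proof (Ha k ltac:(lia)).
      pose proof (Hm (b k) (a (S k)) ltac:(lra) ltac:(lra) ltac:(lra)). lra. }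
  apply Rle_trans with (1 := W n (le_n _)). destruct n as [|n].
  - pose proof (Hm lo hi ltac:(lra) ltac:(lra) ltac:(lra)). lra.
  - destruct (Ha n ltac:(lia)) as (A1 & A2 & A3).
    pose proof (Hm (b n) hi ltac:(lra) ltac:(lra) ltac:(lra)). lra.
Qed.

Definition lim_of (u : nat -> R) : R := epsilon (inhabits 0) (fun l => Un_cv u l).

Lemma lim_of_spec u : (exists l, Un_cv u l) -> Un_cv u (lim_of u).
Proof. intros H. exact (epsilon_spec (inhabits 0) (fun l => Un_cv u l) H). Qed.

(* With [g] converging fast to [p], the increasing function [H = sum 2^k int |g (k+1) - g k|]
   dominates the error: an increment of [int p - int (g n)] is at most [2^-n] times that of [H].
   Hence [int p] is differentiable with derivative [p] wherever the difference quotients of [H]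
   stay bounded. *)
Lemma L1_primitive p : L1 p -> exists F, continuity F /\ acd (-1) 1 F p.
Proof.
  intros Hp. destruct (L1_fast_seq p Hp) as (g & Gc & Gs & Gae).
  set (G := fun n => prim0 (g n)).
  set (D := fun n => prim0 (fun x => Rabs (g (S n) x - g n x))).
  assert (Dc : forall n, continuity (fun x => Rabs (g (S n) x - g n x))).
  { intros n. pose proof (Gc n). pose proof (Gc (S n)). cont. }
  assert (Dm : forall n x y, -1 <= x -> x <= y -> y <= 1 -> D n x <= D n y).
  { intros n x y Hx Hxy Hy. apply acd_nonneg with (fun x => Rabs (g (S n) x - g n x)); auto.
    - now apply prim0_acd.
    - apply ae_all. intros. apply Rabs_pos. }
  assert (GD : forall n x y, -1 <= x -> x <= y -> y <= 1 ->
     Rabs ((G (S n) y - G n y) - (G (S n) x - G n x)) <= D n y - D n x).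
  { intros n x y Hx Hxy Hy.
    apply (acd_abs_le x y (fun z => G (S n) z - G n z) (D n)
      (fun z => g (S n) z - g n z) (fun z => Rabs (g (S n) z - g n z))); auto.
    - apply acd_minus; apply prim0_acd; auto.
    - apply prim0_acd; auto.
    - apply ae_all. intros; lra. }
  set (HN := fun x N => rsum (fun k => 2 ^ k * D k x) N).
  set (H := fun x => lim_of (HN x)).
  assert (p2 : forall k, 0 < 2 ^ k) by (intros; apply pow_lt; lra).
  assert (D0 : forall n x, in_I x -> 0 <= D n x).
  { intros n x [H1 H2]. unfold D at 1. rewrite <- (prim0_start (fun x => Rabs (g (S n) x - g n x))).
    apply Dm; lra. }
  assert (HNb : forall x N, in_I x -> HN x N <= 2 - 2 * (1 / 2) ^ N).
  { intros x N Hx. induction N as [|N IH]; unfold HN in *; cbn [rsum]; [simpl; lra|].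
    assert (2 ^ N * D N x <= (1 / 2) ^ N).
    { apply Rle_trans with (2 ^ N * (1 / 4) ^ N).
      - apply Rmult_le_compat_l; [left; auto|]. apply Rle_trans with (2 := Gs N).
        apply Dm; unfold in_I in Hx; lra.
      - rewrite <- Rpow_mult_distr. replace (2 * (1 / 4)) with (1 / 2) by lra. lra. }
    simpl. lra. }
  assert (Hcv : forall x, in_I x -> Un_cv (HN x) (H x)).
  { intros x Hx. apply lim_of_spec.
    destruct (growing_cv (HN x)) as [l Hl]; [| |now exists l].
    - intros N. unfold HN. cbn [rsum]. specialize (D0 N x Hx). specialize (p2 N). nra.
    - exists 2. intros y [N ->]. specialize (HNb x N Hx).
      assert (0 < (1 / 2) ^ N) by (apply pow_lt; lra). lra. }
  assert (Hinc : forall x y N, -1 <= x -> x <= y -> y <= 1 ->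
     rsum (fun k => 2 ^ k * (D k y - D k x)) N <= H y - H x).
  { intros x y N Hx Hxy Hy.
    assert (C : Un_cv (fun n => HN y n - HN x n) (H y - H x)).
    { apply CV_minus; apply Hcv; split; lra. }
    assert (E : forall n, HN y n - HN x n = rsum (fun k => 2 ^ k * (D k y - D k x)) n).
    { intros n. unfold HN. induction n; simpl; [ring|]. rewrite <- IHn. ring. }
    rewrite <- E. apply (growing_ineq (fun n => HN y n - HN x n)); auto.
    intros n. rewrite !E. cbn [rsum]. specialize (Dm n x y Hx Hxy Hy). specialize (p2 n). nra. }
  assert (Hm : forall x y, -1 <= x -> x <= y -> y <= 1 -> H x <= H y).
  { intros x y Hx Hxy Hy. specialize (Hinc x y O Hx Hxy Hy). simpl in Hinc. lra. }
  assert (GH : forall n m x y, -1 <= x -> x <= y -> y <= 1 ->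
     Rabs ((G (n + m)%nat y - G (n + m)%nat x) - (G n y - G n x)) <= (1 / 2) ^ n * (H y - H x)).
  { intros n m x y Hx Hxy Hy.
    apply Rle_trans with (rsum (fun i => D (n + i)%nat y - D (n + i)%nat x) m).
    - induction m as [|m IH].
      + rewrite Nat.add_0_r. simpl. rewrite Rminus_diag, Rabs_R0. lra.
      + cbn [rsum]. rewrite Nat.add_succ_r. specialize (GD (n + m)%nat x y Hx Hxy Hy).
        set (A := (G (n + m)%nat y - G (n + m)%nat x) - (G n y - G n x)) in *.
        replace (G (S (n + m)) y - G (S (n + m)) x - (G n y - G n x)) with
          (A + (G (S (n + m)) y - G (n + m)%nat y - (G (S (n + m)) x - G (n + m)%nat x))) by (unfold A; ring).
        eapply Rle_trans; [apply Rabs_triang|]. lra.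
    - apply Rmult_le_reg_l with (2 ^ n); [auto|].
      rewrite <- Rmult_assoc, <- Rpow_mult_distr. replace (2 * (1 / 2)) with 1 by lra.
      rewrite pow1, Rmult_1_l. apply Rle_trans with (2 := Hinc x y (n + m)%nat Hx Hxy Hy).
      rewrite rsum_app, <- rsum_scal.
      assert (0 <= rsum (fun k => 2 ^ k * (D k y - D k x)) n).
      { apply rsum_nonneg. intros k _. specialize (Dm k x y Hx Hxy Hy). specialize (p2 k). nra. }
      assert (rsum (fun i => 2 ^ n * (D (n + i)%nat y - D (n + i)%nat x)) m <=
        rsum (fun i => 2 ^ (n + i) * (D (n + i)%nat y - D (n + i)%nat x)) m); [|lra].
      apply rsum_le. intros i _. apply Rmult_le_compat_r.
      + specialize (Dm (n + i)%nat x y Hx Hxy Hy). lra.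
      + apply Rle_pow; [lra|lia]. }
  assert (HT : H 1 - H (-1) <= 2).
  { assert (B1 : Rabs (H 1 - 1) <= 1).
    { apply (Un_cv_bound (HN 1) (H 1) 1 1 O); [apply Hcv; split; lra|].
      intros N. simpl. specialize (HNb 1 N ltac:(split; lra)).
      assert (0 < (1 / 2) ^ N) by (apply pow_lt; lra).
      assert (0 <= HN 1 N).
      { apply rsum_nonneg. intros k _. specialize (D0 k 1 ltac:(split; lra)). specialize (p2 k). nra. }
      apply Rabs_le; lra. }
    assert (B2 : Rabs (H (-1) - 1) <= 1).
    { apply (Un_cv_bound (HN (-1)) (H (-1)) 1 1 O); [apply Hcv; split; lra|].
      intros N. simpl. specialize (HNb (-1) N ltac:(split; lra)).
      assert (0 < (1 / 2) ^ N) by (apply pow_lt; lra).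
      assert (0 <= HN (-1) N).
      { apply rsum_nonneg. intros k _. specialize (D0 k (-1) ltac:(split; lra)). specialize (p2 k). nra. }
      apply Rabs_le; lra. }
    apply Rabs_le_between in B1. apply Rabs_le_between in B2. lra. }
  assert (half0 : forall eps, 0 < eps -> exists n, forall m, (n <= m)%nat -> (1 / 2) ^ m < eps).
  { intros eps He. destruct (pow_lt_1_zero (1 / 2)) with (y := eps) as [n Hn]; auto.
    - rewrite Rabs_pos_eq; lra.
    - exists n. intros m Hmn. specialize (Hn m Hmn).
      rewrite Rabs_pos_eq in Hn by (apply pow_le; lra). easy. }
  assert (G0 : forall n, G n (-1) = 0) by (intros; apply prim0_start).
  set (F := fun x => lim_of (fun n => G n x)).
  assert (Fcv : forall x, in_I x -> Un_cv (fun n => G n x) (F x)).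
  { intros x Hx. apply lim_of_spec.
    destruct (Rcomplete.R_complete (fun n => G n x)) as [l Hl]; [|now exists l].
    intros eps He. destruct (half0 (eps / 4)) as [n Hn]; [lra|].
    assert (W : forall k, (n <= k)%nat -> Rabs (G k x - G n x) < eps / 2).
    { intros k Hk. unfold in_I in Hx. specialize (GH n (k - n)%nat (-1) x ltac:(lra) ltac:(lra) ltac:(lra)).
      replace (n + (k - n))%nat with k in GH by lia. rewrite !G0, !Rminus_0_r in GH.
      specialize (Hn n (le_n _)). specialize (Hm x 1 ltac:(lra) ltac:(lra) ltac:(lra)).
      assert (0 < (1 / 2) ^ n) by (apply pow_lt; lra). nra. }
    exists n. intros a b Ha Hb. unfold Rdist.
    replace (G a x - G b x) with ((G a x - G n x) - (G b x - G n x)) by ring.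
    pose proof (W a Ha) as Wa. pose proof (W b Hb) as Wb.
    apply Rabs_def2 in Wa. apply Rabs_def2 in Wb. apply Rabs_def1; lra. }
  assert (FG : forall n x y, -1 <= x -> x <= y -> y <= 1 ->
     Rabs ((F y - F x) - (G n y - G n x)) <= (1 / 2) ^ n * (H y - H x)).
  { intros n x y Hx Hxy Hy.
    apply (Un_cv_bound (fun k => G k y - G k x) _ _ _ n).
    - apply CV_minus; apply Fcv; split; lra.
    - intros m. now apply GH. }
  assert (FAC : abs_cont_on (-1) 1 F).
  { intros eps He. destruct (half0 (eps / 8)) as [n Hn]; [lra|]. specialize (Hn n (le_n _)).
    assert (GAC : abs_cont_on (-1) 1 (G n)).
    { apply (prim0_acd (g n) (-1) 1); [lra|auto]. }
    destruct (GAC (eps / 2)) as (d & Hd & K); [lra|].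
    exists d. split; [easy|]. intros N a b Ha Hb Hs. specialize (K N a b Ha Hb Hs).
    apply Rle_lt_trans with (rsum (fun i => Rabs (G n (b i) - G n (a i))) N
       + (1 / 2) ^ n * rsum (fun i => H (b i) - H (a i)) N).
    - rewrite <- rsum_scal, <- rsum_plus. apply rsum_le. intros i Hi.
      destruct (Ha i Hi) as (A1 & A2 & A3). specialize (FG n _ _ A1 A2 A3).
      replace (F (b i) - F (a i)) with ((G n (b i) - G n (a i)) + (F (b i) - F (a i) - (G n (b i) - G n (a i)))) by ring.
      eapply Rle_trans; [apply Rabs_triang|]. lra.
    - pose proof (rsum_incr_le H (-1) 1 N a b Hm ltac:(lra) Ha Hb).
      assert (0 < (1 / 2) ^ n) by (apply pow_lt; lra). nra. }
  (* Constant extension, so that the primitive is continuous on the whole line. *)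
  exists (fun x => F (clamp (-1) 1 x)). split; [apply cont_clamp; auto; lra|].
  apply acd_eq_fun with F.
  2:{ intros x Hx. now rewrite clamp_id. }
  split; [easy|].
  apply ae_mp2 with (1 := Gae) (2 := finite_quotient_ae H Hm).
  intros x _ Hg (K & HK & HQ) Hx eps He.
  (* [n] is fixed before the increment [h]. The quotients of [F] and [G n] at [x] then differ by at
     most [eps / 4], and so do [g n x] and [p x]; the third [eps / 4] comes from differentiability
     of [G n]. *)
  destruct (half0 (eps / (4 * K))) as [n1 Hn1]; [apply Rdiv_lt_0_compat; lra|].
  destruct (Hg (eps / 4)) as [n2 Hn2]; [lra|].
  set (n := Nat.max n1 n2). specialize (Hn1 n ltac:(lia)). specialize (Hn2 n ltac:(lia)).
  destruct (dpl_bound (G n) x (g n x) (eps / 4) (prim0_derive (g n) (Gc n) x)) as (d & Hd & HG); [lra|].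
  assert (Hdp : 0 < Rmin d (Rmin (1 - x) (1 + x))).
  { apply Rmin_pos; [easy|]. apply Rmin_pos; lra. }
  exists (mkposreal _ Hdp). simpl. intros h Hh Hhd.
  pose proof (Rmin_l d (Rmin (1 - x) (1 + x))). pose proof (Rmin_r d (Rmin (1 - x) (1 + x))).
  pose proof (Rmin_l (1 - x) (1 + x)). pose proof (Rmin_r (1 - x) (1 + x)).
  assert (Hh' : Rabs h < d) by lra. assert (Hh1 : Rabs h < 1 - x) by lra. assert (Hh2 : Rabs h < 1 + x) by lra.
  apply Rabs_def2 in Hh1. apply Rabs_def2 in Hh2.
  specialize (HG (x + h)). replace (x + h - x) with h in HG by ring. specialize (HG Hh').
  specialize (HQ (x + h) ltac:(split; lra)). replace (x + h - x) with h in HQ by ring.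
  assert (HF : Rabs ((F (x + h) - F x) - (G n (x + h) - G n x)) <= (1 / 2) ^ n * (K * Rabs h)).
  { assert (0 < (1 / 2) ^ n) by (apply pow_lt; lra).
    destruct (Rle_dec x (x + h)).
    - specialize (FG n x (x + h) ltac:(lra) ltac:(lra) ltac:(lra)).
      apply Rle_trans with (1 := FG). apply Rmult_le_compat_l; [lra|].
      eapply Rle_trans; [apply Rle_abs | apply HQ].
    - specialize (FG n (x + h) x ltac:(lra) ltac:(lra) ltac:(lra)).
      rewrite Rabs_minus_sym in FG.
      replace (F (x + h) - F x - (G n (x + h) - G n x)) with (G n x - G n (x + h) - (F x - F (x + h))) by ring.
      apply Rle_trans with (1 := FG). apply Rmult_le_compat_l; [lra|].
      rewrite Rabs_minus_sym in HQ. eapply Rle_trans; [apply Rle_abs | apply HQ]. }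
  assert (Hah : 0 < Rabs h) by now apply Rabs_pos_lt.
  assert (HF2 : (1 / 2) ^ n * (K * Rabs h) <= eps / 4 * Rabs h).
  { replace (eps / 4) with (eps / (4 * K) * K) by (field; lra).
    rewrite Rmult_assoc. apply Rmult_le_compat_r; [|lra]. nra. }
  unfold Rdist in Hn2.
  replace ((F (x + h) - F x) / h - p x) with
    (((F (x + h) - F x - (G n (x + h) - G n x)) + (G n (x + h) - G n x - g n x * h)) * / h + (g n x - p x))
    by (field; easy).
  eapply Rle_lt_trans; [apply Rabs_triang|].
  rewrite Rabs_mult, Rabs_inv.
  assert (Rabs (F (x + h) - F x - (G n (x + h) - G n x) + (G n (x + h) - G n x - g n x * h)) * / Rabs h <= eps / 2).
  { apply Rmult_le_reg_r with (Rabs h); [easy|]. rewrite Rmult_assoc, Rinv_l, Rmult_1_r by lra.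
    eapply Rle_trans; [apply Rabs_triang|]. lra. }
  lra.
Qed.

(** * The differential equation *)

Lemma L1_primitive_nondecr k : L1 k -> (forall x, 0 <= k x) ->
  exists K, continuity K /\ acd (-1) 1 K k /\ forall x y, -1 <= x -> x <= y -> y <= 1 -> K x <= K y.
Proof.
  intros Hk Hp. destruct (L1_primitive k Hk) as (K & Kc & Ka). exists K. split; [easy|]. split; [easy|].
  intros x y Hx Hxy Hy. apply acd_nonneg with k; auto.
  - apply acd_sub with (-1) 1; auto.
  - apply ae_all. auto.
Qed.

Lemma acd_exp a b F f c : a <= b -> acd a b F f ->
  acd a b (fun x => exp (c * F x)) (fun x => c * f x * exp (c * F x)).
Proof.
  intros Hab HF.
  apply acd_eq_deriv' with (f := fun x => exp (c * F x) * (c * f x)).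
  - apply (acd_comp a b (fun x => c * F x) (fun x => c * f x) exp exp); auto.
    + now apply acd_scal.
    + apply derivable_pt_lim_exp.
    + intros x. apply derivable_continuous_pt, derivable_pt_exp.
  - intros; ring.
Qed.

(** Integrating factors: to the right of [x0] the product [N exp (- K)] is nonincreasing, to the
    left of it [N exp K] is nondecreasing. *)
Lemma gronwall N n K k x0 : acd (-1) 1 N n -> acd (-1) 1 K k -> in_I x0 ->
  (forall x y, -1 <= x -> x <= y -> y <= 1 -> K x <= K y) ->
  ae (fun x => -1 < x < 1 -> Rabs (n x) <= k x * N x) ->
  forall x, in_I x -> N x <= N x0 * exp (Rabs (K x - K x0)).
Proof.
  intros HN HK Hx0 Km Hle x Hx. unfold in_I in *.
  destruct (Rle_dec x0 x) as [Hc|Hc].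
  - rewrite Rabs_pos_eq by (specialize (Km x0 x ltac:(lra) ltac:(lra) ltac:(lra)); lra).
    assert (M : acd x0 x (fun y => N y * exp (-1 * K y))
       (fun y => n y * exp (-1 * K y) + N y * (-1 * k y * exp (-1 * K y)))).
    { apply acd_mult; auto; [|apply acd_exp; auto]; apply acd_sub with (-1) 1; auto; lra. }
    pose proof (acd_le x0 x _ _ _ _ ltac:(lra) Hc ltac:(lra) M (acd_const _ _ 0)) as L. cbv beta in L.
    assert (L' : N x * exp (-1 * K x) - N x0 * exp (-1 * K x0) <= 0 - 0).
    { apply L. apply ae_mp with (1 := Hle). intros y _ Hy Hyx. specialize (Hy ltac:(lra)).
      apply Rabs_le_between in Hy. pose proof (exp_pos (-1 * K y)). nra. }
    replace (exp (K x - K x0)) with (exp (K x) * exp (-1 * K x0)) by (rewrite <- exp_plus; f_equal; ring).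
    assert (E : exp (K x) * exp (-1 * K x) = 1) by (rewrite <- exp_plus, Rplus_comm; match goal with |- exp ?z = _ => replace z with 0 by ring end; apply exp_0).
    pose proof (exp_pos (K x)).
    apply Rle_trans with (N x * exp (-1 * K x) * exp (K x)).
    + right. transitivity (N x * (exp (K x) * exp (-1 * K x))); [rewrite E|]; ring.
    + rewrite (Rmult_comm (exp (K x))), <- Rmult_assoc. apply Rmult_le_compat_r; lra.
  - assert (Hc' : x <= x0) by lra.
    rewrite Rabs_minus_sym, Rabs_pos_eq by (specialize (Km x x0 ltac:(lra) ltac:(lra) ltac:(lra)); lra).
    assert (M : acd x x0 (fun y => N y * exp (1 * K y))
       (fun y => n y * exp (1 * K y) + N y * (1 * k y * exp (1 * K y)))).
    { apply acd_mult; auto; [|apply acd_exp; auto]; apply acd_sub with (-1) 1; auto; lra. }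
    pose proof (acd_nonneg x x0 _ _ ltac:(lra) Hc' ltac:(lra) M) as L. cbv beta in L.
    assert (L' : N x * exp (1 * K x) <= N x0 * exp (1 * K x0)).
    { apply L. apply ae_mp with (1 := Hle). intros y _ Hy Hyx. specialize (Hy ltac:(lra)).
      apply Rabs_le_between in Hy. pose proof (exp_pos (1 * K y)). nra. }
    replace (exp (K x0 - K x)) with (exp (1 * K x0) * exp (-1 * K x)) by (rewrite <- exp_plus; f_equal; ring).
    assert (E : exp (1 * K x) * exp (-1 * K x) = 1) by (rewrite <- exp_plus, Rplus_comm; match goal with |- exp ?z = _ => replace z with 0 by ring end; apply exp_0).
    pose proof (exp_pos (-1 * K x)).
    apply Rle_trans with (N x * exp (1 * K x) * exp (-1 * K x)).
    + right. rewrite Rmult_assoc, E. ring.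
    + rewrite <- Rmult_assoc. apply Rmult_le_compat_r; lra.
Qed.

(* For [y = u + i v] the system is [y'' = (P - i S) y]; the equation [-y'' + q y = (a + i b) w y]
   has [P = q - a w] and [S = b w]. *)
Definition wsol (P S u u1 v v1 : R -> R) : Prop :=
  acd (-1) 1 u u1 /\ acd (-1) 1 v v1 /\
  acd (-1) 1 u1 (fun x => P x * u x + S x * v x) /\
  acd (-1) 1 v1 (fun x => P x * v x - S x * u x).

(** Unlike [wsol], this asks for derivatives of [u] and [v] at every real point, so that mean value
    and intermediate value arguments work at the ends of [[-1, 1]] too. The equation itself is still
    imposed on (-1,1) only. *)
Definition sol (P S u u1 v v1 : R -> R) : Prop :=
  (forall x, derivable_pt_lim u x (u1 x)) /\ (forall x, derivable_pt_lim v x (v1 x)) /\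
  continuity u1 /\ continuity v1 /\
  acd (-1) 1 u1 (fun x => P x * u x + S x * v x) /\
  acd (-1) 1 v1 (fun x => P x * v x - S x * u x).

Lemma sol_wsol P S u u1 v v1 : sol P S u u1 v v1 -> wsol P S u u1 v v1.
Proof.
  intros (A & B & C & D & E & F). split; [|split; [|split]]; auto; apply acd_C1; auto; lra.
Qed.

Lemma wsol_lin P S u u1 v v1 w w1 z z1 a b : wsol P S u u1 v v1 -> wsol P S w w1 z z1 ->
  wsol P S (fun x => a * u x + b * w x) (fun x => a * u1 x + b * w1 x)
    (fun x => a * v x + b * z x) (fun x => a * v1 x + b * z1 x).
Proof.
  intros (A1 & A2 & A3 & A4) (B1 & B2 & B3 & B4). split; [|split; [|split]].
  - apply acd_plus; now apply acd_scal.
  - apply acd_plus; now apply acd_scal.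
  - eapply acd_eq_deriv'; [apply acd_plus; apply acd_scal; eassumption|]. intros; cbv beta; ring.
  - eapply acd_eq_deriv'; [apply acd_plus; apply acd_scal; eassumption|]. intros; cbv beta; ring.
Qed.

Lemma sol_lin P S u u1 v v1 w w1 z z1 a b : sol P S u u1 v v1 -> sol P S w w1 z z1 ->
  sol P S (fun x => a * u x + b * w x) (fun x => a * u1 x + b * w1 x)
    (fun x => a * v x + b * z x) (fun x => a * v1 x + b * z1 x).
Proof.
  intros HA HB. destruct (wsol_lin _ _ _ _ _ _ _ _ _ _ a b (sol_wsol _ _ _ _ _ _ HA) (sol_wsol _ _ _ _ _ _ HB))
    as (_ & _ & W1 & W2).
  destruct HA as (A1 & A2 & A3 & A4 & _ & _). destruct HB as (B1 & B2 & B3 & B4 & _ & _).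
  split; [|split; [|split; [|split; [|split]]]]; auto.
  - intros x. eapply dpl_plus; [eapply dpl_scal; auto | eapply dpl_scal; auto |]; reflexivity.
  - intros x. eapply dpl_plus; [eapply dpl_scal; auto | eapply dpl_scal; auto |]; reflexivity.
  - cont.
  - cont.
Qed.

(** Multiplication by [- i], which moves the imaginary part into the place of the real part. *)
Lemma sol_rot P S u u1 v v1 : sol P S u u1 v v1 ->
  sol P S v v1 (fun x => -1 * u x) (fun x => -1 * u1 x).
Proof.
  intros (A & B & C & D & E & F). split; [|split; [|split; [|split; [|split]]]]; auto.
  - intros x. eapply dpl_scal; eauto.
  - cont.
  - eapply acd_eq_deriv'; [exact F|]. intros; cbv beta; ring.
  - eapply acd_eq_deriv'; [apply acd_scal; exact E|]. intros; cbv beta; ring.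
Qed.

Definition sqnorm (u u1 v v1 : R -> R) (x : R) : R := u x ^ 2 + u1 x ^ 2 + (v x ^ 2 + v1 x ^ 2).

Lemma acd_sq a b F f : a <= b -> acd a b F f -> acd a b (fun x => F x ^ 2) (fun x => 2 * F x * f x).
Proof.
  intros Hab HF. apply acd_eq_fun with (fun x => F x * F x); [|intros; ring].
  eapply acd_eq_deriv'; [apply acd_mult; eassumption|]. intros; cbv beta; ring.
Qed.

Lemma sqnorm_acd u u1 v v1 u' u1' v' v1' :
  acd (-1) 1 u u' -> acd (-1) 1 u1 u1' -> acd (-1) 1 v v' -> acd (-1) 1 v1 v1' ->
  acd (-1) 1 (sqnorm u u1 v v1)
   (fun x => 2 * u x * u' x + 2 * u1 x * u1' x + (2 * v x * v' x + 2 * v1 x * v1' x)).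
Proof.
  intros. unfold sqnorm. repeat apply acd_plus; apply acd_sq; auto; lra.
Qed.

Lemma abs_prod_le a b : Rabs (2 * a * b) <= a ^ 2 + b ^ 2.
Proof. apply Rabs_le. pose proof (pow2_ge_0 (a + b)). pose proof (pow2_ge_0 (a - b)). lra. Qed.

Lemma wsol_growth P S u u1 v v1 x :
  Rabs (2 * u x * u1 x + 2 * u1 x * (P x * u x + S x * v x) +
       (2 * v x * v1 x + 2 * v1 x * (P x * v x - S x * u x)))
  <= (1 + Rabs (P x) + Rabs (S x)) * sqnorm u u1 v v1 x.
Proof.
  unfold sqnorm.
  replace (2 * u x * u1 x + _ + _) with
    (2 * u x * u1 x + 2 * v x * v1 x + P x * (2 * u x * u1 x + 2 * v x * v1 x)
      + S x * (2 * v x * u1 x - 2 * u x * v1 x)) by ring.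
  pose proof (abs_prod_le (u x) (u1 x)) as A. pose proof (abs_prod_le (v x) (v1 x)) as B.
  pose proof (abs_prod_le (v x) (u1 x)) as C. pose proof (abs_prod_le (u x) (v1 x)) as D.
  apply Rabs_le_between in A. apply Rabs_le_between in B. apply Rabs_le_between in C. apply Rabs_le_between in D.
  assert (E : Rabs (2 * u x * u1 x + 2 * v x * v1 x) <= u x ^ 2 + u1 x ^ 2 + (v x ^ 2 + v1 x ^ 2)) by (apply Rabs_le; lra).
  assert (F : Rabs (2 * v x * u1 x - 2 * u x * v1 x) <= u x ^ 2 + u1 x ^ 2 + (v x ^ 2 + v1 x ^ 2)) by (apply Rabs_le; lra).
  eapply Rle_trans; [apply Rabs_triang|]. rewrite (Rabs_mult (S x)).
  eapply Rle_trans; [apply Rplus_le_compat_r, Rabs_triang|]. rewrite (Rabs_mult (P x)).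
  pose proof (Rabs_pos (P x)). pose proof (Rabs_pos (S x)). nra.
Qed.

Lemma L1_coef P S : L1 P -> L1 S -> L1 (fun x => 1 + Rabs (P x) + Rabs (S x)).
Proof.
  intros HP HS. apply L1_plus; [|now apply L1_abs]. apply L1_plus; [|now apply L1_abs].
  apply L1_cont, cont_const.
Qed.

Lemma wsol_zero P S u u1 v v1 x0 : L1 P -> L1 S -> in_I x0 -> wsol P S u u1 v v1 ->
  u x0 = 0 -> u1 x0 = 0 -> v x0 = 0 -> v1 x0 = 0 ->
  forall x, in_I x -> u x = 0 /\ u1 x = 0 /\ v x = 0 /\ v1 x = 0.
Proof.
  intros HP HS Hx0 (A1 & A2 & A3 & A4) E1 E2 E3 E4 x Hx.
  destruct (L1_primitive_nondecr (fun x => 1 + Rabs (P x) + Rabs (S x)) (L1_coef P S HP HS)) as (K & _ & Ka & Km).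
  { intros y. pose proof (Rabs_pos (P y)). pose proof (Rabs_pos (S y)). lra. }
  pose proof (gronwall _ _ _ _ x0 (sqnorm_acd _ _ _ _ _ _ _ _ A1 A3 A2 A4) Ka Hx0 Km) as G.
  assert (G' := G ltac:(apply ae_all; intros; apply wsol_growth) x Hx).
  unfold sqnorm in G'. rewrite E1, E2, E3, E4 in G'.
  pose proof (pow2_ge_0 (u x)). pose proof (pow2_ge_0 (u1 x)). pose proof (pow2_ge_0 (v x)). pose proof (pow2_ge_0 (v1 x)).
  repeat split; apply Rsqr_0_uniq; rewrite Rsqr_pow2; lra.
Qed.

Lemma wsol_unique P S u u1 v v1 w w1 z z1 x0 : L1 P -> L1 S -> in_I x0 ->
  wsol P S u u1 v v1 -> wsol P S w w1 z z1 ->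
  u x0 = w x0 -> u1 x0 = w1 x0 -> v x0 = z x0 -> v1 x0 = z1 x0 ->
  forall x, in_I x -> u x = w x /\ u1 x = w1 x /\ v x = z x /\ v1 x = z1 x.
Proof.
  intros HP HS Hx0 A B E1 E2 E3 E4 x Hx.
  destruct (wsol_zero _ _ _ _ _ _ x0 HP HS Hx0 (wsol_lin _ _ _ _ _ _ _ _ _ _ 1 (-1) A B)
    ltac:(lra) ltac:(lra) ltac:(lra) ltac:(lra) x Hx). lra.
Qed.

Lemma abs_le_of_sqnorm u u1 v v1 x M : 0 <= M -> sqnorm u u1 v v1 x <= M ^ 2 ->
  Rabs (u x) <= M /\ Rabs (u1 x) <= M /\ Rabs (v x) <= M /\ Rabs (v1 x) <= M.
Proof.
  intros HM H. unfold sqnorm in H.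
  pose proof (pow2_ge_0 (u x)). pose proof (pow2_ge_0 (u1 x)). pose proof (pow2_ge_0 (v x)). pose proof (pow2_ge_0 (v1 x)).
  repeat split; rewrite <- (Rabs_pos_eq M HM); apply Rsqr_le_abs_0; rewrite !Rsqr_pow2; lra.
Qed.

(** Two families have this shape: the spectral parameter, with [p1 = -1] and [s1 = 0], and the
    imaginary parameter, with [p1 = 0] and [s1 = w]. The Gronwall majorant contains [T] instead of
    [t], which makes the bound uniform. *)
Lemma sol_family_bound p0 p1 s1 x0 T c0 c1 d0 d1 : L1 p0 -> L1 p1 -> L1 s1 -> in_I x0 -> 0 <= T ->
  exists B, 0 < B /\ forall t u u1 v v1, Rabs t <= T ->
    wsol (fun x => p0 x + t * p1 x) (fun x => t * s1 x) u u1 v v1 ->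
    u x0 = c0 -> u1 x0 = c1 -> v x0 = d0 -> v1 x0 = d1 ->
    forall x, in_I x -> Rabs (u x) <= B /\ Rabs (u1 x) <= B /\ Rabs (v x) <= B /\ Rabs (v1 x) <= B.
Proof.
  intros H0 H1 H2 Hx0 HT.
  destruct (L1_primitive_nondecr (fun x => (1 + Rabs (p0 x) + T * Rabs (p1 x)) + T * Rabs (s1 x))) as (K & _ & Ka & Km).
  { apply L1_plus; [|now apply L1_scal, L1_abs]. apply L1_plus; [|now apply L1_scal, L1_abs].
    apply L1_plus; [apply L1_cont, cont_const | now apply L1_abs]. }
  { intros y. pose proof (Rabs_pos (p0 y)). pose proof (Rabs_pos (p1 y)). pose proof (Rabs_pos (s1 y)). nra. }
  set (M := (c0 ^ 2 + c1 ^ 2 + (d0 ^ 2 + d1 ^ 2)) * exp (K 1 - K (-1))).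
  assert (HM : 0 <= M).
  { pose proof (exp_pos (K 1 - K (-1))). unfold M.
    pose proof (pow2_ge_0 c0). pose proof (pow2_ge_0 c1). pose proof (pow2_ge_0 d0). pose proof (pow2_ge_0 d1). nra. }
  exists (M + 1). split; [lra|]. intros t u u1 v v1 Ht (A1 & A2 & A3 & A4) E1 E2 E3 E4 x Hx.
  apply abs_le_of_sqnorm; [lra|].
  pose proof (gronwall _ _ _ _ x0 (sqnorm_acd _ _ _ _ _ _ _ _ A1 A3 A2 A4) Ka Hx0 Km) as G.
  assert (Hn : forall y, 0 <= sqnorm u u1 v v1 y).
  { intros y. unfold sqnorm. pose proof (pow2_ge_0 (u y)). pose proof (pow2_ge_0 (u1 y)).
    pose proof (pow2_ge_0 (v y)). pose proof (pow2_ge_0 (v1 y)). lra. }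
  assert (G' : sqnorm u u1 v v1 x <= sqnorm u u1 v v1 x0 * exp (Rabs (K x - K x0))).
  { apply G; auto. apply ae_all. intros y _ _.
    eapply Rle_trans; [apply (wsol_growth (fun x => p0 x + t * p1 x) (fun x => t * s1 x))|].
    apply Rmult_le_compat_r; auto.
    pose proof (Rabs_triang (p0 y) (t * p1 y)) as Tr. rewrite Rabs_mult in Tr. rewrite (Rabs_mult t (s1 y)).
    pose proof (Rabs_pos (p1 y)). pose proof (Rabs_pos (s1 y)). nra. }
  apply Rle_trans with M; [|nra]. apply Rle_trans with (1 := G').
  unfold M, sqnorm. rewrite E1, E2, E3, E4. apply Rmult_le_compat_l.
  - specialize (Hn x0). unfold sqnorm in Hn. rewrite E1, E2, E3, E4 in Hn. easy.
  - assert (Hle : Rabs (K x - K x0) <= K 1 - K (-1)).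
    { unfold in_I in *.
      pose proof (Km (-1) x ltac:(lra) ltac:(lra) ltac:(lra)). pose proof (Km x 1 ltac:(lra) ltac:(lra) ltac:(lra)).
      pose proof (Km (-1) x0 ltac:(lra) ltac:(lra) ltac:(lra)). pose proof (Km x0 1 ltac:(lra) ltac:(lra) ltac:(lra)).
      apply Rabs_le. lra. }
    destruct Hle as [Hl | ->]; [left; now apply exp_increasing | lra].
Qed.

(** Gronwall is applied to the squared norm of the difference plus the constant [(t - s) ^ 2]. The
    constant absorbs the inhomogeneous term and is all that is left at [x0]. *)
Lemma sol_family_lipschitz p0 p1 s1 x0 T c0 c1 d0 d1 : L1 p0 -> L1 p1 -> L1 s1 -> in_I x0 -> 0 <= T ->
  exists C, 0 < C /\ forall t s u u1 v v1 w w1 z z1, Rabs t <= T -> Rabs s <= T ->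
    wsol (fun x => p0 x + t * p1 x) (fun x => t * s1 x) u u1 v v1 ->
    wsol (fun x => p0 x + s * p1 x) (fun x => s * s1 x) w w1 z z1 ->
    u x0 = c0 -> u1 x0 = c1 -> v x0 = d0 -> v1 x0 = d1 ->
    w x0 = c0 -> w1 x0 = c1 -> z x0 = d0 -> z1 x0 = d1 ->
    forall x, in_I x -> Rabs (u x - w x) <= C * Rabs (t - s) /\ Rabs (v x - z x) <= C * Rabs (t - s).
Proof.
  intros H0 H1 H2 Hx0 HT.
  destruct (sol_family_bound p0 p1 s1 x0 T c0 c1 d0 d1 H0 H1 H2 Hx0 HT) as (B & HB & Bd).
  destruct (L1_primitive_nondecr (fun x => (1 + Rabs (p0 x) + (T + 2 * B) * Rabs (p1 x)) + (T + 2 * B) * Rabs (s1 x)))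
    as (K & _ & Ka & Km).
  { apply L1_plus; [|now apply L1_scal, L1_abs]. apply L1_plus; [|now apply L1_scal, L1_abs].
    apply L1_plus; [apply L1_cont, cont_const | now apply L1_abs]. }
  { intros y. pose proof (Rabs_pos (p0 y)). pose proof (Rabs_pos (p1 y)). pose proof (Rabs_pos (s1 y)). nra. }
  exists (exp (K 1 - K (-1))). split; [apply exp_pos|].
  intros t s u u1 v v1 w w1 z z1 Ht Hs HA HB' E1 E2 E3 E4 F1 F2 F3 F4 x Hx.
  assert (Bw := Bd s w w1 z z1 Hs HB' F1 F2 F3 F4).
  destruct HA as (A1 & A2 & A3 & A4). destruct HB' as (B1 & B2 & B3 & B4).
  set (e := t - s).
  set (du := fun y => u y - w y). set (du1 := fun y => u1 y - w1 y).
  set (dv := fun y => v y - z y). set (dv1 := fun y => v1 y - z1 y).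
  pose proof (acd_plus _ _ _ _ _ _ (sqnorm_acd du du1 dv dv1 _ _ _ _ (acd_minus _ _ _ _ _ _ A1 B1)
    (acd_minus _ _ _ _ _ _ A3 B3) (acd_minus _ _ _ _ _ _ A2 B2) (acd_minus _ _ _ _ _ _ A4 B4))
    (acd_const _ _ (e ^ 2))) as Da.
  pose proof (gronwall _ _ _ _ x0 Da Ka Hx0 Km) as G. cbv beta in G.
  assert (G' : sqnorm du du1 dv dv1 x + e ^ 2 <= (sqnorm du du1 dv dv1 x0 + e ^ 2) * exp (Rabs (K x - K x0))).
  { apply G; auto. apply ae_mp with (1 := ae_interior). intros y Hy _ _.
    destruct (Bw y Hy) as (W1 & _ & W3 & _).
    fold (du y) (du1 y) (dv y) (dv1 y).
    replace (_ + 0) with ((2 * du y * du1 y + 2 * du1 y * ((p0 y + t * p1 y) * du y + (t * s1 y) * dv y) +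
       (2 * dv y * dv1 y + 2 * dv1 y * ((p0 y + t * p1 y) * dv y - (t * s1 y) * du y)))
       + (p1 y * w y + s1 y * z y) * (2 * du1 y * e) + (p1 y * z y - s1 y * w y) * (2 * dv1 y * e))
      by (unfold du, du1, dv, dv1, e; ring).
    eapply Rle_trans; [apply Rabs_triang|]. eapply Rle_trans; [apply Rplus_le_compat_r, Rabs_triang|].
    rewrite (Rabs_mult (p1 y * w y + s1 y * z y)), (Rabs_mult (p1 y * z y - s1 y * w y)).
    pose proof (wsol_growth (fun x => p0 x + t * p1 x) (fun x => t * s1 x) du du1 dv dv1 y) as Gr. cbv beta in Gr.
    pose proof (Rabs_triang (p0 y) (t * p1 y)) as Tr. rewrite Rabs_mult in Tr. rewrite (Rabs_mult t (s1 y)) in Gr.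
    pose proof (abs_prod_le (du1 y) e) as Q1. pose proof (abs_prod_le (dv1 y) e) as Q2.
    pose proof (Rabs_pos (p1 y)) as Pp. pose proof (Rabs_pos (s1 y)) as Ps.
    assert (Wa : Rabs (p1 y * w y + s1 y * z y) <= (Rabs (p1 y) + Rabs (s1 y)) * B).
    { eapply Rle_trans; [apply Rabs_triang|]. rewrite !Rabs_mult. nra. }
    assert (Wb : Rabs (p1 y * z y - s1 y * w y) <= (Rabs (p1 y) + Rabs (s1 y)) * B).
    { eapply Rle_trans; [apply Rabs_triang|]. rewrite Rabs_Ropp, !Rabs_mult. nra. }
    assert (Hsq : 0 <= e ^ 2) by apply pow2_ge_0.
    assert (Hn : du1 y ^ 2 <= sqnorm du du1 dv dv1 y /\ dv1 y ^ 2 <= sqnorm du du1 dv dv1 y /\ 0 <= sqnorm du du1 dv dv1 y).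
    { unfold sqnorm. pose proof (pow2_ge_0 (du y)). pose proof (pow2_ge_0 (du1 y)).
      pose proof (pow2_ge_0 (dv y)). pose proof (pow2_ge_0 (dv1 y)). lra. }
    destruct Hn as (Hn1 & Hn2 & Hn3).
    set (Nn := sqnorm du du1 dv dv1 y) in *.
    set (r := (Rabs (p1 y) + Rabs (s1 y)) * B) in *.
    assert (Hr : 0 <= r) by (unfold r; nra).
    assert (X1 : Rabs (p1 y * w y + s1 y * z y) * Rabs (2 * du1 y * e) <= r * (Nn + e ^ 2)).
    { apply Rmult_le_compat; auto using Rabs_pos; lra. }
    assert (X2 : Rabs (p1 y * z y - s1 y * w y) * Rabs (2 * dv1 y * e) <= r * (Nn + e ^ 2)).
    { apply Rmult_le_compat; auto using Rabs_pos; lra. }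
    assert (X3 : (1 + Rabs (p0 y + t * p1 y) + Rabs t * Rabs (s1 y)) * Nn <=
       (1 + Rabs (p0 y) + T * Rabs (p1 y) + T * Rabs (s1 y)) * (Nn + e ^ 2)).
    { apply Rmult_le_compat; try lra.
      - pose proof (Rabs_pos (p0 y + t * p1 y)). pose proof (Rabs_pos t). nra.
      - nra. }
    apply Rle_trans with ((1 + Rabs (p0 y) + T * Rabs (p1 y) + T * Rabs (s1 y)) * (Nn + e ^ 2) + r * (Nn + e ^ 2) + r * (Nn + e ^ 2)); [lra|].
    right. unfold r. ring. }
  assert (Z0 : sqnorm du du1 dv dv1 x0 = 0).
  { unfold sqnorm, du, du1, dv, dv1. rewrite E1, E2, E3, E4, F1, F2, F3, F4. ring. }
  rewrite Z0, Rplus_0_l in G'.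
  assert (Hle : Rabs (K x - K x0) <= K 1 - K (-1)).
  { unfold in_I in *.
    pose proof (Km (-1) x ltac:(lra) ltac:(lra) ltac:(lra)). pose proof (Km x 1 ltac:(lra) ltac:(lra) ltac:(lra)).
    pose proof (Km (-1) x0 ltac:(lra) ltac:(lra) ltac:(lra)). pose proof (Km x0 1 ltac:(lra) ltac:(lra) ltac:(lra)).
    apply Rabs_le. lra. }
  assert (He1 : 1 <= exp (K 1 - K (-1))).
  { pose proof (Km (-1) 1 ltac:(lra) ltac:(lra) ltac:(lra)). pose proof exp_0.
    destruct (Req_dec (K 1 - K (-1)) 0) as [-> | Hne]; [lra|].
    pose proof (exp_increasing 0 (K 1 - K (-1)) ltac:(lra)). lra. }
  assert (Hee : exp (Rabs (K x - K x0)) <= exp (K 1 - K (-1))).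
  { destruct Hle as [Hl | ->]; [left; now apply exp_increasing | lra]. }
  assert (Hsq : 0 <= e ^ 2) by apply pow2_ge_0.
  destruct (abs_le_of_sqnorm du du1 dv dv1 x (exp (K 1 - K (-1)) * Rabs (t - s))) as (Z1 & _ & Z3 & _).
  - pose proof (Rabs_pos (t - s)). nra.
  - rewrite Rpow_mult_distr, pow2_abs. fold e.
    set (X := exp (K 1 - K (-1))) in *. assert (X <= X ^ 2) by nra. nra.
  - split; easy.
Qed.

(** * Existence of solutions by Picard iteration *)

Lemma geometric_limit (u : nat -> R) C :
  (forall n, Rabs (u (S n) - u n) <= C * (1 / 4) ^ n) ->
  exists l, forall n, Rabs (l - u n) <= 2 * C * (1 / 4) ^ n.
Proof.
  intros H.
  assert (p4 : forall n, 0 < (1 / 4) ^ n) by (intros; apply pow_lt; lra).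
  assert (HC : 0 <= C) by (specialize (H O); simpl in H; pose proof (Rabs_pos (u 1%nat - u O)); lra).
  assert (W : forall n m, Rabs (u (n + m)%nat - u n) <= 2 * C * (1 / 4) ^ n - 2 * C * (1 / 4) ^ (n + m)).
  { intros n m. induction m as [|m IH].
    - rewrite Nat.add_0_r, !Rminus_diag, Rabs_R0. lra.
    - rewrite Nat.add_succ_r. specialize (H (n + m)%nat). specialize (p4 (n + m)%nat).
      replace (u (S (n + m)) - u n) with ((u (S (n + m)) - u (n + m)%nat) + (u (n + m)%nat - u n)) by ring.
      eapply Rle_trans; [apply Rabs_triang|]. simpl. nra. }
  assert (W' : forall n m, Rabs (u (n + m)%nat - u n) <= 2 * C * (1 / 4) ^ n).
  { intros n m. specialize (W n m). specialize (p4 (n + m)%nat). nra. }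
  destruct (Rcomplete.R_complete u) as [l Hl].
  - intros eps He. destruct (pow_lt_1_zero (1 / 4)) with (y := eps / (4 * C + 1)) as [n Hn].
    + rewrite Rabs_pos_eq; lra.
    + apply Rdiv_lt_0_compat; lra.
    + specialize (Hn n (le_n _)). rewrite Rabs_pos_eq in Hn by (left; apply p4).
      assert (Hs : 4 * C * (1 / 4) ^ n < eps).
      { apply Rmult_lt_compat_r with (r := 4 * C + 1) in Hn; [|lra].
        replace (eps / (4 * C + 1) * (4 * C + 1)) with eps in Hn by (field; lra). specialize (p4 n). lra. }
      exists n. intros a b Ha Hb. unfold Rdist.
      pose proof (W' n (a - n)%nat) as Wa. pose proof (W' n (b - n)%nat) as Wb.
      replace (n + (a - n))%nat with a in Wa by lia. replace (n + (b - n))%nat with b in Wb by lia.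
      apply Rabs_le_between in Wa. apply Rabs_le_between in Wb. apply Rabs_def1; lra.
  - exists l. intros n. apply (Un_cv_bound u l (u n) _ n Hl). auto.
Qed.

Definition picard_step (P S : R -> R) (x0 c0 c1 d0 d1 : R) (u v a a1 b b1 : R -> R) : Prop :=
  (forall x, derivable_pt_lim a x (a1 x)) /\ (forall x, derivable_pt_lim b x (b1 x)) /\
  continuity a1 /\ continuity b1 /\
  acd (-1) 1 a1 (fun x => P x * u x + S x * v x) /\
  acd (-1) 1 b1 (fun x => P x * v x - S x * u x) /\
  a x0 = c0 /\ a1 x0 = c1 /\ b x0 = d0 /\ b1 x0 = d1.

Lemma antiderivative_from f x0 c : continuity f -> exists F, (forall x, derivable_pt_lim F x (f x)) /\ F x0 = c.
Proof.
  intros Hf. exists (fun x => prim0 f x + (c - prim0 f x0)). split; [|ring].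
  intros x. eapply dpl_plus; [now apply prim0_derive | apply dpl_const | ring].
Qed.

Lemma L1_primitive_from p x0 c : L1 p -> exists F, continuity F /\ acd (-1) 1 F p /\ F x0 = c.
Proof.
  intros Hp. destruct (L1_primitive p Hp) as (F & Fc & Fa).
  exists (fun x => F x + (c - F x0)). split; [cont|]. split; [|ring].
  eapply acd_eq_deriv'; [apply acd_plus; [exact Fa | apply acd_const]|]. intros; cbv beta; ring.
Qed.

Lemma picard_step_exists P S x0 c0 c1 d0 d1 u v : L1 P -> L1 S -> continuity u -> continuity v ->
  exists a a1 b b1, picard_step P S x0 c0 c1 d0 d1 u v a a1 b b1.
Proof.
  intros HP HS Hu Hv.
  destruct (L1_primitive_from (fun x => P x * u x + S x * v x) x0 c1) as (a1 & A1 & A2 & A3).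
  { apply L1_plus; apply L1_mult_cont; auto. }
  destruct (L1_primitive_from (fun x => P x * v x - S x * u x) x0 d1) as (b1 & B1 & B2 & B3).
  { apply L1_eq with (fun x => P x * v x + (-1) * (S x * u x)); [intros; ring|].
    apply L1_plus; [|apply L1_scal]; apply L1_mult_cont; auto. }
  destruct (antiderivative_from a1 x0 c0 A1) as (a & A4 & A5).
  destruct (antiderivative_from b1 x0 d0 B1) as (b & B4 & B5).
  exists a, a1, b, b1. unfold picard_step. tauto.
Qed.

(** The weight [exp (2 |K - K x0|)] makes each integration gain a factor [1 / 2], so the iteration
    contracts on the whole interval at once. *)
Lemma weighted_increment K k F f c x0 : acd (-1) 1 K k -> acd (-1) 1 F f -> in_I x0 -> 0 <= c ->
  (forall x, 0 <= k x) ->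
  (forall x y, -1 <= x -> x <= y -> y <= 1 -> K x <= K y) ->
  (forall x, in_I x -> Rabs (f x) <= c * k x * exp (2 * Rabs (K x - K x0))) ->
  forall x, in_I x -> Rabs (F x - F x0) <= c / 2 * exp (2 * Rabs (K x - K x0)).
Proof.
  intros HK HF Hx0 Hc Hk Km Hle x Hx. unfold in_I in *.
  destruct (Rle_dec x0 x) as [Hxx|Hxx].
  - rewrite (Rabs_pos_eq (K x - K x0)) by (specialize (Km x0 x ltac:(lra) ltac:(lra) ltac:(lra)); lra).
    pose proof (acd_scal _ _ (c / 2) _ _ (acd_exp x0 x (fun y => K y - K x0) (fun y => k y - 0) 2 Hxx
       (acd_minus _ _ _ _ _ _ (acd_sub (-1) 1 x0 x _ _ ltac:(lra) ltac:(lra) HK) (acd_const _ _ (K x0))))) as G.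
    pose proof (acd_abs_le x0 x _ _ _ _ ltac:(lra) Hxx ltac:(lra) (acd_sub (-1) 1 x0 x _ _ ltac:(lra) ltac:(lra) HF) G) as L.
    cbv beta in L. rewrite Rminus_diag, Rmult_0_r, exp_0 in L.
    assert (L' : Rabs (F x - F x0) <= c / 2 * exp (2 * (K x - K x0)) - c / 2 * 1); [|lra].
    apply L. apply ae_all. intros y Hy Hyx. eapply Rle_trans; [now apply Hle|].
    rewrite Rabs_pos_eq by (specialize (Km x0 y ltac:(lra) ltac:(lra) ltac:(lra)); lra). right; field.
  - assert (Hxx' : x <= x0) by lra.
    rewrite (Rabs_minus_sym (K x)), (Rabs_pos_eq (K x0 - K x)) by (specialize (Km x x0 ltac:(lra) ltac:(lra) ltac:(lra)); lra).
    pose proof (acd_scal _ _ (- c / 2) _ _ (acd_exp x x0 (fun y => K y - K x0) (fun y => k y - 0) (-2) Hxx'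
       (acd_minus _ _ _ _ _ _ (acd_sub (-1) 1 x x0 _ _ ltac:(lra) ltac:(lra) HK) (acd_const _ _ (K x0))))) as G.
    pose proof (acd_abs_le x x0 _ _ _ _ ltac:(lra) Hxx' ltac:(lra) (acd_sub (-1) 1 x x0 _ _ ltac:(lra) ltac:(lra) HF) G) as L.
    cbv beta in L. rewrite Rminus_diag, Rmult_0_r, exp_0 in L. rewrite Rabs_minus_sym.
    replace (-2 * (K x - K x0)) with (2 * (K x0 - K x)) in L by ring.
    assert (L' : Rabs (F x0 - F x) <= - c / 2 * 1 - - c / 2 * exp (2 * (K x0 - K x))); [|lra].
    apply L. apply ae_all. intros y Hy Hyx. eapply Rle_trans; [now apply Hle|].
    rewrite Rabs_minus_sym, Rabs_pos_eq by (specialize (Km y x0 ltac:(lra) ltac:(lra) ltac:(lra)); lra).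
    replace (-2 * (K y - K x0)) with (2 * (K x0 - K y)) by ring. right; field.
Qed.

(** Two integrations, first for the derivatives and then for the functions, give [1 / 4]. The
    summand 1 in [1 + |P| + |S|] is what the second one needs. *)
Lemma picard_contraction P S K x0 c0 c1 d0 d1 u v a a1 b b1 u' v' a' a1' b' b1' c :
  acd (-1) 1 K (fun x => 1 + Rabs (P x) + Rabs (S x)) ->
  (forall x y, -1 <= x -> x <= y -> y <= 1 -> K x <= K y) -> in_I x0 -> 0 <= c ->
  picard_step P S x0 c0 c1 d0 d1 u v a a1 b b1 ->
  picard_step P S x0 c0 c1 d0 d1 u' v' a' a1' b' b1' ->
  (forall x, in_I x -> Rabs (u x - u' x) <= c * exp (2 * Rabs (K x - K x0))
                    /\ Rabs (v x - v' x) <= c * exp (2 * Rabs (K x - K x0))) ->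
  forall x, in_I x -> Rabs (a x - a' x) <= c / 4 * exp (2 * Rabs (K x - K x0))
                    /\ Rabs (b x - b' x) <= c / 4 * exp (2 * Rabs (K x - K x0)).
Proof.
  intros HK Km Hx0 Hc (A1 & A2 & A3 & A4 & A5 & A6 & A7 & A8 & A9 & A10)
    (B1 & B2 & B3 & B4 & B5 & B6 & B7 & B8 & B9 & B10) Hle.
  assert (Hk : forall x, 1 <= 1 + Rabs (P x) + Rabs (S x)).
  { intros y. pose proof (Rabs_pos (P y)). pose proof (Rabs_pos (S y)). lra. }
  assert (Hk0 : forall x, 0 <= 1 + Rabs (P x) + Rabs (S x)) by (intros y; specialize (Hk y); lra).
  assert (D1 : forall x, in_I x -> Rabs (a1 x - a1' x) <= c / 2 * exp (2 * Rabs (K x - K x0))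
                    /\ Rabs (b1 x - b1' x) <= c / 2 * exp (2 * Rabs (K x - K x0))).
  { intros x Hx. split.
    - pose proof (weighted_increment K _ _ _ c x0 HK (acd_minus _ _ _ _ _ _ A5 B5) Hx0 Hc Hk0 Km) as W. cbv beta in W.
      rewrite A8, B8, (Rminus_diag c1) in W.
      replace (a1 x - a1' x) with (a1 x - a1' x - 0) by ring. apply W; auto.
      intros y Hy. destruct (Hle y Hy) as [L1 L2].
      replace (_ - _) with (P y * (u y - u' y) + S y * (v y - v' y)) by ring.
      eapply Rle_trans; [apply Rabs_triang|]. rewrite !Rabs_mult.
      pose proof (Rabs_pos (P y)). pose proof (Rabs_pos (S y)).
      pose proof (Rabs_pos (u y - u' y)). nra.
    - pose proof (weighted_increment K _ _ _ c x0 HK (acd_minus _ _ _ _ _ _ A6 B6) Hx0 Hc Hk0 Km) as W. cbv beta in W.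
      rewrite A10, B10, (Rminus_diag d1) in W.
      replace (b1 x - b1' x) with (b1 x - b1' x - 0) by ring. apply W; auto.
      intros y Hy. destruct (Hle y Hy) as [L1 L2].
      replace (_ - _) with (P y * (v y - v' y) + - S y * (u y - u' y)) by ring.
      eapply Rle_trans; [apply Rabs_triang|]. rewrite !Rabs_mult, Rabs_Ropp.
      pose proof (Rabs_pos (P y)). pose proof (Rabs_pos (S y)).
      pose proof (Rabs_pos (u y - u' y)). nra. }
  assert (Aa : acd (-1) 1 a a1) by (apply acd_C1; auto; lra).
  assert (Ba : acd (-1) 1 a' a1') by (apply acd_C1; auto; lra).
  assert (Ab : acd (-1) 1 b b1) by (apply acd_C1; auto; lra).
  assert (Bb : acd (-1) 1 b' b1') by (apply acd_C1; auto; lra).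
  intros x Hx. split.
  - pose proof (weighted_increment K _ _ _ (c / 2) x0 HK (acd_minus _ _ _ _ _ _ Aa Ba) Hx0 ltac:(lra) Hk0 Km) as W.
    cbv beta in W. rewrite A7, B7, (Rminus_diag c0) in W.
    replace (a x - a' x) with (a x - a' x - 0) by ring. replace (c / 4) with (c / 2 / 2) by field. apply W; auto.
    intros y Hy. destruct (D1 y Hy) as [L1 _]. specialize (Hk y).
    apply Rle_trans with (1 := L1). apply Rmult_le_compat_r; [left; apply exp_pos | nra].
  - pose proof (weighted_increment K _ _ _ (c / 2) x0 HK (acd_minus _ _ _ _ _ _ Ab Bb) Hx0 ltac:(lra) Hk0 Km) as W.
    cbv beta in W. rewrite A9, B9, (Rminus_diag d0) in W.
    replace (b x - b' x) with (b x - b' x - 0) by ring. replace (c / 4) with (c / 2 / 2) by field. apply W; auto.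
    intros y Hy. destruct (D1 y Hy) as [_ L1]. specialize (Hk y).
    apply Rle_trans with (1 := L1). apply Rmult_le_compat_r; [left; apply exp_pos | nra].
Qed.

Lemma cont_bounded f : continuity f -> exists B, 0 < B /\ forall x, in_I x -> Rabs (f x) <= B.
Proof.
  intros Hf. destruct (continuity_ab_maj (fun x => Rabs (f x)) (-1) 1 ltac:(lra)) as (M & HM & _).
  { intros c _. assert (Hcc : continuity (fun x => Rabs (f x))) by cont. apply Hcc. }
  exists (Rabs (f M) + 1). split; [pose proof (Rabs_pos (f M)); lra|].
  intros x Hx. specialize (HM x Hx). lra.
Qed.

Lemma unif_limit_cont (f : nat -> R -> R) F C : (forall n, continuity (f n)) ->
  (forall n x, Rabs (F x - f n x) <= C * (1 / 4) ^ n) -> continuity F.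
Proof.
  intros Hf HF x eps He.
  assert (HC : 0 <= C) by (specialize (HF O x); simpl in HF; pose proof (Rabs_pos (F x - f O x)); lra).
  destruct (pow_lt_1_zero (1 / 4)) with (y := eps / (4 * (C + 1))) as [n Hn].
  { rewrite Rabs_pos_eq; lra. }
  { apply Rdiv_lt_0_compat; lra. }
  specialize (Hn n (le_n _)). rewrite Rabs_pos_eq in Hn by (apply pow_le; lra).
  assert (Hs : C * (1 / 4) ^ n < eps / 3).
  { apply Rmult_lt_compat_r with (r := 4 * (C + 1)) in Hn; [|lra].
    replace (eps / (4 * (C + 1)) * (4 * (C + 1))) with eps in Hn by (field; lra).
    assert (0 < (1 / 4) ^ n) by (apply pow_lt; lra). lra. }
  destruct (Hf n x (eps / 3)) as (d & Hd & K); [lra|].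
  exists d. split; [easy|]. intros y Hy. specialize (K y Hy). simpl in *. unfold Rdist in *.
  pose proof (HF n x) as Fx. pose proof (HF n y) as Fy.
  apply Rabs_le_between in Fx. apply Rabs_le_between in Fy. apply Rabs_def2 in K. apply Rabs_def1; lra.
Qed.

Lemma sol_exists P S x0 c0 c1 d0 d1 : L1 P -> L1 S -> in_I x0 ->
  exists u u1 v v1, sol P S u u1 v v1 /\ u x0 = c0 /\ u1 x0 = c1 /\ v x0 = d0 /\ v1 x0 = d1.
Proof.
  intros HP HS Hx0.
  destruct (L1_primitive_nondecr (fun x => 1 + Rabs (P x) + Rabs (S x)) (L1_coef P S HP HS)) as (K & Kc & Ka & Km).
  { intros y. pose proof (Rabs_pos (P y)). pose proof (Rabs_pos (S y)). lra. }
  set (E := fun x => exp (2 * Rabs (K x - K x0))).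
  set (T := ((R -> R) * (R -> R))%type).
  (* A next iterate is chosen for every pair of functions; for discontinuous pairs it is
     arbitrary. *)
  assert (Hn : forall p : T, exists r : T, continuity (fst p) -> continuity (snd p) ->
     exists a1 b1, picard_step P S x0 c0 c1 d0 d1 (fst p) (snd p) (fst r) a1 (snd r) b1).
  { intros [u v]. destruct (classic (continuity u /\ continuity v)) as [[Hu Hv]|Hc].
    - destruct (picard_step_exists P S x0 c0 c1 d0 d1 u v HP HS Hu Hv) as (a & a1 & b & b1 & H).
      exists (a, b). intros _ _. now exists a1, b1.
    - exists (u, v). simpl. tauto. }
  set (next := fun p => proj1_sig (constructive_indefinite_description _ (Hn p))).
  assert (Hnext : forall p, continuity (fst p) -> continuity (snd p) ->
     exists a1 b1, picard_step P S x0 c0 c1 d0 d1 (fst p) (snd p) (fst (next p)) a1 (snd (next p)) b1).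
  { intros p. exact (proj2_sig (constructive_indefinite_description _ (Hn p))). }
  set (z := fix z n := match n with O => ((fun _ => 0), (fun _ => 0)) : T | Datatypes.S m => next (z m) end).
  set (U := fun n => fst (z n)). set (V := fun n => snd (z n)).
  assert (Hc : forall n, continuity (U n) /\ continuity (V n)).
  { induction n as [|n [IU IV]].
    - split; exact (cont_const 0).
    - destruct (Hnext (z n) IU IV) as (a1 & b1 & A1 & A2 & _). split; eapply cont_dpl; [exact A1 | exact A2]. }
  assert (Hst : forall n, exists a1 b1, picard_step P S x0 c0 c1 d0 d1 (U n) (V n) (U (Datatypes.S n)) a1 (V (Datatypes.S n)) b1).
  { intros n. apply Hnext; apply Hc. }
  destruct (cont_bounded (U 1%nat) (proj1 (Hc 1%nat))) as (BU & HBU & HU).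
  destruct (cont_bounded (V 1%nat) (proj2 (Hc 1%nat))) as (BV & HBV & HV).
  assert (E1 : forall x, 1 <= E x).
  { intros x. unfold E. pose proof (exp_ineq1_le (2 * Rabs (K x - K x0))). pose proof (Rabs_pos (K x - K x0)). lra. }
  assert (p4 : forall n, 0 < (1 / 4) ^ n) by (intros; apply pow_lt; lra).
  assert (Hd : forall n x, in_I x -> Rabs (U (Datatypes.S n) x - U n x) <= (BU + BV) * (1 / 4) ^ n * E x
       /\ Rabs (V (Datatypes.S n) x - V n x) <= (BU + BV) * (1 / 4) ^ n * E x).
  { induction n as [|n IH]; intros x Hx.
    - specialize (HU x Hx). specialize (HV x Hx). specialize (E1 x).
      change (U O x) with 0. change (V O x) with 0. rewrite !Rminus_0_r. simpl ((1 / 4) ^ 0). nra.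
    - destruct (Hst n) as (a1 & b1 & S1). destruct (Hst (Datatypes.S n)) as (a1' & b1' & S2).
      pose proof (picard_contraction P S K x0 c0 c1 d0 d1 _ _ _ _ _ _ _ _ _ _ _ _ ((BU + BV) * (1 / 4) ^ n) Ka Km Hx0
        ltac:(specialize (p4 n); nra) S2 S1 IH x Hx) as [D1 D2].
      replace ((BU + BV) * (1 / 4) ^ Datatypes.S n) with ((BU + BV) * (1 / 4) ^ n / 4) by (simpl; field).
      split; easy. }
  destruct (cont_bounded E) as (BE & HBE & HE).
  { unfold E. apply (continuity_comp (fun x => 2 * Rabs (K x - K x0)) exp); [cont|].
    intros x. apply derivable_continuous_pt, derivable_pt_exp. }
  set (C := (BU + BV) * BE).
  assert (Hb : forall n x, in_I x -> (BU + BV) * (1 / 4) ^ n * E x <= C * (1 / 4) ^ n).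
  { intros n x Hx. specialize (HE x Hx). rewrite Rabs_pos_eq in HE by (specialize (E1 x); lra).
    unfold C. specialize (p4 n).
    replace ((BU + BV) * BE * (1 / 4) ^ n) with ((BU + BV) * (1 / 4) ^ n * BE) by ring.
    apply Rmult_le_compat_l; [nra|easy]. }
  (* Convergence is known on [[-1, 1]] only; clamping the argument makes the limits continuous on
     the line, as one further Picard step requires. *)
  assert (Hcl : forall x, in_I (clamp (-1) 1 x)) by (intros x; apply clamp_in; lra).
  assert (Hlu : forall x, exists l, forall n, Rabs (l - U n (clamp (-1) 1 x)) <= 2 * C * (1 / 4) ^ n).
  { intros x. apply (geometric_limit (fun n => U n (clamp (-1) 1 x))). intros n.
    eapply Rle_trans; [apply (Hd n _ (Hcl x)) | apply Hb, Hcl]. }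
  assert (Hlv : forall x, exists l, forall n, Rabs (l - V n (clamp (-1) 1 x)) <= 2 * C * (1 / 4) ^ n).
  { intros x. apply (geometric_limit (fun n => V n (clamp (-1) 1 x))). intros n.
    eapply Rle_trans; [apply (Hd n _ (Hcl x)) | apply Hb, Hcl]. }
  set (u := fun x => proj1_sig (constructive_indefinite_description _ (Hlu x))).
  assert (Hu : forall x n, Rabs (u x - U n (clamp (-1) 1 x)) <= 2 * C * (1 / 4) ^ n).
  { intros x. exact (proj2_sig (constructive_indefinite_description _ (Hlu x))). }
  set (v := fun x => proj1_sig (constructive_indefinite_description _ (Hlv x))).
  assert (Hv : forall x n, Rabs (v x - V n (clamp (-1) 1 x)) <= 2 * C * (1 / 4) ^ n).
  { intros x. exact (proj2_sig (constructive_indefinite_description _ (Hlv x))). }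
  assert (Hclc : continuity (clamp (-1) 1)) by (apply (cont_clamp (-1) 1 (fun x => x)); [lra | apply ac_id]).
  assert (uc : continuity u).
  { apply unif_limit_cont with (f := fun n x => U n (clamp (-1) 1 x)) (C := 2 * C); auto.
    intros n. apply (continuity_comp (clamp (-1) 1) (U n)); [easy|apply Hc]. }
  assert (vc : continuity v).
  { apply unif_limit_cont with (f := fun n x => V n (clamp (-1) 1 x)) (C := 2 * C); auto.
    intros n. apply (continuity_comp (clamp (-1) 1) (V n)); [easy|apply Hc]. }
  (* One more step from the limit supplies the derivatives. By contraction its result agrees with
     the limit on [[-1, 1]], so it solves the equation. *)
  destruct (picard_step_exists P S x0 c0 c1 d0 d1 u v HP HS uc vc) as (a & a1 & b & b1 & Hab).
  assert (HC : 0 <= C) by (unfold C; nra).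
  assert (Hclose : forall n x, in_I x -> Rabs (a x - U (Datatypes.S n) x) <= C * (1 / 4) ^ n * E x
     /\ Rabs (b x - V (Datatypes.S n) x) <= C * (1 / 4) ^ n * E x).
  { intros n x Hx. destruct (Hst n) as (a1' & b1' & S1).
    destruct (picard_contraction P S K x0 c0 c1 d0 d1 _ _ _ _ _ _ _ _ _ _ _ _ (2 * C * (1 / 4) ^ n) Ka Km Hx0
        ltac:(specialize (p4 n); nra) Hab S1) with (x := x) as [D1 D2]; auto.
    - intros y Hy. specialize (Hu y n). specialize (Hv y n). rewrite clamp_id in Hu, Hv by easy.
      specialize (E1 y). specialize (p4 n). fold (E y).
      assert (0 <= 2 * C * (1 / 4) ^ n) by nra.
      split; nra.
    - fold (E x) in D1, D2. specialize (E1 x). specialize (p4 n).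
      assert (0 <= C * (1 / 4) ^ n * E x) by (apply Rmult_le_pos; nra).
      replace (2 * C * (1 / 4) ^ n / 4 * E x) with (C * (1 / 4) ^ n * E x / 2) in D1, D2 by field.
      lra. }
  assert (small : forall y M, (forall n, Rabs y <= M * (1 / 4) ^ n) -> y = 0).
  { intros y M HM. apply NNPP. intros Hy. apply Rabs_pos_lt in Hy.
    pose proof (HM O) as HM0. simpl in HM0.
    destruct (pow_lt_1_zero (1 / 4)) with (y := Rabs y / M) as [n Hn'].
    - rewrite Rabs_pos_eq; lra.
    - apply Rdiv_lt_0_compat; lra.
    - specialize (Hn' n (le_n _)). specialize (HM n). rewrite Rabs_pos_eq in Hn' by (left; apply p4).
      apply Rmult_lt_compat_l with (r := M) in Hn'; [|lra].
      replace (M * (Rabs y / M)) with (Rabs y) in Hn' by (field; lra). lra. }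
  assert (Ha : forall x, in_I x -> a x = u x).
  { intros x Hx. apply Rminus_diag_uniq. apply (small _ (C * BE + 2 * C)). intros n.
    destruct (Hclose n x Hx) as [D _]. pose proof (Hu x (Datatypes.S n)) as D'. rewrite clamp_id in D' by easy.
    specialize (HE x Hx). rewrite Rabs_pos_eq in HE by (specialize (E1 x); lra). simpl in D'.
    specialize (p4 n). assert (0 <= C * (1 / 4) ^ n) by nra.
    assert (C * (1 / 4) ^ n * E x <= C * (1 / 4) ^ n * BE) by nra.
    apply Rabs_le_between in D. apply Rabs_le_between in D'. apply Rabs_le. lra. }
  assert (Hb' : forall x, in_I x -> b x = v x).
  { intros x Hx. apply Rminus_diag_uniq. apply (small _ (C * BE + 2 * C)). intros n.
    destruct (Hclose n x Hx) as [_ D]. pose proof (Hv x (Datatypes.S n)) as D'. rewrite clamp_id in D' by easy.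
    specialize (HE x Hx). rewrite Rabs_pos_eq in HE by (specialize (E1 x); lra). simpl in D'.
    specialize (p4 n). assert (0 <= C * (1 / 4) ^ n) by nra.
    assert (C * (1 / 4) ^ n * E x <= C * (1 / 4) ^ n * BE) by nra.
    apply Rabs_le_between in D. apply Rabs_le_between in D'. apply Rabs_le. lra. }
  exists a, a1, b, b1. destruct Hab as (A1 & A2 & A3 & A4 & A5 & A6 & A7 & A8 & A9 & A10).
  split; [|tauto]. split; [|split; [|split; [|split; [|split]]]]; auto.
  - apply acd_eq_deriv with (1 := A5). apply ae_all. intros x Hx _. now rewrite Ha, Hb'.
  - apply acd_eq_deriv with (1 := A6). apply ae_all. intros x Hx _. now rewrite Ha, Hb'.
Qed.

(** * The definite problem *)

(** An eigenfunction is given with derivatives in the interior only. It is traded for the solution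
    with the same data at [-1], which agrees with it on [[-1, 1]] by uniqueness. *)
Lemma eigen_sol q w a b : L1 q -> L1 w -> is_eigenvalue q w a b ->
  exists u u1 v v1, sol (fun x => q x - a * w x) (fun x => b * w x) u u1 v v1 /\
    u (-1) = 0 /\ u 1 = 0 /\ v (-1) = 0 /\ v 1 = 0 /\ exists x, in_I x /\ (u x <> 0 \/ v x <> 0).
Proof.
  intros Hq Hw (u & v & u1 & v1 & A1 & A2 & A3 & A4 & Hd & B1 & B2 & B3 & B4 & (x & Hx & Hnz) & Hae).
  assert (W : wsol (fun x => q x - a * w x) (fun x => b * w x) u u1 v v1).
  { split; [|split; [|split]]; split; auto.
    - apply ae_all. intros y _ Hy. now apply Hd.
    - apply ae_all. intros y _ Hy. now apply Hd.
    - apply ae_mp with (1 := Hae). intros y _ (du & dv & D1 & D2 & E1 & E2) _.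
      apply dpl_eq with du; [easy | lra].
    - apply ae_mp with (1 := Hae). intros y _ (du & dv & D1 & D2 & E1 & E2) _.
      apply dpl_eq with dv; [easy | lra]. }
  assert (HP : L1 (fun x => q x - a * w x)).
  { apply L1_eq with (fun x => q x + (- a) * w x); [intros; ring|]. apply L1_plus; auto. now apply L1_scal. }
  assert (HS : L1 (fun x => b * w x)) by now apply L1_scal.
  assert (Hm : in_I (-1)) by (unfold in_I; lra).
  destruct (sol_exists _ _ (-1) (u (-1)) (u1 (-1)) (v (-1)) (v1 (-1)) HP HS Hm)
    as (s & s1 & t & t1 & Hs & C1 & C2 & C3 & C4).
  pose proof (wsol_unique _ _ _ _ _ _ _ _ _ _ (-1) HP HS Hm (sol_wsol _ _ _ _ _ _ Hs) W C1 C2 C3 C4) as U.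
  exists s, s1, t, t1. split; [easy|].
  destruct (U (-1) ltac:(unfold in_I; lra)) as (-> & _ & -> & _).
  destruct (U 1 ltac:(unfold in_I; lra)) as (-> & _ & -> & _).
  do 4 (split; [easy|]). exists x. split; [easy|].
  destruct (U x Hx) as (-> & _ & -> & _). easy.
Qed.

Lemma sol_eigen q w a b u u1 v v1 : sol (fun x => q x - a * w x) (fun x => b * w x) u u1 v v1 ->
  u (-1) = 0 -> u 1 = 0 -> v (-1) = 0 -> v 1 = 0 -> (exists x, in_I x /\ (u x <> 0 \/ v x <> 0)) ->
  is_eigenvalue q w a b.
Proof.
  intros H B1 B2 B3 B4 Hnz. pose proof (sol_wsol _ _ _ _ _ _ H) as ((A1 & _) & (A2 & _) & (A3 & D3) & (A4 & D4)).
  destruct H as (D1 & D2 & _).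
  exists u, v, u1, v1. do 4 (split; [easy|]). split; [auto|]. do 5 (split; [easy|]).
  apply ae_mp2 with (1 := ae_interior) (2 := ae_and _ _ D3 D4). intros x _ Hx [E3 E4].
  eexists. eexists. split; [exact (E3 Hx)|]. split; [exact (E4 Hx)|]. split; ring.
Qed.

Definition dsol (q : R -> R) (l : R) (y y1 : R -> R) : Prop :=
  (forall x, derivable_pt_lim y x (y1 x)) /\ continuity y1 /\
  acd (-1) 1 y1 (fun x => (q x - l) * y x).

(** The products with [-1] and [0] give the coefficients the form of [sol_family_bound]. *)
Lemma dsol_sol q l y y1 : dsol q l y y1 ->
  sol (fun x => q x + l * (-1)) (fun x => l * 0) y y1 (fun _ => 0) (fun _ => 0).
Proof.
  intros (A & B & C). split; [easy|]. split; [intros; apply dpl_const|]. split; [easy|]. split; [apply cont_const|].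
  split.
  - eapply acd_eq_deriv'; [exact C|]. intros; cbv beta; ring.
  - eapply acd_eq_deriv'; [apply acd_const|]. intros; cbv beta; ring.
Qed.

Lemma sol_dsol q P S l y y1 v v1 : sol P S y y1 v v1 -> (forall x, P x = q x - l) -> (forall x, S x = 0) ->
  dsol q l y y1 /\ dsol q l v v1.
Proof.
  intros (A & B & C & D & E & F) HP HS. split; (split; [easy|split; [easy|]]).
  - eapply acd_eq_deriv'; [exact E|]. intros x; cbv beta. rewrite HP, HS. ring.
  - eapply acd_eq_deriv'; [exact F|]. intros x; cbv beta. rewrite HP, HS. ring.
Qed.

Lemma L1_shift q l : L1 q -> L1 (fun x => q x + l * (-1)).
Proof. intros Hq. apply L1_plus; auto. apply L1_cont, cont_const. Qed.

Lemma L1_zero l : L1 (fun _ => l * 0).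
Proof. apply L1_cont, cont_const. Qed.

Lemma dsol_exists q l x0 c0 c1 : L1 q -> in_I x0 -> exists y y1, dsol q l y y1 /\ y x0 = c0 /\ y1 x0 = c1.
Proof.
  intros Hq Hx0. destruct (sol_exists _ _ x0 c0 c1 0 0 (L1_shift q l Hq) (L1_zero l) Hx0)
    as (u & u1 & v & v1 & Hs & A & B & _).
  exists u, u1. split; [|easy]. apply (sol_dsol q _ _ l _ _ _ _ Hs); intros; ring.
Qed.

Lemma dsol_lin q l y y1 z z1 a b : dsol q l y y1 -> dsol q l z z1 ->
  dsol q l (fun x => a * y x + b * z x) (fun x => a * y1 x + b * z1 x).
Proof.
  intros H1 H2. refine (proj1 (sol_dsol q _ _ l _ _ _ _
    (sol_lin _ _ _ _ _ _ _ _ _ _ a b (dsol_sol _ _ _ _ H1) (dsol_sol _ _ _ _ H2)) _ _)); intros; ring.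
Qed.

Lemma dsol_unique q l y y1 z z1 x0 : L1 q -> in_I x0 -> dsol q l y y1 -> dsol q l z z1 ->
  y x0 = z x0 -> y1 x0 = z1 x0 -> forall x, in_I x -> y x = z x /\ y1 x = z1 x.
Proof.
  intros Hq Hx0 H1 H2 E1 E2 x Hx.
  destruct (wsol_unique _ _ _ _ _ _ _ _ _ _ x0 (L1_shift q l Hq) (L1_zero l) Hx0
    (sol_wsol _ _ _ _ _ _ (dsol_sol _ _ _ _ H1)) (sol_wsol _ _ _ _ _ _ (dsol_sol _ _ _ _ H2)) E1 E2 eq_refl eq_refl x Hx).
  tauto.
Qed.

Lemma dsol_zero_dsol q l : dsol q l (fun _ => 0) (fun _ => 0).
Proof.
  split; [intros; apply dpl_const|]. split; [apply cont_const|].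
  eapply acd_eq_deriv'; [apply acd_const|]. intros; cbv beta; ring.
Qed.

Lemma dsol_zero q l y y1 x0 : L1 q -> in_I x0 -> dsol q l y y1 ->
  y x0 = 0 -> y1 x0 = 0 -> forall x, in_I x -> y x = 0 /\ y1 x = 0.
Proof.
  intros Hq Hx0 H1 E1 E2. apply (dsol_unique q l y y1 (fun _ => 0) (fun _ => 0) x0); auto.
  apply dsol_zero_dsol.
Qed.

Lemma dsol_acd q l y y1 : dsol q l y y1 -> acd (-1) 1 y y1.
Proof. intros (A & B & _). apply acd_C1; auto; lra. Qed.

Lemma dsol_wronskian q l m y y1 z z1 : dsol q l y y1 -> dsol q m z z1 ->
  acd (-1) 1 (fun x => y1 x * z x - y x * z1 x) (fun x => (m - l) * (y x * z x)).
Proof.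
  intros H1 H2. pose proof (dsol_acd _ _ _ _ H1) as A. pose proof (dsol_acd _ _ _ _ H2) as B.
  destruct H1 as (_ & _ & C). destruct H2 as (_ & _ & D).
  eapply acd_eq_deriv'; [apply acd_minus; apply acd_mult; try eassumption; lra|].
  intros; cbv beta; ring.
Qed.

(** * The Dirichlet solution as a function of the spectral parameter *)

Lemma sign_near f x l : derivable_pt_lim f x l -> f x = 0 -> l <> 0 ->
  exists d, 0 < d /\ forall y, Rabs (y - x) < d -> y <> x -> 0 < l * (y - x) * f y.
Proof.
  intros Hf H0 Hl. apply Rabs_pos_lt in Hl as Hl'.
  destruct (dpl_bound f x l (Rabs l / 2) Hf) as (d & Hd & K); [lra|].
  exists d. split; [easy|]. intros y Hy Hne. specialize (K y Hy). rewrite H0, Rminus_0_r in K.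
  set (t := y - x) in *. assert (Ht : t <> 0) by (unfold t; lra). clearbody t.
  assert (K' : Rabs (f y - l * t) <= Rabs (l * t) / 2).
  { rewrite Rabs_mult. lra. }
  assert (Hlt : l * t <> 0) by now apply Rmult_integral_contrapositive.
  set (s := l * t) in *. clearbody s.
  destruct (Rlt_dec s 0).
  - rewrite (Rabs_left s) in K' by easy. apply Rabs_le_between in K'. nra.
  - rewrite (Rabs_pos_eq s) in K' by lra. apply Rabs_le_between in K'. nra.
Qed.

(** With [T = int |q|], Young's inequality bounds [y ^ 2] up to a zero [x0] by [M = int y' ^ 2 / (T
    + 1) + (T + 1) int y ^ 2]. Testing the equation with [y] gives
    [int y' ^ 2 - l int y ^ 2 <= T M], whereas for [l <= - (T + 1) ^ 2] the left side is at least
    [(T + 1) M]. So [M <= 0] and [y] vanishes up to [x0], against [y1 (-1) = 1]. *)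
Lemma dirichlet_nonvanishing q : L1 q -> exists L, 0 < L /\ forall l y y1, l <= - L -> dsol q l y y1 ->
  y (-1) = 0 -> y1 (-1) = 1 -> forall x, -1 < x <= 1 -> y x <> 0.
Proof.
  intros Hq. destruct (L1_primitive_nondecr (fun x => Rabs (q x)) (L1_abs q Hq)) as (Q & Qc & Qa & Qm).
  { intros; apply Rabs_pos. }
  set (T := Q 1 - Q (-1)).
  assert (HT : 0 <= T) by (specialize (Qm (-1) 1 ltac:(lra) ltac:(lra) ltac:(lra)); unfold T; lra).
  exists ((T + 1) * (T + 1)). split; [nra|]. intros l y y1 Hl Hy Hy0 Hy1 x0 Hx0 Hz.
  pose proof (dsol_acd _ _ _ _ Hy) as Ya. destruct Hy as (Yd & Yc1 & Ya1).
  pose proof (cont_dpl _ _ Yd) as Yc.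
  assert (Ea : acd (-1) 1 (prim0 (fun x => y1 x ^ 2)) (fun x => y1 x ^ 2)) by (apply prim0_acd; [lra|cont]).
  assert (Ga : acd (-1) 1 (prim0 (fun x => y x ^ 2)) (fun x => y x ^ 2)) by (apply prim0_acd; [lra|cont]).
  set (E := prim0 (fun x => y1 x ^ 2)) in *. set (G := prim0 (fun x => y x ^ 2)) in *.
  assert (E0 : E (-1) = 0) by apply prim0_start. assert (G0 : G (-1) = 0) by apply prim0_start.
  assert (mono : forall F f, acd (-1) 1 F f -> (forall x, 0 <= f x) -> forall s t, -1 <= s -> s <= t -> t <= 1 -> F s <= F t).
  { intros F f HF Hf s t Hs Hst Ht. apply acd_nonneg with f; auto.
    - apply acd_sub with (-1) 1; auto.
    - apply ae_all; auto. }
  assert (Em := mono E _ Ea ltac:(intros; apply pow2_ge_0)).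
  assert (Gm := mono G _ Ga ltac:(intros; apply pow2_ge_0)).
  set (M := / (T + 1) * E x0 + (T + 1) * G x0).
  assert (HM : forall x, -1 <= x <= x0 -> y x ^ 2 <= M).
  { intros x Hx.
    pose proof (acd_plus _ _ _ _ _ _ (acd_scal _ _ (/ (T + 1)) _ _ Ea) (acd_scal _ _ (T + 1) _ _ Ga)) as D.
    pose proof (acd_le (-1) x _ _ _ _ ltac:(lra) ltac:(lra) ltac:(lra)
       (acd_sub (-1) 1 (-1) x _ _ (Rle_refl _) ltac:(lra) (acd_sq (-1) 1 _ _ ltac:(lra) Ya))
       (acd_sub (-1) 1 (-1) x _ _ (Rle_refl _) ltac:(lra) D)) as L. cbv beta in L.
    rewrite Hy0, E0, G0 in L.
    assert (L' : y x ^ 2 - 0 ^ 2 <= / (T + 1) * E x + (T + 1) * G x - (/ (T + 1) * 0 + (T + 1) * 0)).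
    { apply L. apply ae_all. intros z _ _.
      assert (Hi : / (T + 1) * (T + 1) = 1) by (apply Rinv_l; lra).
      assert (Hp : 0 < / (T + 1)) by (apply Rinv_0_lt_compat; lra).
      pose proof (pow2_ge_0 (y1 z - (T + 1) * y z)) as Sq.
      assert (0 <= / (T + 1) * (y1 z - (T + 1) * y z) ^ 2) by (apply Rmult_le_pos; lra).
      replace (/ (T + 1) * (y1 z - (T + 1) * y z) ^ 2) with
        (/ (T + 1) * y1 z ^ 2 - 2 * (/ (T + 1) * (T + 1)) * y1 z * y z + (/ (T + 1) * (T + 1)) * (T + 1) * y z ^ 2) in H by ring.
      rewrite Hi in H. lra. }
    specialize (Em x x0 ltac:(lra) ltac:(lra) ltac:(lra)). specialize (Gm x x0 ltac:(lra) ltac:(lra) ltac:(lra)).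
    assert (Hp : 0 < / (T + 1)) by (apply Rinv_0_lt_compat; lra). unfold M. nra. }
  pose proof (acd_mult (-1) 1 _ _ _ _ ltac:(lra) Ya Ya1) as D1.
  pose proof (acd_minus _ _ _ _ _ _ (acd_minus _ _ _ _ _ _ Ea (acd_scal _ _ l _ _ Ga)) (acd_scal _ _ M _ _ Qa)) as D2.
  pose proof (acd_le (-1) x0 _ _ _ _ ltac:(lra) ltac:(lra) ltac:(lra)
       (acd_sub (-1) 1 (-1) x0 _ _ (Rle_refl _) ltac:(lra) D2)
       (acd_sub (-1) 1 (-1) x0 _ _ (Rle_refl _) ltac:(lra) D1)) as L. cbv beta in L.
  rewrite Hy0, E0, G0, Hz in L.
  assert (L' : E x0 - l * G x0 - M * Q x0 - (0 - l * 0 - M * Q (-1)) <= 0 * y1 x0 - 0 * y1 (-1)).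
  { apply L. apply ae_all. intros z _ Hzx. specialize (HM z ltac:(lra)).
    pose proof (Rle_abs (- q z)) as Aq. rewrite Rabs_Ropp in Aq. pose proof (pow2_ge_0 (y z)).
    pose proof (Rabs_pos (q z)). nra. }
  assert (HE : 0 <= E x0) by (rewrite <- E0; apply Em; lra).
  assert (HG : 0 <= G x0) by (rewrite <- G0; apply Gm; lra).
  assert (HQ : Q x0 - Q (-1) <= T) by (specialize (Qm x0 1 ltac:(lra) ltac:(lra) ltac:(lra)); unfold T; lra).
  assert (Hp : 0 < / (T + 1)) by (apply Rinv_0_lt_compat; lra).
  assert (HM0 : 0 <= M) by (unfold M; nra).
  assert (Hsum : / (T + 1) * E x0 + (T + 1) * G x0 <= 0).
  { assert (X : E x0 - l * G x0 <= M * T) by nra.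
    unfold M in X.
    assert (Hi : / (T + 1) * T = 1 - / (T + 1)) by (field; lra).
    replace ((/ (T + 1) * E x0 + (T + 1) * G x0) * T) with ((/ (T + 1) * T) * E x0 + (T + 1) * T * G x0) in X by ring.
    rewrite Hi in X. nra. }
  destruct (sign_near y (-1) 1) as (d & Hd & K); auto; try lra.
  { rewrite <- Hy1. apply Yd. }
  set (t := Rmin x0 (-1 + d / 2)).
  assert (Ht : -1 < t) by (apply Rmin_glb_lt; lra).
  assert (Ht1 : t <= x0) by apply Rmin_l. assert (Ht2 : t <= -1 + d / 2) by apply Rmin_r.
  specialize (K t ltac:(rewrite Rabs_pos_eq; lra) ltac:(lra)).
  specialize (HM t ltac:(lra)). fold M in Hsum.
  assert (y t = 0).
  { apply Rsqr_0_uniq. rewrite Rsqr_pow2. pose proof (pow2_ge_0 (y t)). lra. }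
  rewrite H in K. lra.
Qed.

(** All these solutions vanish at [-1], so their minimum over the closed interval is never positive.
    A common interval of positivity lets [first_touch] start at [-1 + d] instead. *)
Lemma dirichlet_pos_near q L : L1 q -> 0 <= L -> exists d, 0 < d < 2 /\ forall l y y1, Rabs l <= L -> dsol q l y y1 ->
  y (-1) = 0 -> y1 (-1) = 1 -> forall x, -1 < x <= -1 + d -> 0 < y x.
Proof.
  intros Hq HL.
  assert (Hm : in_I (-1)) by (unfold in_I; lra).
  destruct (sol_family_bound q (fun _ => -1) (fun _ => 0) (-1) L 0 1 0 0 Hq
    (L1_cont _ (cont_const _)) (L1_cont _ (cont_const _)) Hm HL) as (B & HB & Bd).
  destruct (L1_primitive_nondecr (fun x => Rabs (q x) + L)) as (K & Kc & Ka & Km).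
  { apply L1_plus; [now apply L1_abs | apply L1_cont, cont_const]. }
  { intros x. pose proof (Rabs_pos (q x)). lra. }
  (* As long as [K] has grown by less than [1 / (2 B)], the derivative [y1] stays at least
     [1 / 2]. *)
  destruct (Kc (-1) (/ (2 * B))) as (d & Hd & HK); [apply Rinv_0_lt_compat; lra|].
  assert (Hdm : 0 < Rmin (d / 2) 1) by (apply Rmin_pos; lra).
  pose proof (Rmin_l (d / 2) 1). pose proof (Rmin_r (d / 2) 1).
  exists (Rmin (d / 2) 1). split; [lra|]. intros l y y1 Hl Hy Hy0 Hy1.
  assert (W := Bd l y y1 (fun _ => 0) (fun _ => 0) Hl (sol_wsol _ _ _ _ _ _ (dsol_sol _ _ _ _ Hy)) Hy0 Hy1 eq_refl eq_refl).
  pose proof (dsol_acd _ _ _ _ Hy) as Ya. destruct Hy as (Yd & Yc1 & Ya1).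
  assert (H1 : forall x, -1 < x <= -1 + Rmin (d / 2) 1 -> 1 / 2 <= y1 x).
  { intros x Hx. pose proof (acd_abs_le (-1) x _ _ _ _ ltac:(lra) ltac:(lra) ltac:(lra)
       (acd_sub (-1) 1 (-1) x _ _ (Rle_refl _) ltac:(lra) Ya1)
       (acd_sub (-1) 1 (-1) x _ _ (Rle_refl _) ltac:(lra) (acd_scal _ _ B _ _ Ka))) as D. cbv beta in D.
    assert (D' : Rabs (y1 x - y1 (-1)) <= B * K x - B * K (-1)).
    { apply D. apply ae_mp with (1 := ae_interior). intros z Hz _ _. destruct (W z) as [Wz _]; [easy|].
      rewrite Rabs_mult. pose proof (Rabs_pos (q z - l)). pose proof (Rabs_pos (y z)).
      pose proof (Rabs_triang (q z) (- l)) as Tr. rewrite Rabs_Ropp in Tr. unfold Rminus. fold (q z - l).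
      unfold Rminus in *. nra. }
    specialize (HK x). simpl in HK. unfold Rdist in HK.
    assert (HK' : Rabs (K x - K (-1)) < / (2 * B)).
    { apply HK. split; [split; [easy|lra]|]. rewrite Rabs_pos_eq; lra. }
    apply Rabs_def2 in HK'. apply Rabs_le_between in D'. rewrite Hy1 in D'.
    assert (B * (K x - K (-1)) <= B * / (2 * B)) by (apply Rmult_le_compat_l; lra).
    replace (B * / (2 * B)) with (1 / 2) in H1 by (field; lra). lra. }
  intros x Hx.
  pose proof (acd_le (-1) x _ _ _ _ ltac:(lra) ltac:(lra) ltac:(lra)
       (acd_scal _ _ (1 / 2) _ _ (acd_id (-1) x))
       (acd_sub (-1) 1 (-1) x _ _ (Rle_refl _) ltac:(lra) Ya)) as D. cbv beta in D.
  assert (D' : 1 / 2 * x - 1 / 2 * -1 <= y x - y (-1)).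
  { apply D. apply ae_all. intros z _ Hz. specialize (H1 z ltac:(lra)). lra. }
  lra.
Qed.

(** The minimum of [F l] over [[x1, 1]] is Lipschitz in [l], so the intermediate value theorem finds
    a parameter at which it is exactly 0. *)
Lemma first_touch (F : R -> R -> R) a b x1 C : a <= b -> x1 <= 1 -> 0 <= C ->
  (forall l, a <= l <= b -> continuity (F l)) ->
  (forall l m x, a <= l <= b -> a <= m <= b -> x1 <= x <= 1 -> Rabs (F l x - F m x) <= C * Rabs (l - m)) ->
  (forall x, x1 <= x <= 1 -> 0 < F a x) ->
  (exists x, x1 <= x <= 1 /\ F b x <= 0) ->
  exists l, a < l <= b /\ (forall x, x1 <= x <= 1 -> 0 <= F l x) /\ exists x, x1 <= x <= 1 /\ F l x = 0.
Proof.
  intros Hab Hx1 HC Hcont Hlip Hpos (xb & Hxb & Hb).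
  assert (Hmin : forall l, exists m, (forall x, x1 <= x <= 1 -> F (clamp a b l) m <= F (clamp a b l) x) /\ x1 <= m <= 1).
  { intros l. destruct (continuity_ab_min (F (clamp a b l)) x1 1 Hx1) as (m & H1 & H2).
    - intros c _. apply Hcont. now apply clamp_in.
    - now exists m. }
  set (m := fun l => proj1_sig (constructive_indefinite_description _ (Hmin l))).
  assert (Hm : forall l, (forall x, x1 <= x <= 1 -> F (clamp a b l) (m l) <= F (clamp a b l) x) /\ x1 <= m l <= 1).
  { intros l. exact (proj2_sig (constructive_indefinite_description _ (Hmin l))). }
  set (g := fun l => F (clamp a b l) (m l)).
  assert (Hg1 : forall l k, g l - g k <= C * Rabs (l - k)).
  { intros l k. destruct (Hm l) as [A1 A2]. destruct (Hm k) as [B1 B2]. specialize (A1 (m k) B2).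
    pose proof (Hlip (clamp a b l) (clamp a b k) (m k) (clamp_in a b l Hab) (clamp_in a b k Hab) B2) as L.
    pose proof (clamp_lip a b k l) as L2. apply Rabs_le_between in L. unfold g. nra. }
  assert (Hgc : continuity g).
  { intros l eps He. exists (eps / (C + 1)). split; [apply Rdiv_lt_0_compat; lra|].
    intros k [_ Hk]. simpl in *. unfold Rdist in *.
    assert (Hk' : (C + 1) * Rabs (k - l) < eps).
    { apply Rmult_lt_compat_l with (r := C + 1) in Hk; [|lra].
      replace ((C + 1) * (eps / (C + 1))) with eps in Hk by (field; lra). easy. }
    pose proof (Hg1 k l). pose proof (Hg1 l k) as H2. rewrite (Rabs_minus_sym l) in H2.
    pose proof (Rabs_pos (k - l)). apply Rabs_def1; nra. }
  assert (Ha : 0 < g a).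
  { unfold g. rewrite clamp_id by lra. apply Hpos. apply Hm. }
  assert (Hgb : g b <= 0).
  { destruct (Hm b) as [A1 _]. specialize (A1 xb Hxb). unfold g. rewrite clamp_id in A1 |- * by lra. lra. }
  destruct (IVT_cor g a b Hgc Hab) as (l & Hl & Hgl); [nra|].
  exists l. destruct (Hm l) as [A1 A2]. unfold g in Hgl. rewrite clamp_id in A1, Hgl by lra.
  split; [|split].
  - destruct (Req_dec l a) as [->|Hne]; [|lra]. unfold g in Ha. rewrite clamp_id in Ha by lra. lra.
  - intros x Hx. specialize (A1 x Hx). lra.
  - now exists (m l).
Qed.

Lemma interior_min_deriv f x l a b : a < x < b -> derivable_pt_lim f x l ->
  (forall y, a < y < b -> f x <= f y) -> l = 0.
Proof.
  intros Hx Hd Hm. set (pr := exist _ l Hd : derivable_pt f x).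
  pose proof (deriv_minimum f a b x pr (proj1 Hx) (proj2 Hx) ltac:(intros; apply Hm; lra)) as E.
  rewrite <- E. symmetry. now apply derive_pt_eq.
Qed.

Lemma pos_by_IVT f a x : a <= x -> continuity f -> 0 < f a -> (forall z, a <= z <= x -> f z <> 0) -> 0 < f x.
Proof.
  intros Hax Hc Ha Hz. apply Rnot_le_lt. intros Hle.
  destruct (IVT_cor f a x Hc Hax) as (z & Hzx & Hz0); [nra|]. now apply (Hz z).
Qed.

Lemma dsol_cont q l y y1 : dsol q l y y1 -> continuity y.
Proof. intros (H & _). exact (cont_dpl _ _ H). Qed.

Lemma dirichlet_eigenvalue q l y y1 : L1 q -> dsol q l y y1 -> y (-1) = 0 -> y1 (-1) = 1 -> y 1 = 0 ->
  is_eigenvalue q (fun _ => 1) l 0.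
Proof.
  intros Hq Hy H0 H1 H2. pose proof (dsol_sol _ _ _ _ Hy) as (A & B & C & D & E & F).
  apply sol_eigen with y y1 (fun _ => 0) (fun _ => 0); auto.
  - split; [easy|]. split; [easy|]. split; [easy|]. split; [easy|]. split.
    + eapply acd_eq_deriv'; [exact E|]. intros; cbv beta; ring.
    + eapply acd_eq_deriv'; [exact F|]. intros; cbv beta; ring.
  - destruct (sign_near y (-1) 1) as (d & Hd & K); auto; try lra.
    { rewrite <- H1. apply A. }
    set (t := Rmin 1 (-1 + d / 2)).
    assert (Ht : -1 < t) by (apply Rmin_glb_lt; lra).
    assert (Ht1 : t <= 1) by apply Rmin_l. assert (Ht2 : t <= -1 + d / 2) by apply Rmin_r.
    specialize (K t ltac:(rewrite Rabs_pos_eq; lra) ltac:(lra)).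
    exists t. split; [split; lra|]. left. intros Hz. rewrite Hz in K. lra.
Qed.

Lemma eigenvalue_dirichlet q l y y1 : L1 q -> dsol q l y y1 -> y (-1) = 0 -> y1 (-1) = 1 ->
  is_eigenvalue q (fun _ => 1) l 0 -> y 1 = 0.
Proof.
  intros Hq Hy H0 H1 He.
  destruct (eigen_sol _ _ _ _ Hq (L1_cont _ (cont_const 1)) He) as (u & u1 & v & v1 & Hs & B1 & B2 & B3 & B4 & x & Hx & Hnz).
  destruct (sol_dsol q _ _ l _ _ _ _ Hs) as [Du Dv]; [intros; ring | intros; ring|].
  assert (Hm : in_I (-1)) by (unfold in_I; lra).
  assert (W : forall f f1, dsol q l f f1 -> f (-1) = 0 -> f 1 = 0 -> f x <> 0 -> y 1 = 0).
  { intros f f1 Hf F0 F1 Fx.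
    assert (U := dsol_unique q l f f1 _ _ (-1) Hq Hm Hf (dsol_lin _ _ _ _ _ _ (f1 (-1)) 0 Hy (dsol_zero_dsol q l))).
    cbv beta in U. assert (U' := U ltac:(rewrite F0, H0; ring) ltac:(rewrite H1; ring)).
    destruct (U' 1) as [E1 _]; [unfold in_I; lra|]. destruct (U' x Hx) as [E2 _].
    rewrite F1 in E1. destruct (Rmult_integral (f1 (-1)) (y 1)) as [Z|Z]; [lra| |easy].
    exfalso. apply Fx. rewrite E2, Z. ring. }
  destruct Hnz as [Hn|Hn]; [now apply (W u u1) | now apply (W v v1)].
Qed.

Lemma no_double_zero q l y y1 x : L1 q -> dsol q l y y1 -> y1 (-1) = 1 -> in_I x -> y x = 0 -> y1 x <> 0.
Proof.
  intros Hq Hy H1 Hx H2 H3.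
  destruct (dsol_zero q l y y1 x Hq Hx Hy H2 H3 (-1)) as [_ E]; [unfold in_I; lra|]. lra.
Qed.

(* Two continuation arguments in the spectral parameter.  Lowering it far enough makes the
   Dirichlet solution [y] positive on (-1,1]; raising it, positivity can only be lost through a
   zero at 1, that is at an eigenvalue, so the eigenfunction [phi] of [l0] is positive.  From [l0]
   up to 0 the same argument applies to [int phi y], which is a Wronskian up to the factor [l - l0];
   its positivity at 0 says that [y / phi] decreases. *)
Lemma dirichlet_one_zero q : L1 q ->
  (exists l0, l0 < 0 /\ is_eigenvalue q (fun _ => 1) l0 0 /\
            forall a b, is_eigenvalue q (fun _ => 1) a b -> (a = l0 /\ b = 0) \/ (b = 0 /\ 0 < a)) ->
  exists y y1 c, dsol q 0 y y1 /\ y (-1) = 0 /\ y1 (-1) = 1 /\ -1 < c < 1 /\ y c = 0 /\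
    (forall x, -1 < x < c -> 0 < y x) /\ (forall x, c < x <= 1 -> y x < 0).
Proof.
  intros Hq (l0 & Hl0 & He0 & Hdef).
  assert (Hm : in_I (-1)) by (unfold in_I; lra).
  assert (Hex : forall l, exists p : (R -> R) * (R -> R), dsol q l (fst p) (snd p) /\ fst p (-1) = 0 /\ snd p (-1) = 1).
  { intros l. destruct (dsol_exists q l (-1) 0 1 Hq Hm) as (y & y1 & H). now exists (y, y1). }
  set (Y := fun l => fst (proj1_sig (constructive_indefinite_description _ (Hex l)))).
  set (Y1 := fun l => snd (proj1_sig (constructive_indefinite_description _ (Hex l)))).
  assert (HY : forall l, dsol q l (Y l) (Y1 l) /\ Y l (-1) = 0 /\ Y1 l (-1) = 1).
  { intros l. exact (proj2_sig (constructive_indefinite_description _ (Hex l))). }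
  clearbody Y Y1.
  assert (Yzero : forall l, l <= 0 -> Y l 1 = 0 -> l = l0).
  { intros l Hl Hz. destruct (HY l) as (A & B & C).
    destruct (Hdef l 0 (dirichlet_eigenvalue q l _ _ Hq A B C Hz)); lra. }
  assert (Y0 : Y l0 1 = 0).
  { destruct (HY l0) as (A & B & C). now apply eigenvalue_dirichlet with q l0 (Y1 l0). }
  destruct (dirichlet_nonvanishing q Hq) as (L & HL & Hnv).
  assert (Hnv' : forall x, -1 < x <= 1 -> Y (- L) x <> 0).
  { destruct (HY (- L)) as (A & B & C). apply (Hnv (- L) _ _ ltac:(lra) A B C). }
  assert (HLl0 : - L < l0).
  { apply Rnot_le_lt. intros Hc. destruct (HY l0) as (A & B & C).
    now apply (Hnv l0 _ _ Hc A B C 1 ltac:(lra)). }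
  destruct (dirichlet_pos_near q L Hq ltac:(lra)) as (d & Hd & Hnear).
  assert (Hnear' : forall l, - L <= l <= 0 -> forall x, -1 < x <= -1 + d -> 0 < Y l x).
  { intros l Hl. destruct (HY l) as (A & B & C). apply (Hnear l _ (Y1 l)); auto.
    apply Rabs_le; lra. }
  destruct (sol_family_lipschitz q (fun _ => -1) (fun _ => 0) (-1) L 0 1 0 0 Hq
    (L1_cont _ (cont_const _)) (L1_cont _ (cont_const _)) Hm ltac:(lra)) as (C & HC & Hlip0).
  assert (Hlip : forall l m x, - L <= l <= 0 -> - L <= m <= 0 -> in_I x -> Rabs (Y l x - Y m x) <= C * Rabs (l - m)).
  { intros l m x Hl Hm' Hx. destruct (HY l) as (A1 & A2 & A3). destruct (HY m) as (B1 & B2 & B3).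
    apply (Hlip0 l m _ _ _ _ _ _ _ _ ltac:(apply Rabs_le; lra) ltac:(apply Rabs_le; lra)
      (sol_wsol _ _ _ _ _ _ (dsol_sol _ _ _ _ A1)) (sol_wsol _ _ _ _ _ _ (dsol_sol _ _ _ _ B1))
      A2 A3 eq_refl eq_refl B2 B3 eq_refl eq_refl x Hx). }
  assert (Ycont : forall l, continuity (Y l)) by (intros l; apply (dsol_cont q l _ (Y1 l)), HY).
  assert (Hphi : forall x, -1 < x < 1 -> 0 < Y l0 x).
  { destruct (first_touch Y (- L) l0 (-1 + d) C) as (l & Hl & Hge & x & Hx & Hxz); try lra.
    - auto.
    - intros l m x Hl Hm' Hx. apply Hlip; unfold in_I; lra.
    - intros x Hx. apply pos_by_IVT with (-1 + d); auto; try lra.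
      + apply Hnear'; lra.
      + intros z Hz. apply Hnv'. lra.
    - exists 1. rewrite Y0. lra.
    - destruct (HY l) as (A1 & A2 & A3).
      assert (Hpos : forall z, -1 < z < 1 -> 0 <= Y l z).
      { intros z Hz. destruct (Rle_dec z (-1 + d)); [left; apply Hnear' | apply Hge]; lra. }
      assert (Hpos' : forall z, -1 < z < 1 -> 0 < Y l z).
      { intros z Hz. destruct (Hpos z Hz) as [Hlt|Hz0]; [easy|]. exfalso.
        apply (no_double_zero q l (Y l) (Y1 l) z Hq A1 A3); [unfold in_I; lra | easy|].
        apply (interior_min_deriv (Y l) z (Y1 l z) (-1) 1 Hz).
        - apply A1.
        - rewrite <- Hz0. auto. }
      assert (l = l0); [|now subst l].
      apply Yzero; [lra|]. destruct (Rlt_dec x 1).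
      + specialize (Hpos' x ltac:(lra)). lra.
      + replace 1 with x by lra. easy. }
  destruct (HY l0) as (P1 & P2 & P3).
  set (phi := Y l0) in *. set (phi1 := Y1 l0) in *.
  assert (Hphi1 : phi1 1 < 0).
  { apply Rnot_le_lt. intros Hle.
    assert (Hne : phi1 1 <> 0) by (apply (no_double_zero q l0 phi phi1 1 Hq P1 P3); [unfold in_I; lra | easy]).
    destruct (sign_near phi 1 (phi1 1)) as (e & He & K); auto; [apply P1|].
    set (t := Rmax 0 (1 - e / 2)).
    assert (Ht : t < 1) by (apply Rmax_lub_lt; lra).
    assert (Ht1 : 0 <= t) by apply Rmax_l. assert (Ht2 : 1 - e / 2 <= t) by apply Rmax_r.
    specialize (K t ltac:(rewrite Rabs_minus_sym, Rabs_pos_eq; lra) ltac:(lra)).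
    specialize (Hphi t ltac:(lra)).
    assert (0 < phi1 1 * (1 - t)) by (apply Rmult_lt_0_compat; lra). nra. }
  set (U := fun l => prim0 (fun x => phi x * Y l x)).
  assert (Uc : forall l, continuity (fun x => phi x * Y l x)).
  { intros l. apply cont_mult; [apply (Ycont l0) | apply Ycont]. }
  assert (Ud : forall l x, derivable_pt_lim (U l) x (phi x * Y l x)) by (intros l x; exact (prim0_derive _ (Uc l) x)).
  assert (Ua : forall l s t, s <= t -> acd s t (U l) (fun x => phi x * Y l x)) by (intros l s t Hst; exact (prim0_acd _ s t Hst (Uc l))).
  assert (U0 : forall l, U l (-1) = 0) by (intros l; exact (prim0_start _)).
  assert (Upos : forall l x, -1 < x <= 1 -> (forall z, -1 < z < x -> 0 < Y l z) -> 0 < U l x).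
  { intros l x Hx Hz.
    destruct (MVT_cor2 (U l) (fun x => phi x * Y l x) (-1) x ltac:(lra) ltac:(auto)) as (t & Et & Ht).
    rewrite U0, Rminus_0_r in Et. rewrite Et. apply Rmult_lt_0_compat; [|lra].
    apply Rmult_lt_0_compat; [apply Hphi; lra | apply Hz; lra]. }
  assert (Wr : forall l x, in_I x -> phi1 x * Y l x - phi x * Y1 l x = (l - l0) * U l x).
  { intros l x Hx. unfold in_I in Hx. destruct (HY l) as (A1 & A2 & A3).
    pose proof (acd_same (-1) x _ _ _ _ ltac:(lra) ltac:(lra) ltac:(lra)
      (acd_sub (-1) 1 (-1) x _ _ ltac:(lra) ltac:(lra) (dsol_wronskian q l0 l _ _ _ _ P1 A1))
      (acd_scal _ _ (l - l0) _ _ (Ua l (-1) x ltac:(lra)))) as E. cbv beta in E.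
    rewrite A2, P2, U0 in E. assert (E' := E ltac:(apply ae_all; intros; reflexivity)). lra. }
  destruct (cont_bounded phi (Ycont l0)) as (B & HB & HBphi).
  assert (HU : forall x, -1 < x <= 1 -> 0 < U 0 x).
  { apply NNPP. intros Hn.
    (* In the Lipschitz constant, 2 is the length of the interval, [B] bounds [phi], and [C] is the
       constant of [Y]. *)
    destruct (first_touch U l0 0 (-1 + d) (2 * B * C)) as (l & Hl & Hge & x & Hx & Hxz); try lra.
    - nra.
    - intros l _. exact (cont_dpl _ _ (Ud l)).
    - intros l m x Hl Hm' Hx.
      pose proof (acd_abs_le (-1) x _ _ _ _ ltac:(lra) ltac:(lra) ltac:(lra)
        (acd_minus _ _ _ _ _ _ (Ua l (-1) x ltac:(lra)) (Ua m (-1) x ltac:(lra)))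
        (acd_scal _ _ (B * (C * Rabs (l - m))) _ _ (acd_id (-1) x))) as E. cbv beta in E.
      rewrite !U0 in E. rewrite !Rminus_0_r in E.
      apply Rle_trans with (B * (C * Rabs (l - m)) * x - B * (C * Rabs (l - m)) * -1).
      + apply E. apply ae_all. intros z Hz _.
        rewrite <- Rmult_minus_distr_l, Rabs_mult, Rmult_1_r.
        apply Rmult_le_compat; auto using Rabs_pos. apply Hlip; auto; lra.
      + assert (0 <= B * (C * Rabs (l - m))).
        { pose proof (Rabs_pos (l - m)). apply Rmult_le_pos; [lra|]. apply Rmult_le_pos; lra. }
        nra.
    - intros x Hx. apply Upos; [lra|]. intros z Hz. apply Hphi. lra.
    - apply NNPP. intros Hn2. apply Hn. intros x Hx. apply Rnot_le_lt. intros Hle.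
      destruct (Rle_dec x (-1 + d)) as [Hc|Hc].
      + specialize (Upos 0 x Hx). assert (0 < U 0 x); [|lra]. apply Upos. intros z Hz. apply Hnear'; lra.
      + apply Hn2. exists x. split; [lra | easy].
    (* A touch inside gives [U' = phi Y = 0], so [Y] vanishes there, and by the Wronskian identity
       [Y1] does too. A touch at 1, where [phi] vanishes, would make [l] a second nonpositive
       eigenvalue. *)
    - destruct (HY l) as (A1 & A2 & A3).
      pose proof (Wr l x ltac:(unfold in_I; lra)) as V. rewrite Hxz, Rmult_0_r in V.
      destruct (Rlt_dec x 1) as [Hc|Hc].
      + assert (Hne : x <> -1 + d).
        { intros Heq. specialize (Upos l x ltac:(lra)). assert (0 < U l x); [|lra]. apply Upos.
          intros z Hz. apply Hnear'; lra. }
        assert (E : phi x * Y l x = 0).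
        { apply (interior_min_deriv (U l) x _ (-1 + d) 1); [lra|apply Ud|].
          intros y Hy. rewrite Hxz. apply Hge. lra. }
        specialize (Hphi x ltac:(lra)).
        assert (Ez : Y l x = 0) by nra. rewrite Ez in V.
        apply (no_double_zero q l (Y l) (Y1 l) x Hq A1 A3); [unfold in_I; lra | easy | nra].
      + replace x with 1 in V by lra. fold phi in Y0. rewrite Y0 in V.
        assert (Ez : Y l 1 = 0) by nra. specialize (Yzero l ltac:(lra) Ez). lra. }
  destruct (HY 0) as (A1 & A2 & A3).
  set (y := Y 0) in *. set (y1 := Y1 0) in *.
  assert (V : forall x, -1 < x <= 1 -> 0 < phi1 x * y x - phi x * y1 x).
  { intros x Hx. unfold y, y1. rewrite Wr by (unfold in_I; lra). specialize (HU x Hx). nra. }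
  assert (Hy1 : y 1 < 0).
  { specialize (V 1 ltac:(lra)). fold phi in Y0. rewrite Y0 in V. nra. }
  assert (Hyd : 0 < y (-1 + d)) by (apply Hnear'; lra).
  destruct (IVT_cor y (-1 + d) 1 (Ycont 0) ltac:(lra)) as (c & Hc & Hyc); [nra|].
  assert (Hc1 : c <> 1) by (intros ->; lra).
  assert (Hq' : forall s t, -1 < s -> s < t -> t < 1 -> y t / phi t < y s / phi s).
  { intros s t Hs Hst Ht.
    destruct (MVT_cor2 (fun x => y x / phi x) (fun x => (y1 x * phi x - phi1 x * y x) / Rsqr (phi x)) s t Hst) as (z & Ez & Hz).
    - intros x Hx. apply (derivable_pt_lim_div y phi x (y1 x) (phi1 x)); [apply A1 | apply P1|].
      specialize (Hphi x ltac:(lra)). lra.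
    - assert ((y1 z * phi z - phi1 z * y z) / Rsqr (phi z) < 0).
      { specialize (Hphi z ltac:(lra)). specialize (V z ltac:(lra)).
        assert (0 < Rsqr (phi z)) by (apply Rsqr_pos_lt; lra).
        apply Rmult_lt_reg_r with (Rsqr (phi z)); [easy|].
        unfold Rdiv. rewrite Rmult_assoc, Rinv_l by lra. lra. }
      nra. }
  exists y, y1, c. split; [easy|]. split; [easy|]. split; [easy|]. split; [lra|]. split; [easy|]. split.
  - intros x Hx. specialize (Hq' x c ltac:(lra) ltac:(lra) ltac:(lra)). rewrite Hyc in Hq'.
    specialize (Hphi x ltac:(lra)). unfold Rdiv in Hq'. rewrite Rmult_0_l in Hq'.
    assert (0 < / phi x) by now apply Rinv_0_lt_compat. nra.
  - intros x Hx. destruct (Req_dec x 1) as [->|Hne]; [easy|].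
    specialize (Hq' c x ltac:(lra) ltac:(lra) ltac:(lra)). rewrite Hyc in Hq'.
    specialize (Hphi x ltac:(lra)). unfold Rdiv in Hq'. rewrite Rmult_0_l in Hq'.
    assert (0 < / phi x) by now apply Rinv_0_lt_compat. nra.
Qed.

(** * Jacobi's factorisation and non-real eigenvalues *)

Lemma acd_inv a b F f : a <= b -> continuity F -> acd a b F f -> (forall x, a <= x <= b -> F x <> 0) ->
  acd a b (fun x => / F x) (fun x => - f x / F x ^ 2).
Proof.
  intros Hab Hc [HA HD] Hnz.
  assert (Hca : continuity (fun x => Rabs (F x))) by cont.
  destruct (continuity_ab_min (fun x => Rabs (F x)) a b Hab) as (m & Hm & Hmx); [intros; apply Hca|].
  assert (Hp : 0 < Rabs (F m)) by (apply Rabs_pos_lt, Hnz, Hmx).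
  split.
  - apply ac_dom with (G1 := F) (G2 := F) (C := / (Rabs (F m) * Rabs (F m))); auto.
    intros x y Hx Hxy Hy.
    assert (Fx := Hnz x ltac:(lra)). assert (Fy := Hnz y ltac:(lra)).
    replace (/ F y - / F x) with ((F x - F y) * / (F x * F y)) by (field; easy).
    rewrite Rabs_mult, Rabs_inv, Rabs_mult, (Rabs_minus_sym (F x)).
    assert (/ (Rabs (F x) * Rabs (F y)) <= / (Rabs (F m) * Rabs (F m))).
    { apply Rinv_le_contravar; [nra|]. pose proof (Hm x ltac:(lra)). pose proof (Hm y ltac:(lra)). nra. }
    assert (0 < / (Rabs (F m) * Rabs (F m))) by (apply Rinv_0_lt_compat; nra).
    pose proof (Rabs_pos (F y - F x)). nra.
  - apply ae_mp with (1 := HD). intros x _ H Hx. assert (Fx := Hnz x ltac:(lra)).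
    assert (D : derivable_pt_lim (fun y => 1 / F y) x ((0 * F x - f x * 1) / Rsqr (F x))).
    { apply (derivable_pt_lim_div (fun _ => 1) F x 0 (f x)); auto. apply dpl_const. }
    apply dpl_eq with ((0 * F x - f x * 1) / Rsqr (F x)); [|unfold Rsqr; field; easy].
    intros eps He. destruct (D eps He) as [d Hd]. exists d. intros h Hh Hhd.
    specialize (Hd h Hh Hhd). unfold Rdiv in Hd. rewrite !Rmult_1_l in Hd. exact Hd.
Qed.

Lemma C1_lipschitz U U1 : (forall x, derivable_pt_lim U x (U1 x)) -> continuity U1 ->
  exists M, 0 < M /\ forall x y, in_I x -> in_I y -> Rabs (U y - U x) <= M * Rabs (y - x).
Proof.
  intros Hd Hc. destruct (cont_bounded U1 Hc) as (M & HM & Hb). exists M. split; [easy|].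
  assert (W : forall x y, in_I x -> in_I y -> x <= y -> Rabs (U y - U x) <= M * Rabs (y - x)).
  { intros x y Hx Hy Hxy. rewrite (Rabs_pos_eq (y - x)) by lra. apply deriv_incr_bound with U1; auto.
    intros z Hz. apply Hb. unfold in_I in *. lra. }
  intros x y Hx Hy. destruct (Rle_dec x y); [auto|].
  rewrite (Rabs_minus_sym (U y)), (Rabs_minus_sym y). apply W; auto. lra.
Qed.

(** The bound also covers points where [f] does not vanish, because in [jacobi] an end of the
    interval, such as 1, need not be a zero of [y]. *)
Lemma simple_zero_lower f x l : derivable_pt_lim f x l -> (f x = 0 -> l <> 0) -> continuity f ->
  exists m d, 0 < m /\ 0 < d /\ forall y, Rabs (y - x) < d -> m * Rabs (y - x) <= Rabs (f y).
Proof.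
  intros Hf Hl Hc. destruct (Req_dec (f x) 0) as [H0|H0].
  - specialize (Hl H0). apply Rabs_pos_lt in Hl.
    destruct (dpl_bound f x l (Rabs l / 2) Hf) as (d & Hd & K); [lra|].
    exists (Rabs l / 2), d. split; [lra|]. split; [easy|]. intros y Hy. specialize (K y Hy).
    rewrite H0, Rminus_0_r in K.
    pose proof (Rabs_triang_inv (l * (y - x)) (l * (y - x) - f y)) as T.
    replace (l * (y - x) - (l * (y - x) - f y)) with (f y) in T by ring.
    rewrite (Rabs_minus_sym _ (f y)), Rabs_mult in T. lra.
  - apply Rabs_pos_lt in H0. destruct (Hc x (Rabs (f x) / 2)) as (d & Hd & K); [lra|].
    exists (Rabs (f x) / 2), (Rmin d 1). split; [lra|]. split; [apply Rmin_pos; lra|].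
    intros y Hy. pose proof (Rmin_l d 1). pose proof (Rmin_r d 1).
    assert (Rabs (f x) / 2 <= Rabs (f y)); [|pose proof (Rabs_pos (y - x)); nra].
    destruct (Req_dec x y) as [->|Hne]; [lra|].
    assert (K' : Rabs (f y - f x) < Rabs (f x) / 2).
    { apply (K y). split; [now split|]. simpl. unfold Rdist. lra. }
    pose proof (Rabs_triang_inv (f x) (f x - f y)) as T.
    replace (f x - (f x - f y)) with (f y) in T by ring. rewrite (Rabs_minus_sym (f x) (f y)) in T. lra.
Qed.

(* Jacobi: [(U U' - U^2 y'/y)' = (U' - U y'/y)^2 - U rho], and the boundary terms vanish because
   [U] does and the zeros of [y] are simple. *)
Lemma jacobi q y y1 U U1 rho R0 A B : dsol q 0 y y1 -> (forall x, in_I x -> y x = 0 -> y1 x <> 0) ->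
  (forall x, derivable_pt_lim U x (U1 x)) -> continuity U1 ->
  acd (-1) 1 U1 (fun x => q x * U x - rho x) -> acd (-1) 1 R0 (fun x => U x * rho x) ->
  -1 <= A -> A < B -> B <= 1 -> U A = 0 -> U B = 0 -> (forall x, A < x < B -> y x <> 0) ->
  R0 A <= R0 B /\ (R0 A = R0 B -> exists k, forall x, A < x < B -> U x = k * y x).
Proof.
  intros Hy Hsz Hd Hc1 HU1 HR HA HAB HB UA UB Hnz.
  pose proof (dsol_cont _ _ _ _ Hy) as yc. pose proof (dsol_acd _ _ _ _ Hy) as ya.
  destruct Hy as (yd & y1c & y1a). pose proof (cont_dpl _ _ Hd) as Uc.
  assert (Ua : acd (-1) 1 U U1) by (apply acd_C1; auto; lra).
  set (Z := fun x => U x * U1 x - U x * U x * (y1 x * / y x) + R0 x).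
  assert (Za : forall s t, A < s -> s <= t -> t < B -> acd s t Z (fun x => (U1 x - U x * y1 x * / y x) ^ 2)).
  { intros s t Hs Hst Ht.
    assert (sub : forall F f, acd (-1) 1 F f -> acd s t F f) by (intros F f HF; apply acd_sub with (-1) 1; auto; lra).
    pose proof (acd_inv s t y y1 Hst yc (sub _ _ ya) ltac:(intros; apply Hnz; lra)) as Hi.
    pose proof (acd_mult _ _ _ _ _ _ Hst (sub _ _ y1a) Hi) as H1.
    pose proof (acd_mult _ _ _ _ _ _ Hst (acd_mult _ _ _ _ _ _ Hst (sub _ _ Ua) (sub _ _ Ua)) H1) as H2.
    pose proof (acd_mult _ _ _ _ _ _ Hst (sub _ _ Ua) (sub _ _ HU1)) as H3.
    pose proof (acd_plus _ _ _ _ _ _ (acd_minus _ _ _ _ _ _ H3 H2) (sub _ _ HR)) as H4.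
    apply acd_eq_deriv with (1 := H4). apply ae_all. intros x _ Hx. cbv beta.
    field. apply Hnz. lra. }
  assert (Zm : forall s t, A < s -> s <= t -> t < B -> Z s <= Z t).
  { intros s t Hs Hst Ht. apply (acd_nonneg s t Z _ ltac:(lra) Hst ltac:(lra) (Za s t Hs Hst Ht)).
    apply ae_all. intros. apply pow2_ge_0. }
  (* [U] is at most of order [|x - e|] and [1 / y] at most of order [1 / |x - e|], so [U ^ 2 y' / y]
     tends to 0 at either end. *)
  assert (lim : forall e, in_I e -> U e = 0 -> forall eps, 0 < eps -> exists d, 0 < d /\
    forall x, A < x < B -> Rabs (x - e) < d -> Rabs (Z x - R0 e) < eps).
  { intros e He Ue eps Heps.
    destruct (C1_lipschitz U U1 Hd Hc1) as (M & HM & HML).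
    destruct (cont_bounded U1 Hc1) as (M1 & HM1 & Hb1).
    destruct (cont_bounded y1 y1c) as (M2 & HM2 & Hb2).
    destruct (simple_zero_lower y e (y1 e) (yd e) (Hsz e He) yc) as (m & d1 & Hm & Hd1 & Hlow).
    destruct (ac_unif (-1) 1 R0 (proj1 HR) (eps / 2)) as (d2 & Hd2 & HR2); [lra|].
    set (C := M * M1 + M * M * M2 / m).
    assert (HC : 0 < C).
    { unfold C. apply Rplus_lt_0_compat; [nra|]. apply Rdiv_lt_0_compat; [|easy].
      apply Rmult_lt_0_compat; nra. }
    exists (Rmin d1 (Rmin d2 (eps / (2 * C)))).
    assert (Hq : 0 < eps / (2 * C)) by (apply Rdiv_lt_0_compat; lra).
    split; [repeat apply Rmin_pos; lra|]. intros x Hx Hxe.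
    pose proof (Rmin_l d1 (Rmin d2 (eps / (2 * C)))). pose proof (Rmin_r d1 (Rmin d2 (eps / (2 * C)))).
    pose proof (Rmin_l d2 (eps / (2 * C))). pose proof (Rmin_r d2 (eps / (2 * C))).
    assert (Hxi : in_I x) by (unfold in_I; lra).
    assert (E1 : Rabs (U x) <= M * Rabs (x - e)).
    { pose proof (HML e x He Hxi) as E. now rewrite Ue, Rminus_0_r in E. }
    specialize (Hlow x ltac:(lra)). specialize (Hb1 x Hxi). specialize (Hb2 x Hxi).
    specialize (HR2 e x He Hxi ltac:(lra)).
    assert (Hy0 : 0 < Rabs (y x)) by (apply Rabs_pos_lt, Hnz, Hx).
    set (t := Rabs (x - e)) in *. assert (Ht : 0 <= t) by apply Rabs_pos.
    assert (E2 : Rabs (U x * U1 x) <= M * M1 * t).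
    { rewrite Rabs_mult. pose proof (Rabs_pos (U x)). pose proof (Rabs_pos (U1 x)). nra. }
    assert (E3 : Rabs (U x * U x * (y1 x * / y x)) <= M * M * M2 / m * t).
    { rewrite !Rabs_mult, Rabs_inv. apply Rmult_le_reg_r with (m * Rabs (y x)); [nra|].
      replace (Rabs (U x) * Rabs (U x) * (Rabs (y1 x) * / Rabs (y x)) * (m * Rabs (y x))) with
        (m * (Rabs (U x) * Rabs (U x)) * Rabs (y1 x)) by (field; lra).
      replace (M * M * M2 / m * t * (m * Rabs (y x))) with (M * M * t * Rabs (y x) * M2) by (field; lra).
      apply Rmult_le_compat; auto using Rabs_pos.
      - pose proof (Rabs_pos (U x)). nra.
      - apply Rle_trans with (M * M * t * (m * t)).
        + pose proof (Rabs_pos (U x)).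
          assert (Rabs (U x) * Rabs (U x) <= (M * t) * (M * t)) by nra. nra.
        + apply Rmult_le_compat_l; [|easy]. apply Rmult_le_pos; nra. }
    assert (E4 : C * t < eps / 2).
    { apply Rlt_le_trans with (C * (eps / (2 * C))); [apply Rmult_lt_compat_l; lra|]. right. field. lra. }
    unfold C in E4. rewrite Rmult_plus_distr_r in E4.
    apply Rabs_le_between in E2. apply Rabs_le_between in E3. apply Rabs_def2 in HR2.
    unfold Z. apply Rabs_def1; lra. }
  assert (LA : forall t, A < t < B -> R0 A <= Z t).
  { intros t Ht. apply Rnot_lt_le. intros Hlt.
    destruct (lim A ltac:(unfold in_I; lra) UA (R0 A - Z t)) as (d & Hd0 & K); [lra|].
    set (s := Rmin t (A + d / 2)).
    assert (A < s) by (apply Rmin_glb_lt; lra).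
    assert (s <= t) by apply Rmin_l. assert (s <= A + d / 2) by apply Rmin_r.
    specialize (K s ltac:(lra) ltac:(rewrite Rabs_pos_eq; lra)).
    specialize (Zm s t ltac:(lra) ltac:(lra) ltac:(lra)). apply Rabs_def2 in K. lra. }
  assert (LB : forall t, A < t < B -> Z t <= R0 B).
  { intros t Ht. apply Rnot_lt_le. intros Hlt.
    destruct (lim B ltac:(unfold in_I; lra) UB (Z t - R0 B)) as (d & Hd0 & K); [lra|].
    set (s := Rmax t (B - d / 2)).
    assert (s < B) by (apply Rmax_lub_lt; lra).
    assert (t <= s) by apply Rmax_l. assert (B - d / 2 <= s) by apply Rmax_r.
    specialize (K s ltac:(lra) ltac:(rewrite Rabs_minus_sym, Rabs_pos_eq; lra)).
    specialize (Zm t s ltac:(lra) ltac:(lra) ltac:(lra)). apply Rabs_def2 in K. lra. }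
  split.
  - apply Rle_trans with (Z ((A + B) / 2)); [apply LA | apply LB]; lra.
  - intros Heq.
    (* In the equality case [Z] is constant, so the square that is its derivative vanishes, and with
       it [(U / y)']. *)
    assert (Zc : forall t, A < t < B -> Z t = R0 A).
    { intros t Ht. specialize (LA t Ht). specialize (LB t Ht). lra. }
    assert (W : forall s t, A < s -> s < t -> t < B -> U t * / y t = U s * / y s).
    { intros s t Hs Hst Ht.
      assert (Hz : ae (fun x => s < x < t -> U1 x - U x * y1 x * / y x = 0)).
      { destruct (Za s t Hs ltac:(lra) Ht) as [_ HD]. apply ae_mp with (1 := HD).
        intros x _ Hx Hxs. specialize (Hx Hxs). apply Rsqr_0_uniq. rewrite Rsqr_pow2.
        apply (uniqueness_limite Z x _ _ Hx).
        apply dpl_on_interval with (fun _ => R0 A) s t; auto.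
        - intros z Hz. apply Zc. lra.
        - apply dpl_const. }
      assert (sub : forall F f, acd (-1) 1 F f -> acd s t F f) by (intros F f HF; apply acd_sub with (-1) 1; auto; lra).
      pose proof (acd_inv s t y y1 ltac:(lra) yc (sub _ _ ya) ltac:(intros; apply Hnz; lra)) as Hi.
      pose proof (acd_mult s t _ _ _ _ ltac:(lra) (sub _ _ Ua) Hi) as Hq.
      apply (acd_zero s t _ _ ltac:(lra) ltac:(lra) ltac:(lra) Hq).
      apply ae_mp with (1 := Hz). intros x _ Hx Hxs. specialize (Hx Hxs).
      replace (U1 x * / y x + U x * (- y1 x / y x ^ 2)) with ((U1 x - U x * y1 x * / y x) * / y x)
        by (field; apply Hnz; lra).
      rewrite Hx. ring. }
    exists (U ((A + B) / 2) * / y ((A + B) / 2)). intros x Hx.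
    assert (E : U x * / y x = U ((A + B) / 2) * / y ((A + B) / 2)).
    { destruct (Rtotal_order x ((A + B) / 2)) as [Hl | [-> | Hl]].
      - symmetry. apply W; lra.
      - easy.
      - apply W; lra. }
    rewrite <- E. field. now apply Hnz.
Qed.

Lemma zero_on_interval_deriv U U1 a b : a < b -> -1 <= a -> b <= 1 -> (forall x, derivable_pt_lim U x (U1 x)) ->
  continuity U1 -> (forall x, a < x < b -> U x = 0) -> forall x, a <= x <= b -> U x = 0 /\ U1 x = 0.
Proof.
  intros Hab Ha Hb Hd Hc Hz x Hx. split.
  - apply (ae_zero_cont U a b Ha Hab Hb); auto; [exact (cont_dpl _ _ Hd)|]. apply ae_all. auto.
  - apply (ae_zero_cont U1 a b Ha Hab Hb); auto. apply ae_all. intros z _ Hz'.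
    apply (uniqueness_limite U z); [apply Hd|].
    apply dpl_on_interval with (fun _ => 0) a b; auto. apply dpl_const.
Qed.

(** In the equality case [U] is [k y] to the left of [c] and [m y] to the right. At 1, where [y] is
    negative, [U] vanishes, so [m = 0]; continuity of [U1] then gives [k * y1 c = 0], and the zero
    of [y] at [c] is simple. *)
Lemma jacobi_strict q y y1 c U U1 rho R0 : L1 q -> dsol q 0 y y1 -> y1 (-1) = 1 -> -1 < c < 1 -> y c = 0 ->
  (forall x, -1 < x < c -> 0 < y x) -> (forall x, c < x <= 1 -> y x < 0) ->
  (forall x, derivable_pt_lim U x (U1 x)) -> continuity U1 ->
  acd (-1) 1 U1 (fun x => q x * U x - rho x) -> acd (-1) 1 R0 (fun x => U x * rho x) ->
  U (-1) = 0 -> U c = 0 -> U 1 = 0 ->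
  R0 (-1) <= R0 1 /\ (R0 (-1) = R0 1 -> forall x, in_I x -> U x = 0 /\ U1 x = 0).
Proof.
  intros Hq Hy Hy1 Hc Hyc Hpos Hneg Hd Hc1 HU1 HR E1 E2 E3.
  assert (Hsz : forall x, in_I x -> y x = 0 -> y1 x <> 0) by (intros x Hx; apply (no_double_zero q 0 y y1 x Hq Hy Hy1 Hx)).
  destruct (jacobi q y y1 U U1 rho R0 (-1) c Hy Hsz Hd Hc1 HU1 HR) as [J1 J2]; try lra.
  { intros x Hx. specialize (Hpos x Hx). lra. }
  destruct (jacobi q y y1 U U1 rho R0 c 1 Hy Hsz Hd Hc1 HU1 HR) as [K1 K2]; try lra.
  { intros x Hx. specialize (Hneg x ltac:(lra)). lra. }
  split; [lra|]. intros Heq.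
  destruct (J2 ltac:(lra)) as [k Hk]. destruct (K2 ltac:(lra)) as [m Hm].
  destruct Hy as (yd & y1c & _).
  assert (Hdm : forall r x, derivable_pt_lim (fun z => U z - r * y z) x (U1 x - r * y1 x)).
  { intros r x. eapply dpl_minus; [apply Hd | eapply dpl_scal; [apply yd|reflexivity] | reflexivity]. }
  assert (Hcm : forall r, continuity (fun x => U1 x - r * y1 x)) by (intros; cont).
  assert (M0 : m = 0).
  { destruct (zero_on_interval_deriv _ _ c 1 ltac:(lra) ltac:(lra) ltac:(lra) (Hdm m) (Hcm m)
      ltac:(intros x Hx; cbv beta; rewrite (Hm x Hx); ring) 1 ltac:(lra)) as [Z _].
    rewrite E3 in Z. specialize (Hneg 1 ltac:(lra)). nra. }
  assert (Zr : forall x, c <= x <= 1 -> U x = 0 /\ U1 x = 0).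
  { apply (zero_on_interval_deriv U U1 c 1); auto; try lra.
    intros x Hx. rewrite (Hm x Hx), M0. ring. }
  assert (K0 : k = 0).
  { destruct (zero_on_interval_deriv _ _ (-1) c ltac:(lra) ltac:(lra) ltac:(lra) (Hdm k) (Hcm k)
      ltac:(intros x Hx; cbv beta; rewrite (Hk x Hx); ring) c ltac:(lra)) as [_ Z].
    rewrite (proj2 (Zr c ltac:(lra))) in Z. pose proof (Hsz c ltac:(unfold in_I; lra) Hyc).
    destruct (Rmult_integral k (y1 c)); [lra|easy|easy]. }
  intros x Hx. destruct (Rle_dec c x); [apply Zr; unfold in_I in Hx; lra|].
  apply (zero_on_interval_deriv U U1 (-1) c); auto; try lra.
  - intros z Hz. rewrite (Hk z Hz), K0. ring.
  - unfold in_I in Hx. lra.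
Qed.

(** [X + i Y] is a primitive of [w (u + i v) conj (s + i t)]. Green's identity multiplies its
    increment by [lam - conj mu], where [lam = a + i b] and [mu = a' + i b'], and the condition on
    the parameters says that this factor is nonzero. An eigenfunction paired with itself is covered
    when [b <> 0]. *)
Lemma eigen_orthogonal q w a b a' b' u u1 v v1 s s1 t t1 X Y :
  sol (fun x => q x - a * w x) (fun x => b * w x) u u1 v v1 ->
  sol (fun x => q x - a' * w x) (fun x => b' * w x) s s1 t t1 ->
  u (-1) = 0 -> u 1 = 0 -> v (-1) = 0 -> v 1 = 0 ->
  s (-1) = 0 -> s 1 = 0 -> t (-1) = 0 -> t 1 = 0 ->
  a <> a' \/ b <> - b' ->
  acd (-1) 1 X (fun x => w x * (u x * s x + v x * t x)) ->
  acd (-1) 1 Y (fun x => w x * (v x * s x - u x * t x)) ->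
  X (-1) = X 1 /\ Y (-1) = Y 1.
Proof.
  intros H1 H2 A1 A2 A3 A4 B1 B2 B3 B4 Hne HX HY.
  destruct (sol_wsol _ _ _ _ _ _ H1) as (C1 & C2 & C3 & C4).
  destruct (sol_wsol _ _ _ _ _ _ H2) as (D1 & D2 & D3 & D4).
  assert (h : -1 <= 1) by lra.
  pose proof (acd_minus _ _ _ _ _ _
    (acd_plus _ _ _ _ _ _ (acd_mult _ _ _ _ _ _ h C3 D1) (acd_mult _ _ _ _ _ _ h C4 D2))
    (acd_plus _ _ _ _ _ _ (acd_mult _ _ _ _ _ _ h C1 D3) (acd_mult _ _ _ _ _ _ h C2 D4))) as Q1.
  pose proof (acd_minus _ _ _ _ _ _
    (acd_minus _ _ _ _ _ _ (acd_mult _ _ _ _ _ _ h C4 D1) (acd_mult _ _ _ _ _ _ h C3 D2))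
    (acd_minus _ _ _ _ _ _ (acd_mult _ _ _ _ _ _ h C2 D3) (acd_mult _ _ _ _ _ _ h C1 D4))) as Q2.
  pose proof (acd_plus _ _ _ _ _ _ (acd_scal _ _ (- (a - a')) _ _ HX) (acd_scal _ _ (b + b') _ _ HY)) as P1.
  pose proof (acd_plus _ _ _ _ _ _ (acd_scal _ _ (- (a - a')) _ _ HY) (acd_scal _ _ (- (b + b')) _ _ HX)) as P2.
  pose proof (acd_same (-1) 1 _ _ _ _ ltac:(lra) h ltac:(lra) Q1 P1 ltac:(apply ae_all; intros; ring)) as E1.
  pose proof (acd_same (-1) 1 _ _ _ _ ltac:(lra) h ltac:(lra) Q2 P2 ltac:(apply ae_all; intros; ring)) as E2.
  cbv beta in E1, E2. rewrite A1, A2, A3, A4, B1, B2, B3, B4 in E1, E2.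
  set (dX := X 1 - X (-1)). set (dY := Y 1 - Y (-1)).
  assert (F1 : (a - a') * dX - (b + b') * dY = 0) by (unfold dX, dY; lra).
  assert (F2 : (a - a') * dY + (b + b') * dX = 0) by (unfold dX, dY; lra).
  assert (Hsq : 0 < (a - a') ^ 2 + (b + b') ^ 2).
  { pose proof (pow2_ge_0 (a - a')). pose proof (pow2_ge_0 (b + b')).
    destruct Hne as [Hne|Hne].
    - assert (0 < (a - a') ^ 2) by (apply pow2_gt_0; lra). lra.
    - assert (0 < (b + b') ^ 2) by (apply pow2_gt_0; lra). lra. }
  assert (G : ((a - a') ^ 2 + (b + b') ^ 2) * (dX ^ 2 + dY ^ 2) = 0).
  { transitivity (((a - a') * dX - (b + b') * dY) ^ 2 + ((a - a') * dY + (b + b') * dX) ^ 2); [ring|].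
    rewrite F1, F2. ring. }
  assert (dX ^ 2 + dY ^ 2 = 0) by (destruct (Rmult_integral _ _ G); lra).
  pose proof (pow2_ge_0 dX). pose proof (pow2_ge_0 dY).
  assert (dX = 0) by (apply Rsqr_0_uniq; rewrite Rsqr_pow2; lra).
  assert (dY = 0) by (apply Rsqr_0_uniq; rewrite Rsqr_pow2; lra).
  unfold dX, dY in *. lra.
Qed.

Lemma sq_sum_zero x y : x ^ 2 + y ^ 2 = 0 -> x = 0 /\ y = 0.
Proof.
  intros H. pose proof (pow2_ge_0 x). pose proof (pow2_ge_0 y).
  split; apply Rsqr_0_uniq; rewrite Rsqr_pow2; lra.
Qed.

Lemma scaled_sq_sum_zero k x y : 0 < k -> k * (x ^ 2 + y ^ 2) = 0 -> x = 0 /\ y = 0.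
Proof.
  intros Hk H. apply sq_sum_zero. destruct (Rmult_integral _ _ H); [lra | easy].
Qed.

(* Some combination [p y + r z] of the two eigenfunctions vanishes at the point [c] of
   [dirichlet_one_zero]; orthogonality makes its energy zero, hence it vanishes identically. *)
Lemma nonreal_eigenvalue_pair q w a b a' b' : L1 q -> L1 w -> ae (fun x => w x <> 0) ->
  (exists l0, l0 < 0 /\ is_eigenvalue q (fun _ => 1) l0 0 /\
            forall a b, is_eigenvalue q (fun _ => 1) a b -> (a = l0 /\ b = 0) \/ (b = 0 /\ 0 < a)) ->
  is_eigenvalue q w a b -> is_eigenvalue q w a' b' -> b <> 0 -> b' <> 0 ->
  a' = a /\ (b' = b \/ b' = - b).
Proof.
  intros Hq Hw Hw0 Hdef He He' Hb Hb'. apply NNPP. intros Hne.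
  assert (Hortho : a <> a' \/ b <> - b').
  { destruct (Req_dec a a') as [<-|?]; [right; intros ->; apply Hne; split; [easy|right; ring] | now left]. }
  assert (Hdiff : 0 < (a - a') ^ 2 + (b - b') ^ 2).
  { pose proof (pow2_ge_0 (a - a')). pose proof (pow2_ge_0 (b - b')).
    destruct (Req_dec a a') as [<-|?].
    - assert (0 < (b - b') ^ 2); [|lra]. apply pow2_gt_0. intros E. apply Hne. split; [easy|left; lra].
    - assert (0 < (a - a') ^ 2) by (apply pow2_gt_0; lra). lra. }
  destruct (dirichlet_one_zero q Hq Hdef) as (y & y1 & c & Hy & Hy0 & Hy1 & Hc & Hyc & Hpos & Hneg).
  destruct (eigen_sol q w a b Hq Hw He) as (u & u1 & v & v1 & Hs & A1 & A2 & A3 & A4 & x1 & Hx1 & Hn1).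
  destruct (eigen_sol q w a' b' Hq Hw He') as (s & s1 & t & t1 & Ht & B1 & B2 & B3 & B4 & x2 & Hx2 & Hn2).
  assert (uc : continuity u) by (destruct Hs as (D & _); exact (cont_dpl _ _ D)).
  assert (vc : continuity v) by (destruct Hs as (_ & D & _); exact (cont_dpl _ _ D)).
  assert (sc : continuity s) by (destruct Ht as (D & _); exact (cont_dpl _ _ D)).
  assert (tc : continuity t) by (destruct Ht as (_ & D & _); exact (cont_dpl _ _ D)).
  assert (Prim : forall f, continuity f -> exists F, acd (-1) 1 F (fun x => w x * f x)).
  { intros f Hf. destruct (L1_primitive _ (L1_mult_cont w f Hf Hw)) as (F & _ & HF). now exists F. }
  destruct (Prim (fun x => u x * u x + v x * v x)) as (W1 & HW1); [cont|].
  destruct (Prim (fun x => s x * s x + t x * t x)) as (W2 & HW2); [cont|].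
  destruct (Prim (fun x => u x * s x + v x * t x)) as (W3 & HW3); [cont|].
  destruct (Prim (fun x => v x * s x - u x * t x)) as (W4 & HW4); [cont|].
  assert (Z : forall z, acd (-1) 1 (fun _ => 0) (fun x => w x * (z x * x - z x * x))).
  { intros z. apply acd_eq_deriv' with (1 := acd_const _ _ 0). intros; ring. }
  assert (Z1 : acd (-1) 1 (fun _ => 0) (fun x => w x * (v x * u x - u x * v x))).
  { apply acd_eq_deriv' with (1 := acd_const _ _ 0). intros; ring. }
  assert (Z2 : acd (-1) 1 (fun _ => 0) (fun x => w x * (t x * s x - s x * t x))).
  { apply acd_eq_deriv' with (1 := acd_const _ _ 0). intros; ring. }
  clear Z.
  destruct (eigen_orthogonal q w a b a b u u1 v v1 u u1 v v1 W1 _ Hs Hs A1 A2 A3 A4 A1 A2 A3 A4 ltac:(right; lra) HW1 Z1) as [O1 _].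
  destruct (eigen_orthogonal q w a' b' a' b' s s1 t t1 s s1 t t1 W2 _ Ht Ht B1 B2 B3 B4 B1 B2 B3 B4 ltac:(right; lra) HW2 Z2) as [O2 _].
  destruct (eigen_orthogonal q w a b a' b' u u1 v v1 s s1 t t1 W3 W4 Hs Ht A1 A2 A3 A4 B1 B2 B3 B4 Hortho HW3 HW4) as [O3 O4].
  (* [p = s c + i t c] and [r = - (u c + i v c)], unless [s + i t] itself vanishes at [c]; then it
     is taken alone. *)
  assert (Hp : exists p1 p2 r1 r2, (0 < p1 ^ 2 + p2 ^ 2 \/ 0 < r1 ^ 2 + r2 ^ 2) /\
     p1 * u c - p2 * v c + r1 * s c - r2 * t c = 0 /\ p1 * v c + p2 * u c + r1 * t c + r2 * s c = 0).
  { destruct (Rlt_dec 0 (s c ^ 2 + t c ^ 2)) as [Hl|Hl].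
    - exists (s c), (t c), (- u c), (- v c). split; [now left|]. split; ring.
    - destruct (sq_sum_zero (s c) (t c)) as [Es Et].
      { pose proof (pow2_ge_0 (s c)). pose proof (pow2_ge_0 (t c)). lra. }
      exists 0, 0, 1, 0. split; [right; lra|]. rewrite Es, Et. split; ring. }
  destruct Hp as (p1 & p2 & r1 & r2 & Hpr & Ec1 & Ec2).
  destruct Hs as (Du & Dv & u1c & v1c & u1a & v1a). destruct Ht as (Ds & Dt & s1c & t1c & s1a & t1a).
  set (U := fun x => p1 * u x - p2 * v x + r1 * s x - r2 * t x).
  set (V := fun x => p1 * v x + p2 * u x + r1 * t x + r2 * s x).
  set (U1 := fun x => p1 * u1 x - p2 * v1 x + r1 * s1 x - r2 * t1 x).
  set (V1 := fun x => p1 * v1 x + p2 * u1 x + r1 * t1 x + r2 * s1 x).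
  (* [al + i be = lam p (u + i v) + mu r (s + i t)] with [lam = a + i b] and [mu = a' + i b'], so
     that [(U + i V)'' = q (U + i V) - w (al + i be)]. *)
  set (al := fun x => p1 * (a * u x - b * v x) - p2 * (a * v x + b * u x) + r1 * (a' * s x - b' * t x) - r2 * (a' * t x + b' * s x)).
  set (be := fun x => p1 * (a * v x + b * u x) + p2 * (a * u x - b * v x) + r1 * (a' * t x + b' * s x) + r2 * (a' * s x - b' * t x)).
  assert (DU : forall x, derivable_pt_lim U x (U1 x)).
  { intros x. unfold U, U1.
    eapply dpl_minus; [eapply dpl_plus; [eapply dpl_minus|..]|..]; try (eapply dpl_scal; [eauto|]); reflexivity. }
  assert (DV : forall x, derivable_pt_lim V x (V1 x)).
  { intros x. unfold V, V1.
    eapply dpl_plus; [eapply dpl_plus; [eapply dpl_plus|..]|..]; try (eapply dpl_scal; [eauto|]); reflexivity. }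
  assert (U1c : continuity U1) by (unfold U1; cont). assert (V1c : continuity V1) by (unfold V1; cont).
  assert (alc : continuity al) by (unfold al; cont). assert (bec : continuity be) by (unfold be; cont).
  assert (Uc : continuity U) by (unfold U; cont). assert (Vc : continuity V) by (unfold V; cont).
  assert (U1a : acd (-1) 1 U1 (fun x => q x * U x - w x * al x)).
  { unfold U1. eapply acd_eq_deriv'.
    - apply acd_minus; [apply acd_plus; [apply acd_minus|]|]; apply acd_scal; eassumption.
    - intros x. cbv beta. unfold U, al. ring. }
  assert (V1a : acd (-1) 1 V1 (fun x => q x * V x - w x * be x)).
  { unfold V1. eapply acd_eq_deriv'.
    - apply acd_plus; [apply acd_plus; [apply acd_plus|]|]; apply acd_scal; eassumption.
    - intros x. cbv beta. unfold V, be. ring. }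
  destruct (Prim (fun x => U x * al x)) as (RU & HRU); [cont|].
  destruct (Prim (fun x => V x * be x)) as (RV & HRV); [cont|].
  assert (HRU' : acd (-1) 1 RU (fun x => U x * (w x * al x))) by (eapply acd_eq_deriv'; [exact HRU|]; intros; cbv beta; ring).
  assert (HRV' : acd (-1) 1 RV (fun x => V x * (w x * be x))) by (eapply acd_eq_deriv'; [exact HRV|]; intros; cbv beta; ring).
  destruct (jacobi_strict q y y1 c U U1 _ RU Hq Hy Hy1 Hc Hyc Hpos Hneg DU U1c U1a HRU') as [JU1 JU2].
  { unfold U. rewrite A1, A3, B1, B3. ring. }
  { easy. }
  { unfold U. rewrite A2, A4, B2, B4. ring. }
  destruct (jacobi_strict q y y1 c V V1 _ RV Hq Hy Hy1 Hc Hyc Hpos Hneg DV V1c V1a HRV') as [JV1 JV2].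
  { unfold V. rewrite A1, A3, B1, B3. ring. }
  { easy. }
  { unfold V. rewrite A2, A4, B2, B4. ring. }
  (* [g1 + i g2 = p conj r], the coefficient of the cross terms in the energy of [U + i V]. *)
  set (g1 := p1 * r1 + p2 * r2). set (g2 := p2 * r1 - p1 * r2).
  pose proof (acd_plus _ _ _ _ _ _ (acd_plus _ _ _ _ _ _ (acd_scal _ _ (a * (p1 ^ 2 + p2 ^ 2)) _ _ HW1)
     (acd_scal _ _ (a' * (r1 ^ 2 + r2 ^ 2)) _ _ HW2))
     (acd_minus _ _ _ _ _ _ (acd_scal _ _ ((a + a') * g1 - (b - b') * g2) _ _ HW3)
     (acd_scal _ _ ((a + a') * g2 + (b - b') * g1) _ _ HW4))) as HW.
  pose proof (acd_same (-1) 1 _ _ _ _ ltac:(lra) ltac:(lra) ltac:(lra) (acd_plus _ _ _ _ _ _ HRU' HRV') HW) as E.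
  cbv beta in E. rewrite <- O1, <- O2, <- O3, <- O4 in E.
  assert (E' := E ltac:(apply ae_all; intros x _ _; unfold U, V, al, be, g1, g2; ring)).
  assert (Hsum : RU 1 + RV 1 = RU (-1) + RV (-1)) by (apply Rminus_diag_uniq; rewrite E'; ring).
  clear E E'.
  assert (ZU := JU2 ltac:(lra)). assert (ZV := JV2 ltac:(lra)).
  assert (Hae : ae (fun x => -1 < x < 1 -> al x = 0 /\ be x = 0)).
  { apply ae_mp2 with (1 := Hw0) (2 := ae_and _ _ (proj2 U1a) (proj2 V1a)).
    intros x Hx Hwx [D1 D2] Hx'. specialize (D1 Hx'). specialize (D2 Hx').
    assert (Q : forall F F' k, derivable_pt_lim F' x (q x * F x - w x * k) ->
       (forall z, in_I z -> F z = 0 /\ F' z = 0) -> k = 0).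
    { intros F F' k HD HF. rewrite (proj1 (HF x Hx)), Rmult_0_r, Rminus_0_l in HD.
      assert (- (w x * k) = 0).
      { apply (uniqueness_limite F' x); [exact HD|].
        apply dpl_on_interval with (fun _ => 0) (-1) 1; auto; [|apply dpl_const].
        intros z Hz. apply HF. unfold in_I; lra. }
      apply Ropp_eq_0_compat in H. rewrite Ropp_involutive in H.
      now destruct (Rmult_integral (w x) k H). }
    split; [apply (Q U U1) | apply (Q V V1)]; auto. }
  (* [m1 + i m2 = p (u + i v)]. Multiplied by [lam - mu] it is [al + i be - mu (U + i V)], which
     vanishes a.e. *)
  set (m1 := fun x => p1 * u x - p2 * v x). set (m2 := fun x => p1 * v x + p2 * u x).
  assert (Hm : ae (fun x => -1 < x < 1 -> m1 x = 0 /\ m2 x = 0)).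
  { apply ae_mp with (1 := Hae). intros x Hx H Hx'. destruct (H Hx') as [Ha Hbe].
    apply (scaled_sq_sum_zero _ _ _ Hdiff).
    destruct (ZU x Hx) as [Zu _]. destruct (ZV x Hx) as [Zv _].
    assert (Ea : (a - a') * m1 x - (b - b') * m2 x = al x - (a' * U x - b' * V x)) by (unfold al, m1, m2, U, V; ring).
    assert (Eb : (a - a') * m2 x + (b - b') * m1 x = be x - (a' * V x + b' * U x)) by (unfold be, m1, m2, U, V; ring).
    rewrite Zu, Zv, Ha in Ea. rewrite Zu, Zv, Hbe in Eb.
    transitivity (((a - a') * m1 x - (b - b') * m2 x) ^ 2 + ((a - a') * m2 x + (b - b') * m1 x) ^ 2); [ring|].
    rewrite Ea, Eb. ring. }
  assert (Hm1 : forall x, in_I x -> m1 x = 0).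
  { apply (ae_zero_cont m1 (-1) 1); try lra; [unfold m1; cont|].
    apply ae_mp with (1 := Hm). intros x _ H Hx. now apply H. }
  assert (Hm2 : forall x, in_I x -> m2 x = 0).
  { apply (ae_zero_cont m2 (-1) 1); try lra; [unfold m2; cont|].
    apply ae_mp with (1 := Hm). intros x _ H Hx. now apply H. }
  destruct (Rlt_dec 0 (p1 ^ 2 + p2 ^ 2)) as [Hpp|Hpp].
  - assert (G : (p1 ^ 2 + p2 ^ 2) * (u x1 ^ 2 + v x1 ^ 2) = 0).
    { transitivity (m1 x1 ^ 2 + m2 x1 ^ 2); [unfold m1, m2; ring|]. rewrite Hm1, Hm2 by easy. ring. }
    destruct (scaled_sq_sum_zero _ _ _ Hpp G). now destruct Hn1.
  - destruct (sq_sum_zero p1 p2) as [Ep1 Ep2].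
    { pose proof (pow2_ge_0 p1). pose proof (pow2_ge_0 p2). lra. }
    assert (G : (r1 ^ 2 + r2 ^ 2) * (s x2 ^ 2 + t x2 ^ 2) = 0).
    { destruct (ZU x2 Hx2) as [Zu _]. destruct (ZV x2 Hx2) as [Zv _].
      transitivity (U x2 ^ 2 + V x2 ^ 2); [unfold U, V; rewrite Ep1, Ep2; ring|]. rewrite Zu, Zv. ring. }
    assert (Hrr : 0 < r1 ^ 2 + r2 ^ 2) by now destruct Hpr.
    destruct (scaled_sq_sum_zero _ _ _ Hrr G). now destruct Hn2.
Qed.

(** * Large imaginary parameters *)

(** Cauchy-Schwarz with a free scale [tau] in place of a square root:
    [2 |f1| <= tau f1 ^ 2 + 1 / tau], integrated. *)
Lemma energy_increment f f1 E e a b tau : -1 <= a -> a <= b -> b <= 1 -> acd a b f f1 -> acd a b E e ->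
  (forall x, f1 x ^ 2 <= e x) -> E b - E a <= 1 -> 0 < tau ->
  Rabs (f b - f a) <= / 2 * (tau + (b - a) / tau).
Proof.
  intros Ha Hab Hb Hf HE He H1 Ht.
  pose proof (acd_abs_le a b _ _ _ _ Ha Hab Hb Hf
    (acd_plus _ _ _ _ _ _ (acd_scal _ _ (/ 2 * tau) _ _ HE) (acd_scal _ _ (/ 2 * / tau) _ _ (acd_id a b)))) as D.
  cbv beta in D.
  assert (D' : Rabs (f b - f a) <= / 2 * tau * E b + / 2 * / tau * b - (/ 2 * tau * E a + / 2 * / tau * a)).
  { apply D. apply ae_all. intros x _ _.
    assert (Hi : tau * / tau = 1) by (apply Rinv_r; lra).
    assert (Hp : 0 < / tau) by (apply Rinv_0_lt_compat; lra).
    apply Rle_trans with (/ 2 * tau * f1 x ^ 2 + / 2 * / tau * 1).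
    - assert (Q : forall s, 2 * s <= tau * s ^ 2 + / tau).
      { intros s. assert (0 <= / tau * (tau * s - 1) ^ 2) by (apply Rmult_le_pos; [lra|apply pow2_ge_0]).
        replace (/ tau * (tau * s - 1) ^ 2) with ((tau * / tau) * tau * s ^ 2 - 2 * (tau * / tau) * s + / tau) in H by ring.
        rewrite Hi in H. lra. }
      pose proof (Q (f1 x)). pose proof (Q (- f1 x)) as Q2. replace ((- f1 x) ^ 2) with (f1 x ^ 2) in Q2 by ring.
      apply Rabs_le. lra.
    - specialize (He x). nra. }
  apply Rle_trans with (1 := D').
  assert (0 < / tau) by (apply Rinv_0_lt_compat; lra). unfold Rdiv. nra.
Qed.

(* Near a point [x] where [int w] and [int |w|] are differentiable with [w x <> 0], the integral of
   [w f] against the bump [l^2 - (y - x)^2] is at least of order [l^3 |w x| eta], whereas the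
   equation [alpha w f = q g - g''] bounds [alpha] times it independently of [alpha]. *)
Lemma local_bound q w c d eta : L1 q -> L1 w -> ae (fun x => w x <> 0) -> -1 <= c -> c < d -> d <= 1 -> 0 < eta ->
  exists A, 0 < A /\ forall al f f1 g g1 E, A <= al -> sol q (fun x => al * w x) f f1 g g1 ->
    acd c d E (fun x => f1 x ^ 2 + g1 x ^ 2) -> E d - E c <= 1 ->
    (forall x, c <= x <= d -> Rabs (g x) <= 1) -> ~ (forall x, c <= x <= d -> eta <= Rabs (f x)).
Proof.
  intros Hq Hw Hw0 Hc Hcd Hd Heta.
  destruct (L1_primitive w Hw) as (W & Wc & Wa).
  destruct (L1_primitive_nondecr (fun x => Rabs (w x)) (L1_abs w Hw)) as (H & Hcc & Ha & Hm); [intros; apply Rabs_pos|].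
  destruct (L1_primitive_nondecr (fun x => Rabs (q x)) (L1_abs q Hq)) as (Q & Qc & Qa & Qm); [intros; apply Rabs_pos|].
  destruct (ae_exists c d _ Hc Hcd Hd (ae_and _ _ Hw0 (ae_and _ _ (proj2 Wa) (proj2 Ha)))) as (x & Hx & Hwx & DW & DH).
  specialize (DW ltac:(lra)). specialize (DH ltac:(lra)).
  set (w0 := w x) in *. apply Rabs_pos_lt in Hwx.
  destruct (dpl_bound W x w0 (Rabs w0 / 12) DW) as (d1 & Hd1 & K1); [lra|].
  destruct (dpl_bound H x (Rabs w0) (Rabs w0 / 12) DH) as (d2 & Hd2 & K2); [lra|].
  (* The window must lie in [[c, d]] and within the range of both linear approximations;
     [eta * eta / 36] gives [sqrt l <= eta / 6], which bounds the oscillation of [f] on it. *)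
  set (l := Rmin (Rmin (d1 / 2) (d2 / 2)) (Rmin (Rmin (x - c) (d - x)) (eta * eta / 36))).
  assert (Hl : 0 < l /\ l <= d1 / 2 /\ l <= d2 / 2 /\ l <= x - c /\ l <= d - x /\ l <= eta * eta / 36).
  { pose proof (Rmin_l (Rmin (d1 / 2) (d2 / 2)) (Rmin (Rmin (x - c) (d - x)) (eta * eta / 36))).
    pose proof (Rmin_r (Rmin (d1 / 2) (d2 / 2)) (Rmin (Rmin (x - c) (d - x)) (eta * eta / 36))).
    pose proof (Rmin_l (d1 / 2) (d2 / 2)). pose proof (Rmin_r (d1 / 2) (d2 / 2)).
    pose proof (Rmin_l (Rmin (x - c) (d - x)) (eta * eta / 36)). pose proof (Rmin_r (Rmin (x - c) (d - x)) (eta * eta / 36)).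
    pose proof (Rmin_l (x - c) (d - x)). pose proof (Rmin_r (x - c) (d - x)).
    split; [|unfold l; lra]. unfold l. repeat apply Rmin_pos; try lra. nra. }
  clearbody l. destruct Hl as (Hl0 & Hl1 & Hl2 & Hl3 & Hl4 & Hl5).
  assert (Hsq : 0 < sqrt l <= eta / 6).
  { split; [now apply sqrt_lt_R0|]. rewrite <- (sqrt_square (eta / 6)) by lra. apply sqrt_le_1_alt. lra. }
  assert (Hss : sqrt l * sqrt l = l) by (apply sqrt_sqrt; lra).
  set (r := sqrt l) in *. clearbody r.
  set (T := Q d - Q c). assert (HT : 0 <= T) by (specialize (Qm c d ltac:(lra) ltac:(lra) ltac:(lra)); unfold T; lra).
  (* A bound for [int phi (q g - g'')] after integration by parts: [|phi'| <= 2 l] and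
     [|g'| <= 1 + g' ^ 2] give the first summand, [phi <= l ^ 2] and [|g| <= 1] the second. *)
  set (C := 2 * l * (2 * l + 1) + l * l * T).
  assert (HC : 0 < C) by (unfold C; assert (0 <= l * l * T) by (apply Rmult_le_pos; nra); nra).
  assert (Hl3' : 0 < l * l * l) by (repeat apply Rmult_lt_0_compat; easy).
  (* The main term [(4 / 3) l ^ 3 |w0| |f x|] loses [(1 / 3) l ^ 3 |w0| |f x|] and
     [(13 / 6) r l ^ 3 |w0|]. As [r <= eta / 6] and [|f x| >= eta], at least half of
     [l ^ 3 |w0| eta] is left. *)
  set (k := l * l * l * Rabs w0 * (eta / 2)).
  assert (Hk : 0 < k) by (unfold k; repeat apply Rmult_lt_0_compat; lra).
  exists (C / k + 1). split; [assert (0 < C / k) by (now apply Rdiv_lt_0_compat); lra|].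
  intros al f f1 g g1 E Hal Hs HE HE1 Hg Hf.
  assert (Halp : 0 < al) by (assert (0 < C / k) by (now apply Rdiv_lt_0_compat); lra).
  set (a := x - l). set (b := x + l).
  assert (Hab : a <= b) by (unfold a, b; lra).
  assert (Hca : c <= a) by (unfold a; lra). assert (Hbd : b <= d) by (unfold b; lra).
  destruct Hs as (Df & Dg & f1c & g1c & f1a & g1a).
  pose proof (cont_dpl _ _ Df) as fc. pose proof (cont_dpl _ _ Dg) as gc.
  set (phi := fun y => l * l - (y - x) * (y - x)).
  assert (Dphi : forall y, derivable_pt_lim phi y (-2 * (y - x))).
  { intros y. unfold phi.
    assert (D1 : derivable_pt_lim (fun z => z - x) y 1) by (eapply dpl_minus; [apply dpl_id|apply dpl_const|ring]).
    eapply dpl_minus; [apply dpl_const | eapply dpl_mult; [exact D1|exact D1|reflexivity] | ring]. }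
  assert (phic : continuity phi) by (unfold phi; cont).
  assert (phia : acd a b phi (fun y => -2 * (y - x))) by (apply acd_C1; auto; cont).
  assert (phib : forall y, a < y < b -> 0 <= phi y <= l * l).
  { intros y Hy. assert (0 <= (l - (y - x)) * (l + (y - x))) by (apply Rmult_le_pos; unfold a, b in Hy; lra).
    pose proof (Rle_0_sqr (y - x)) as Sq. unfold Rsqr in Sq. unfold phi. lra. }
  assert (phi0 : phi a = 0 /\ phi b = 0) by (unfold phi, a, b; split; ring).
  destruct phi0 as [phia0 phib0].
  destruct (L1_primitive _ (L1_mult_cont w (fun y => phi y * f y) (cont_mult _ _ phic fc) Hw)) as (F3 & _ & F3a).
  assert (sub : forall F f', acd (-1) 1 F f' -> acd a b F f') by (intros F f' HF; apply acd_sub with (-1) 1; auto; lra).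
  assert (subE : acd a b E (fun x => f1 x ^ 2 + g1 x ^ 2)) by (apply acd_sub with c d; auto).
  assert (Emono : forall s t, c <= s -> s <= t -> t <= d -> E s <= E t).
  { intros s t Hs Hst Ht. apply acd_nonneg with (fun x => f1 x ^ 2 + g1 x ^ 2); try lra.
    - apply acd_sub with c d; auto.
    - apply ae_all. intros z _ _. pose proof (pow2_ge_0 (f1 z)). pose proof (pow2_ge_0 (g1 z)). lra. }
  assert (HEab : E b - E a <= 1).
  { pose proof (Emono c a ltac:(lra) ltac:(lra) ltac:(lra)). pose proof (Emono b d ltac:(lra) ltac:(lra) ltac:(lra)). lra. }
  assert (Bound2 : al * Rabs (F3 b - F3 a) <= C).
  { pose proof (acd_plus _ _ _ _ _ _ (acd_mult _ _ _ _ _ _ Hab phia (sub _ _ g1a)) (acd_scal _ _ al _ _ (sub _ _ F3a))) as L1'.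
    pose proof (acd_plus _ _ _ _ _ _ (acd_scal _ _ (2 * l) _ _ (acd_plus _ _ _ _ _ _ (acd_id a b) subE))
      (acd_scal _ _ (l * l) _ _ (sub _ _ Qa))) as L2'.
    pose proof (acd_abs_le a b _ _ _ _ ltac:(lra) Hab ltac:(lra) L1' L2') as D. cbv beta in D.
    rewrite phia0, phib0 in D.
    assert (D' : Rabs (0 * g1 b + al * F3 b - (0 * g1 a + al * F3 a)) <=
      2 * l * (b + E b) + l * l * Q b - (2 * l * (a + E a) + l * l * Q a)).
    { apply D. apply ae_all. intros y _ Hy. specialize (phib y Hy). specialize (Hg y ltac:(lra)).
      replace (_ + _) with (-2 * (y - x) * g1 y + phi y * (q y * g y)) by ring.
      eapply Rle_trans; [apply Rabs_triang|]. rewrite !Rabs_mult, (Rabs_pos_eq (phi y)) by lra.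
      rewrite (Rabs_left (-2)) by lra.
      assert (Rabs (y - x) <= l) by (apply Rabs_le; unfold a, b in Hy; lra).
      assert (Rabs (g1 y) <= 1 + (f1 y ^ 2 + g1 y ^ 2)).
      { pose proof (pow2_ge_0 (f1 y)). pose proof (abs_prod_le 1 (g1 y)) as P. rewrite Rmult_1_r, Rabs_mult in P.
        rewrite (Rabs_pos_eq 2) in P by lra. pose proof (pow2_ge_0 (g1 y)). pose proof (Rabs_pos (g1 y)). nra. }
      pose proof (Rabs_pos (y - x)). pose proof (Rabs_pos (g1 y)). pose proof (Rabs_pos (q y)). pose proof (Rabs_pos (g y)).
      apply Rplus_le_compat.
      - assert (Rabs (y - x) * Rabs (g1 y) <= l * (1 + (f1 y ^ 2 + g1 y ^ 2))) by (apply Rmult_le_compat; lra). lra.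
      - apply Rmult_le_compat; try lra; [apply Rmult_le_pos; lra|]. nra. }
    replace (0 * g1 b + al * F3 b - (0 * g1 a + al * F3 a)) with (al * (F3 b - F3 a)) in D' by ring.
    rewrite Rabs_mult, (Rabs_pos_eq al) in D' by lra. apply Rle_trans with (1 := D').
    pose proof (Qm c a ltac:(lra) ltac:(lra) ltac:(lra)). pose proof (Qm b d ltac:(lra) ltac:(lra) ltac:(lra)).
    replace (2 * l * (b + E b) + l * l * Q b - (2 * l * (a + E a) + l * l * Q a)) with
      (2 * l * (2 * l + (E b - E a)) + l * l * (Q b - Q a)) by (unfold a, b; ring).
    assert (Q b - Q a <= T) by (unfold T; lra). unfold C. apply Rplus_le_compat.
    - apply Rmult_le_compat_l; lra.
    - apply Rmult_le_compat_l; nra. }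
  assert (Hol : forall y, a < y < b -> Rabs (f y - f x) <= r).
  { assert (faa : forall s t, s <= t -> acd s t f f1) by (intros; now apply acd_C1).
    assert (Hq2 : forall z, f1 z ^ 2 <= f1 z ^ 2 + g1 z ^ 2) by (intros z; pose proof (pow2_ge_0 (g1 z)); lra).
    assert (Hrr : forall t, t <= l -> / 2 * (r + t / r) <= r).
    { intros t Ht. assert (t / r <= r); [|lra]. apply Rmult_le_reg_r with r; [lra|].
      unfold Rdiv. rewrite Rmult_assoc, Rinv_l by lra. lra. }
    intros y Hy. destruct (Rle_dec x y).
    - apply Rle_trans with (/ 2 * (r + (y - x) / r)); [|apply Hrr; unfold b in Hy; lra].
      apply (energy_increment f f1 E _ x y r ltac:(lra) ltac:(lra) ltac:(lra) (faa x y ltac:(lra))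
        (acd_sub c d x y _ _ ltac:(lra) ltac:(lra) HE) Hq2); [|lra].
      pose proof (Emono c x ltac:(lra) ltac:(lra) ltac:(lra)). pose proof (Emono y d ltac:(lra) ltac:(lra) ltac:(lra)). lra.
    - rewrite Rabs_minus_sym. apply Rle_trans with (/ 2 * (r + (x - y) / r)); [|apply Hrr; unfold a in Hy; lra].
      apply (energy_increment f f1 E _ y x r ltac:(lra) ltac:(lra) ltac:(lra) (faa y x ltac:(lra))
        (acd_sub c d y x _ _ ltac:(lra) ltac:(lra) HE) Hq2); [|lra].
      pose proof (Emono c y ltac:(lra) ltac:(lra) ltac:(lra)). pose proof (Emono x d ltac:(lra) ltac:(lra) ltac:(lra)). lra. }
  assert (Bound1 : Rabs (F3 b - F3 a - f x * w0 * (4 / 3 * (l * l * l))) <=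
     Rabs (f x) * (Rabs w0 / 3) * (l * l * l) + r * (l * l * l) * (Rabs w0 * (13 / 6))).
  (* [w] need not be close to [w0] near [x]; only its primitive is close to a linear function.
     Integration by parts therefore moves the derivative onto the bump, which vanishes at both
     ends. *)
  { set (R0 := fun y => W y - W x - w0 * (y - x)).
    assert (R0a : acd a b R0 (fun y => w y - w0)).
    { apply acd_eq_deriv' with (f := fun y => w y - 0 - w0 * (1 - 0)); [|intros; ring].
      unfold R0. apply acd_minus; [apply acd_minus; [now apply sub|apply acd_const]|].
      apply acd_scal, acd_minus; [apply acd_id|apply acd_const]. }
    set (Phi := fun y => l * l * (y - x) - / 3 * (y - x) ^ 3).
    assert (Phia : acd a b Phi phi).
    { apply acd_C1; auto. intros y. unfold Phi, phi.
      assert (D1 : derivable_pt_lim (fun z => z - x) y 1) by (eapply dpl_minus; [apply dpl_id|apply dpl_const|ring]).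
      eapply dpl_minus; [eapply dpl_scal; [exact D1|reflexivity] | eapply dpl_scal;
        [exact (derivable_pt_lim_comp _ (fun z => z ^ 3) y _ _ D1 (derivable_pt_lim_pow _ 3)) | reflexivity] |].
      simpl. field. }
    pose proof (acd_minus _ _ _ _ _ _ (acd_minus _ _ _ _ _ _ (sub _ _ F3a)
      (acd_scal _ _ (f x) _ _ (acd_mult _ _ _ _ _ _ Hab phia R0a))) (acd_scal _ _ (f x * w0) _ _ Phia)) as L1'.
    pose proof (acd_plus _ _ _ _ _ _ (acd_scal _ _ (Rabs (f x) * (2 * l * (Rabs w0 / 12 * l))) _ _ (acd_id a b))
      (acd_scal _ _ (l * l * r) _ _ (sub _ _ Ha))) as L2'.
    pose proof (acd_abs_le a b _ _ _ _ ltac:(lra) Hab ltac:(lra) L1' L2') as D. cbv beta in D.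
    rewrite phia0, phib0 in D.
    assert (D' := D ltac:(apply ae_all; intros y _ Hy;
      replace (w y * (phi y * f y) - f x * (-2 * (y - x) * R0 y + phi y * (w y - w0)) - f x * w0 * phi y)
        with (f x * (2 * (y - x) * R0 y) + phi y * (f y - f x) * w y) by ring;
      specialize (phib y Hy); specialize (Hol y Hy);
      assert (Hyx : Rabs (y - x) <= l) by (apply Rabs_le; unfold a, b in Hy; lra);
      specialize (K1 y ltac:(lra)); fold (R0 y) in K1;
      eapply Rle_trans; [apply Rabs_triang|];
      rewrite !Rabs_mult, (Rabs_pos_eq (phi y)), (Rabs_pos_eq 2) by lra; rewrite Rmult_1_r;
      apply Rplus_le_compat;
      [ apply Rmult_le_compat_l; [apply Rabs_pos|]; rewrite !Rmult_assoc; apply Rmult_le_compat_l; [lra|];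
        apply Rmult_le_compat; auto using Rabs_pos; apply Rle_trans with (1 := K1);
        apply Rmult_le_compat_l; lra
      | apply Rmult_le_compat_r; [apply Rabs_pos|]; apply Rmult_le_compat; auto using Rabs_pos; lra ])).
    clear D.
    replace (F3 b - f x * (0 * R0 b) - f x * w0 * Phi b - (F3 a - f x * (0 * R0 a) - f x * w0 * Phi a))
      with (F3 b - F3 a - f x * w0 * (4 / 3 * (l * l * l))) in D' by (unfold Phi, a, b; field).
    apply Rle_trans with (1 := D').
    assert (KH : H b - H a <= 2 * l * (Rabs w0 * (13 / 12))).
    { pose proof (K2 b ltac:(unfold b; rewrite Rabs_pos_eq; lra)) as Kb.
      pose proof (K2 a ltac:(unfold a; rewrite Rabs_minus_sym, Rabs_pos_eq; lra)) as Ka.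
      unfold a, b in Ka, Kb |- *. rewrite (Rabs_minus_sym (x - l)) in Ka.
      rewrite (Rabs_pos_eq (x + l - x)) in Kb by lra. rewrite (Rabs_pos_eq (x - (x - l))) in Ka by lra.
      apply Rabs_le_between in Ka. apply Rabs_le_between in Kb. lra. }
    replace (Rabs (f x) * (2 * l * (Rabs w0 / 12 * l)) * b + l * l * r * H b -
      (Rabs (f x) * (2 * l * (Rabs w0 / 12 * l)) * a + l * l * r * H a)) with
      (Rabs (f x) * (Rabs w0 / 3) * (l * l * l) + l * l * r * (H b - H a)) by (unfold a, b; field).
    apply Rplus_le_compat_l.
    apply Rle_trans with (l * l * r * (2 * l * (Rabs w0 * (13 / 12)))).
    - apply Rmult_le_compat_l; [|easy]. apply Rmult_le_pos; nra.
    - right. field. }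
  specialize (Hf x ltac:(lra)).
  assert (Hlow : k <= Rabs (F3 b - F3 a)).
  { pose proof (Rabs_triang_inv (f x * w0 * (4 / 3 * (l * l * l))) (f x * w0 * (4 / 3 * (l * l * l)) - (F3 b - F3 a))) as Tr.
    replace (f x * w0 * (4 / 3 * (l * l * l)) - (f x * w0 * (4 / 3 * (l * l * l)) - (F3 b - F3 a))) with (F3 b - F3 a) in Tr by ring.
    rewrite (Rabs_minus_sym _ (F3 b - F3 a)) in Tr.
    rewrite !Rabs_mult, (Rabs_pos_eq (4 / 3)), (Rabs_pos_eq l) in Tr by lra.
    assert (Hfin : k <= Rabs (f x) * Rabs w0 * (4 / 3 * (l * l * l)) -
      (Rabs (f x) * (Rabs w0 / 3) * (l * l * l) + r * (l * l * l) * (Rabs w0 * (13 / 6)))); [|lra].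
    replace (Rabs (f x) * Rabs w0 * (4 / 3 * (l * l * l)) -
      (Rabs (f x) * (Rabs w0 / 3) * (l * l * l) + r * (l * l * l) * (Rabs w0 * (13 / 6)))) with
      (l * l * l * Rabs w0 * (Rabs (f x) - r * (13 / 6))) by field.
    unfold k. apply Rmult_le_compat_l; [|lra]. apply Rmult_le_pos; lra. }
  assert (Hcontra : C < al * k).
  { apply Rlt_le_trans with ((C / k + 1) * k).
    - rewrite Rmult_plus_distr_r. unfold Rdiv. rewrite Rmult_assoc, Rinv_l by lra. lra.
    - apply Rmult_le_compat_r; lra. }
  assert (al * k <= al * Rabs (F3 b - F3 a)) by (apply Rmult_le_compat_l; lra). lra.
Qed.

Lemma uniform_threshold (P : nat -> R -> Prop) n :
  (forall j, (j < n)%nat -> exists A, 0 < A /\ forall al, A <= al -> P j al) ->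
  exists A, 0 < A /\ forall al, A <= al -> forall j, (j < n)%nat -> P j al.
Proof.
  induction n as [|n IH]; intros H.
  - exists 1. split; [lra|]. intros; lia.
  - destruct IH as (A & HA & KA); [intros; apply H; lia|].
    destruct (H n ltac:(lia)) as (B & HB & KB).
    exists (Rmax A B). pose proof (Rmax_l A B). pose proof (Rmax_r A B). split; [lra|].
    intros al Hal j Hj. destruct (Nat.eq_dec j n) as [->|Hne]; [apply KB; lra | apply KA; [lra|lia]].
Qed.

Lemma cell_in_window z d M : 0 <= z -> 0 < d -> (0 < M)%nat -> 2 / INR M <= d -> z + d <= 1 ->
  exists j, (j < M)%nat /\ z <= INR j / INR M /\ INR (S j) / INR M <= z + d.
Proof.
  intros Hz Hd HM HMd Hz1. apply lt_0_INR in HM.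
  destruct (nfloor_ex (z * INR M)) as [n [Hn1 Hn2]]; [nra|].
  assert (E : INR (S (S n)) / INR M <= z + d).
  { apply Rle_trans with (z + 2 / INR M); [|lra]. rewrite !S_INR.
    replace (z + 2 / INR M) with ((z * INR M + 2) * / INR M) by (field; lra).
    unfold Rdiv. apply Rmult_le_compat_r; [left; now apply Rinv_0_lt_compat | lra]. }
  (* Left end at the first grid point strictly after [z]; the condition on [M] leaves room for a
     full cell behind it. *)
  exists (S n). split; [|split; [|easy]].
  - apply INR_lt. rewrite S_INR in E.
    assert (INR (S n) + 1 <= 1 * INR M); [|lra].
    apply Rmult_le_reg_r with (/ INR M); [now apply Rinv_0_lt_compat|].
    rewrite Rmult_assoc, Rinv_r by lra. unfold Rdiv in E. lra.
  - rewrite S_INR. apply Rmult_le_reg_r with (INR M); [easy|]. unfold Rdiv. rewrite Rmult_assoc, Rinv_l by lra. lra.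
Qed.

(** At energy 1 the squared modulus must reach [1 / (T + 1)] somewhere: otherwise testing the
    equation with the solution, where the terms in [al] cancel, gives [1 <= T / (T + 1)]. The place
    may depend on [al], so a fixed grid of [M] cells is used to reduce the thresholds of
    [local_bound] to finitely many. *)
Lemma energy_normalised_bound q w : L1 q -> L1 w -> ae (fun x => w x <> 0) ->
  exists A, 0 < A /\ forall al f f1 g g1 x0, A <= al -> sol q (fun x => al * w x) f f1 g g1 ->
    f1 0 = 0 -> g 0 = 0 -> 0 < x0 <= 1 -> f x0 = 0 -> g x0 = 0 ->
    prim0 (fun x => f1 x ^ 2 + g1 x ^ 2) x0 - prim0 (fun x => f1 x ^ 2 + g1 x ^ 2) 0 <> 1.
Proof.
  intros Hq Hw Hw0.
  destruct (L1_primitive_nondecr (fun x => Rabs (q x)) (L1_abs q Hq)) as (Q & Qc & Qa & Qm); [intros; apply Rabs_pos|].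
  set (T := Q 1 - Q (-1)).
  assert (HT : 0 <= T) by (specialize (Qm (-1) 1 ltac:(lra) ltac:(lra) ltac:(lra)); unfold T; lra).
  set (eta0 := / (T + 1)). assert (He0 : 0 < eta0 <= 1).
  { split; [apply Rinv_0_lt_compat; lra|]. unfold eta0. rewrite <- Rinv_1. apply Rinv_le_contravar; lra. }
  (* As [eta0 <= 1], this gives [2 eta ^ 2 <= eta0], so one of [|f z|] and [|g z|] is at least
     [eta]. *)
  set (eta := eta0 / 2). assert (He : 0 < eta) by (unfold eta; lra).
  (* Over a length [eta ^ 2 / 4] a function of energy at most 1 varies by at most [eta / 2]; a mesh
     below half of that length puts a whole cell into such a window. *)
  destruct (archimed_cor1 (eta * eta / 8)) as (M & HM1 & HM); [nra|].
  destruct (uniform_threshold (fun j al => forall f f1 g g1 E, sol q (fun x => al * w x) f f1 g g1 ->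
    acd (INR j / INR M) (INR (S j) / INR M) E (fun x => f1 x ^ 2 + g1 x ^ 2) -> E (INR (S j) / INR M) - E (INR j / INR M) <= 1 ->
    (forall x, INR j / INR M <= x <= INR (S j) / INR M -> Rabs (g x) <= 1) ->
    ~ (forall x, INR j / INR M <= x <= INR (S j) / INR M -> eta / 2 <= Rabs (f x))) M) as (A & HA & KA).
  { intros j Hj. pose proof (lt_0_INR M HM) as HMp.
    assert (Hjp : 0 <= INR j / INR M) by (apply Rdiv_le_0_compat; [apply pos_INR|easy]).
    assert (Hj1 : INR (S j) / INR M <= 1).
    { apply Rmult_le_reg_r with (INR M); [easy|]. unfold Rdiv. rewrite Rmult_assoc, Rinv_l by lra.
      rewrite Rmult_1_l, Rmult_1_r. apply le_INR. lia. }
    destruct (local_bound q w (INR j / INR M) (INR (S j) / INR M) (eta / 2) Hq Hw Hw0) as (A & HA & KA); try lra.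
    - rewrite S_INR. unfold Rdiv. apply Rmult_lt_compat_r; [now apply Rinv_0_lt_compat | lra].
    - exists A. split; [easy|]. intros al Hal f f1 g g1 E. now apply KA. }
  exists A. split; [easy|]. intros al f f1 g g1 x0 Hal Hs Hf1 Hg Hx0 Hfx Hgx.
  set (E := prim0 (fun x => f1 x ^ 2 + g1 x ^ 2)). intros HE.
  pose proof Hs as (Df & Dg & f1c & g1c & f1a & g1a).
  assert (Ea : forall s t, s <= t -> acd s t E (fun x => f1 x ^ 2 + g1 x ^ 2)) by (intros; apply prim0_acd; [easy|cont]).
  assert (Emono : forall s t, -1 <= s -> s <= t -> t <= 1 -> E s <= E t).
  { intros s t Hs' Hst Ht. apply acd_nonneg with (fun x => f1 x ^ 2 + g1 x ^ 2); auto.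
    apply ae_all. intros z _ _. pose proof (pow2_ge_0 (f1 z)). pose proof (pow2_ge_0 (g1 z)). lra. }
  assert (EI : forall s t, 0 <= s -> s <= t -> t <= x0 -> E t - E s <= 1).
  { intros s t Hs' Hst Ht. pose proof (Emono 0 s ltac:(lra) ltac:(lra) ltac:(lra)).
    pose proof (Emono t x0 ltac:(lra) ltac:(lra) ltac:(lra)). lra. }
  assert (fa : acd (-1) 1 f f1) by (apply acd_C1; auto; lra).
  assert (ga : acd (-1) 1 g g1) by (apply acd_C1; auto; lra).
  assert (Hz : exists z, 0 <= z <= x0 /\ eta0 <= f z ^ 2 + g z ^ 2).
  { apply NNPP. intros Hn.
    assert (Hlt : forall z, 0 <= z <= x0 -> f z ^ 2 + g z ^ 2 <= eta0).
    { intros z Hz. left. apply Rnot_le_lt. intros Hle. apply Hn. now exists z. }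
    assert (h : -1 <= 1) by lra.
    pose proof (acd_plus _ _ _ _ _ _ (acd_mult _ _ _ _ _ _ h fa f1a) (acd_mult _ _ _ _ _ _ h ga g1a)) as L1'.
    pose proof (acd_minus _ _ _ _ _ _ (Ea (-1) 1 h) (acd_scal _ _ eta0 _ _ Qa)) as L2'.
    pose proof (acd_le 0 x0 _ _ _ _ ltac:(lra) ltac:(lra) ltac:(lra) (acd_sub (-1) 1 0 x0 _ _ ltac:(lra) ltac:(lra) L2')
      (acd_sub (-1) 1 0 x0 _ _ ltac:(lra) ltac:(lra) L1')) as D. cbv beta in D. rewrite Hf1, Hg, Hfx, Hgx in D.
    assert (D' : E x0 - eta0 * Q x0 - (E 0 - eta0 * Q 0) <= 0 * f1 x0 + 0 * g1 x0 - (f 0 * 0 + 0 * g1 0)).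
    { apply D. apply ae_all. intros z _ Hzx. specialize (Hlt z ltac:(lra)).
      pose proof (Rle_abs (- q z)) as Aq. rewrite Rabs_Ropp in Aq. pose proof (Rabs_pos (q z)).
      pose proof (pow2_ge_0 (f z)). pose proof (pow2_ge_0 (g z)).
      replace (f1 z * f1 z + f z * (q z * f z + al * w z * g z) + (g1 z * g1 z + g z * (q z * g z - al * w z * f z)))
        with (f1 z ^ 2 + g1 z ^ 2 + q z * (f z ^ 2 + g z ^ 2)) by ring.
      assert (- Rabs (q z) * eta0 <= q z * (f z ^ 2 + g z ^ 2)) by nra. lra. }
    assert (Q x0 - Q 0 <= T).
    { pose proof (Qm (-1) 0 ltac:(lra) ltac:(lra) ltac:(lra)). pose proof (Qm x0 1 ltac:(lra) ltac:(lra) ltac:(lra)). unfold T. lra. }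
    assert (eta0 * (Q x0 - Q 0) <= eta0 * T) by (apply Rmult_le_compat_l; lra).
    assert (eta0 * T = 1 - eta0) by (unfold eta0; field; lra). lra. }
  destruct Hz as (z & Hz & Hzeta).
  (* Stated for a general pair, so that it applies to [f + i g] and to its multiple by [- i]. *)
  assert (main : forall h h1 k k1, sol q (fun x => al * w x) h h1 k k1 ->
    (forall x, h1 x ^ 2 + k1 x ^ 2 = f1 x ^ 2 + g1 x ^ 2) -> h x0 = 0 -> k x0 = 0 -> eta <= Rabs (h z) -> False).
  { intros h h1 k k1 Hh Heq Hh0 Hk0 Hhz.
    pose proof Hh as (Dh & Dk & h1c & k1c & _ & _).
    assert (Hinc : forall p p1, (forall x, derivable_pt_lim p x (p1 x)) -> continuity p1 ->
      (forall x, p1 x ^ 2 <= f1 x ^ 2 + g1 x ^ 2) -> forall s t tau, 0 <= s -> s <= t -> t <= x0 -> 0 < tau ->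
      Rabs (p t - p s) <= / 2 * (tau + (t - s) / tau)).
    { intros p p1 Dp p1c Hp s t tau Hs' Hst Ht Htau.
      apply (energy_increment p p1 E (fun x => f1 x ^ 2 + g1 x ^ 2) s t tau ltac:(lra) Hst ltac:(lra)); auto.
      apply acd_C1; auto. }
    assert (Hh2 : forall x, h1 x ^ 2 <= f1 x ^ 2 + g1 x ^ 2) by (intros x; rewrite <- Heq; pose proof (pow2_ge_0 (k1 x)); lra).
    assert (Hk2 : forall x, k1 x ^ 2 <= f1 x ^ 2 + g1 x ^ 2) by (intros x; rewrite <- Heq; pose proof (pow2_ge_0 (h1 x)); lra).
    pose proof (Hinc h h1 Dh h1c Hh2) as Ih. pose proof (Hinc k k1 Dk k1c Hk2) as Ik.
    (* [h] vanishes at [x0], and to fall there from a value of size [eta] at energy 1 it needs a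
       length of at least [eta ^ 2]. So the window after [z] ends before [x0]. *)
    assert (Hgap : eta * eta <= x0 - z).
    { pose proof (Ih z x0 eta ltac:(lra) ltac:(lra) ltac:(lra) He) as I1.
      rewrite Hh0, Rminus_0_l, Rabs_Ropp in I1.
      assert (eta <= (x0 - z) / eta) by lra. apply Rmult_le_compat_r with (r := eta) in H; [|lra].
      unfold Rdiv in H. rewrite Rmult_assoc, Rinv_l in H by lra. lra. }
    assert (Hbig : forall y, z <= y <= z + eta * eta / 4 -> eta / 2 <= Rabs (h y)).
    { intros y Hy. pose proof (Ih z y (eta / 2) ltac:(lra) ltac:(lra) ltac:(nra) ltac:(lra)) as I1.
      assert ((y - z) / (eta / 2) <= eta / 2).
      { apply Rmult_le_reg_r with (eta / 2); [lra|]. unfold Rdiv at 1. rewrite Rmult_assoc, Rinv_l by lra. nra. }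
      pose proof (Rabs_triang_inv (h z) (h z - h y)) as Tr.
      replace (h z - (h z - h y)) with (h y) in Tr by ring. rewrite (Rabs_minus_sym (h z)) in Tr. lra. }
    destruct (cell_in_window z (eta * eta / 4) M) as (j & Hj & Hj1 & Hj2); [lra|nra|easy|lra|nra|].
    assert (Hcell : INR (S j) / INR M <= x0) by nra.
    pose proof (lt_0_INR M HM) as HMp.
    assert (Hjj : INR j / INR M <= INR (S j) / INR M).
    { rewrite S_INR. unfold Rdiv. apply Rmult_le_compat_r; [left; now apply Rinv_0_lt_compat | lra]. }
    apply (KA al Hal j Hj h h1 k k1 E Hh).
    - eapply acd_eq_deriv'; [apply Ea; easy|]. intros; cbv beta; now rewrite Heq.
    - apply EI; lra.
    - intros y Hy. pose proof (Ik y x0 1 ltac:(lra) ltac:(lra) ltac:(lra) ltac:(lra)) as I1.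
        rewrite Hk0, Rminus_0_l, Rabs_Ropp in I1. unfold Rdiv in I1. rewrite Rinv_1 in I1. lra.
    - intros y Hy. apply Hbig. lra. }
  assert (Hcase : eta <= Rabs (f z) \/ eta <= Rabs (g z)).
  { destruct (Rle_dec eta (Rabs (f z))) as [?|Hn]; [now left|]. right. apply Rnot_lt_le. intros Hlt.
    rewrite <- (pow2_abs (f z)), <- (pow2_abs (g z)) in Hzeta.
    pose proof (Rabs_pos (f z)). pose proof (Rabs_pos (g z)).
    assert (Rabs (f z) ^ 2 < eta ^ 2) by nra. assert (Rabs (g z) ^ 2 < eta ^ 2) by nra.
    assert (2 * eta ^ 2 <= eta0); [|lra]. unfold eta. nra. }
  destruct Hcase as [Hc|Hc].
  - now apply (main f f1 g g1).
  - apply (main g g1 _ _ (sol_rot _ _ _ _ _ _ Hs)); auto.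
    + intros x. ring.
    + rewrite Hfx. ring.
Qed.

(** A positive energy can be scaled to 1. If the energy on [[0, x0]] is zero, the solution is
    constant there, with value 0 at [x0]. *)
Lemma no_large_parameter q w : L1 q -> L1 w -> ae (fun x => w x <> 0) ->
  exists A, 0 < A /\ forall al f f1 g g1 x0, A <= al -> sol q (fun x => al * w x) f f1 g g1 ->
    f1 0 = 0 -> g 0 = 0 -> 0 < x0 <= 1 -> f x0 = 0 -> g x0 = 0 -> f 0 = 0 /\ g1 0 = 0.
Proof.
  intros Hq Hw Hw0. destruct (energy_normalised_bound q w Hq Hw Hw0) as (A & HA & KA).
  exists A. split; [easy|]. intros al f f1 g g1 x0 Hal Hs Hf1 Hg Hx0 Hfx Hgx.
  pose proof Hs as (Df & Dg & f1c & g1c & _ & _).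
  set (E := prim0 (fun x => f1 x ^ 2 + g1 x ^ 2)).
  assert (ec : continuity (fun x => f1 x ^ 2 + g1 x ^ 2)) by cont.
  assert (Ea : forall s t, s <= t -> acd s t E (fun x => f1 x ^ 2 + g1 x ^ 2)) by (intros; now apply prim0_acd).
  assert (Emono : forall s t, -1 <= s -> s <= t -> t <= 1 -> E s <= E t).
  { intros s t Hs' Hst Ht. apply acd_nonneg with (fun x => f1 x ^ 2 + g1 x ^ 2); auto.
    apply ae_all. intros z _ _. pose proof (pow2_ge_0 (f1 z)). pose proof (pow2_ge_0 (g1 z)). lra. }
  destruct (Rle_dec (E x0 - E 0) 0) as [Hle|Hgt].
  - assert (Hz : forall x, 0 <= x <= x0 -> E x - E 0 = 0 /\ f1 x ^ 2 + g1 x ^ 2 = 0).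
    { apply zero_on_interval_deriv; try lra; auto.
      - intros x. eapply dpl_minus; [apply prim0_derive; exact ec | apply dpl_const | cbv beta; ring].
      - intros x Hx. pose proof (Emono 0 x ltac:(lra) ltac:(lra) ltac:(lra)).
        pose proof (Emono x x0 ltac:(lra) ltac:(lra) ltac:(lra)). lra. }
    destruct (sq_sum_zero _ _ (proj2 (Hz 0 ltac:(lra)))) as [_ Hg1]. split; [|easy].
    transitivity (f x0); [symmetry | exact Hfx]. apply (acd_zero 0 x0 f f1); try lra.
    + apply acd_C1; auto; lra.
    + apply ae_all. intros x _ Hx. destruct (sq_sum_zero _ _ (proj2 (Hz x ltac:(lra)))). easy.
  - exfalso. set (e := E x0 - E 0) in *. assert (He : 0 < sqrt e) by (apply sqrt_lt_R0; lra).
    assert (Hee : sqrt e * sqrt e = e) by (apply sqrt_sqrt; lra).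
    set (k := / sqrt e). assert (Hk : k * k * e = 1).
    { transitivity (k * k * (sqrt e * sqrt e)); [now rewrite Hee|]. unfold k. field. lra. }
    pose proof (sol_lin _ _ _ _ _ _ _ _ _ _ k 0 Hs Hs) as Hs'.
    apply (KA al _ _ _ _ x0 Hal Hs').
    + rewrite Hf1. ring.
    + rewrite Hg. ring.
    + easy.
    + rewrite Hfx. ring.
    + rewrite Hgx. ring.
    + set (h1 := fun x => k * f1 x + 0 * f1 x). set (j1 := fun x => k * g1 x + 0 * g1 x).
      assert (hc : continuity (fun x => h1 x ^ 2 + j1 x ^ 2)) by (unfold h1, j1; cont).
      pose proof (acd_same 0 x0 _ _ _ _ ltac:(lra) ltac:(lra) ltac:(lra)
        (prim0_acd _ 0 x0 ltac:(lra) hc) (acd_scal _ _ (k * k) _ _ (Ea 0 x0 ltac:(lra)))) as S. cbv beta in S.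
      change (prim0 (fun x => h1 x ^ 2 + j1 x ^ 2) x0 - prim0 (fun x => h1 x ^ 2 + j1 x ^ 2) 0 = 1).
      rewrite S.
      * rewrite <- Rmult_minus_distr_l. exact Hk.
      * apply ae_all. intros x _ _. unfold h1, j1. ring.
Qed.

(** * Existence of the imaginary eigenvalues *)

(** For [acd_reflect]: reflection reverses the order of the intervals in the definition of absolute
    continuity. *)
Lemma rsum_rev f n : rsum f n = rsum (fun i => f (n - 1 - i)%nat) n.
Proof.
  induction n as [|n IH]; [easy|].
  replace (S n) with (1 + n)%nat at 2 by lia. rewrite rsum_app. cbn [rsum].
  rewrite IH, Rplus_0_l, Rplus_comm. f_equal; [f_equal; lia|].
  apply rsum_ext. intros i Hi. f_equal. lia.
Qed.

Lemma acd_reflect F f : acd (-1) 1 F f -> acd (-1) 1 (fun x => F (- x)) (fun x => - f (- x)).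
Proof.
  intros [HA HD]. split.
  - intros eps He. destruct (HA eps He) as (d & Hd & K). exists d. split; [easy|].
    intros n a b Ha Hb Hs.
    rewrite (rsum_ext _ (fun i => Rabs (F (- a i) - F (- b i)))) by (intros; apply Rabs_minus_sym).
    rewrite rsum_rev. apply (K n (fun i => - b (n - 1 - i)%nat) (fun i => - a (n - 1 - i)%nat)).
    + intros i Hi. specialize (Ha (n - 1 - i)%nat ltac:(lia)). lra.
    + intros i Hi. specialize (Hb (n - 1 - S i)%nat ltac:(lia)).
      replace (S (n - 1 - S i)) with (n - 1 - i)%nat in Hb by lia. lra.
    + apply Rle_lt_trans with (2 := Hs). right. rewrite (rsum_rev (fun i => b i - a i)).
      apply rsum_ext. intros; ring.
  - apply ae_reflect in HD. apply ae_mp with (1 := HD). intros x _ H Hx.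
    apply dpl_eq with (f (- x) * -1); [|ring].
    apply (derivable_pt_lim_comp (fun y => - y) F x (-1) (f (- x))); [|apply H; lra].
    exact (derivable_pt_lim_opp (fun y => y) x 1 (dpl_id x)).
Qed.

Lemma sol_reflect P S u u1 v v1 : ae (fun x => P x = P (- x)) -> ae (fun x => S (- x) = - S x) ->
  sol P S u u1 v v1 ->
  wsol P S (fun x => u (- x)) (fun x => -1 * u1 (- x)) (fun x => -1 * v (- x)) (fun x => v1 (- x)).
Proof.
  intros HP HS Hs. destruct (sol_wsol _ _ _ _ _ _ Hs) as (A1 & A2 & A3 & A4). split; [|split; [|split]].
  - eapply acd_eq_deriv'; [apply acd_reflect; exact A1|]. intros; cbv beta; ring.
  - eapply acd_eq_deriv'; [apply acd_scal, acd_reflect; exact A2|]. intros; cbv beta; ring.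
  - eapply acd_eq_deriv; [apply acd_scal, acd_reflect; exact A3|].
    apply ae_mp2 with (1 := HP) (2 := HS). intros x _ E1 E2 _. rewrite E2, <- E1. ring.
  - eapply acd_eq_deriv; [apply acd_reflect; exact A4|].
    apply ae_mp2 with (1 := HP) (2 := HS). intros x _ E1 E2 _. rewrite E2, <- E1. ring.
Qed.

(* PT symmetry: [conj (y (-x))] solves the same equation. *)
Lemma sol_parity P S u u1 v v1 : L1 P -> L1 S -> ae (fun x => P x = P (- x)) -> ae (fun x => S (- x) = - S x) ->
  sol P S u u1 v v1 -> u1 0 = 0 -> v 0 = 0 ->
  forall x, in_I x -> u (- x) = u x /\ - u1 (- x) = u1 x /\ - v (- x) = v x /\ v1 (- x) = v1 x.
Proof.
  intros HP HS EP ES Hs H1 H2 x Hx.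
  destruct (wsol_unique _ _ _ _ _ _ _ _ _ _ 0 HP HS ltac:(unfold in_I; lra)
    (sol_reflect _ _ _ _ _ _ EP ES Hs) (sol_wsol _ _ _ _ _ _ Hs)) with (x := x) as (E1 & E2 & E3 & E4); auto.
  - now rewrite Ropp_0.
  - rewrite Ropp_0, H1. ring.
  - rewrite Ropp_0, H2. ring.
  - now rewrite Ropp_0.
  - lra.
Qed.

Lemma sol_eq_coef P P' S S' u u1 v v1 : (forall x, P x = P' x) -> (forall x, S x = S' x) ->
  sol P S u u1 v v1 -> sol P' S' u u1 v v1.
Proof.
  intros HP HS (A & B & C & D & E & F). do 4 (split; [easy|]). split.
  - eapply acd_eq_deriv'; [exact E|]. intros x; cbv beta. now rewrite HP, HS.
  - eapply acd_eq_deriv'; [exact F|]. intros x; cbv beta. now rewrite HP, HS.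
Qed.

(** Complex conjugation, which leads from the eigenvalue [i al] to [- i al]. *)
Lemma sol_conj P S u u1 v v1 : sol P S u u1 v v1 ->
  sol P (fun x => -1 * S x) u u1 (fun x => -1 * v x) (fun x => -1 * v1 x).
Proof.
  intros (A & B & C & D & E & F). split; [easy|]. split; [|split; [easy|split; [cont|split]]].
  - intros x. eapply dpl_scal; [apply B | reflexivity].
  - eapply acd_eq_deriv'; [exact E|]. intros; cbv beta; ring.
  - eapply acd_eq_deriv'; [apply acd_scal; exact F|]. intros; cbv beta; ring.
Qed.

Lemma singular_2x2 a b c d : a * d - b * c = 0 ->
  exists p r, (p <> 0 \/ r <> 0) /\ p * a + r * b = 0 /\ p * c + r * d = 0.
Proof.
  intros H. destruct (Req_dec c 0) as [Hc|Hc]; [destruct (Req_dec d 0) as [Hd|Hd]|].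
  - destruct (Req_dec a 0) as [Ha|Ha].
    + exists 1, 0. rewrite Ha, Hc. split; [left; lra|lra].
    + exists b, (- a). rewrite Hc, Hd. split; [right; lra|]. split; ring.
  - exists d, (- c). split; [now left|]. split; [lra|ring].
  - exists d, (- c). split; [right; lra|]. split; [lra|ring].
Qed.

Lemma lipschitz_cont h C : (forall x y, Rabs (h x - h y) <= C * Rabs (x - y)) -> continuity h.
Proof.
  intros H x eps He.
  assert (HC : 0 < Rabs C + 1) by (pose proof (Rabs_pos C); lra).
  exists (eps / (Rabs C + 1)). split; [now apply Rdiv_lt_0_compat|].
  intros y [_ Hy]. simpl in *. unfold Rdist in *.
  apply Rmult_lt_compat_l with (r := Rabs C + 1) in Hy; [|easy].
  replace ((Rabs C + 1) * (eps / (Rabs C + 1))) with eps in Hy by (field; lra).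
  specialize (H y x). pose proof (Rle_abs C). pose proof (Rabs_pos (y - x)). nra.
Qed.

(* [y = s(1) c + c(1) s], so [y 1 = 2 c(1) s(1)]. *)
Lemma even_odd_sign q y y1 c c1 s s1 : L1 q -> dsol q 0 y y1 -> y (-1) = 0 -> y1 (-1) = 1 -> y 1 < 0 ->
  dsol q 0 c c1 -> dsol q 0 s s1 -> c 0 = 1 -> c1 0 = 0 -> s 0 = 0 -> s1 0 = 1 ->
  c (-1) = c 1 -> c1 (-1) = - c1 1 -> s (-1) = - s 1 -> s1 (-1) = s1 1 -> c 1 * s 1 < 0.
Proof.
  intros Hq Hy Hy0 Hy1 Hneg Hc Hs C0 C1 S0 S1 Ec Ec1 Es Es1.
  pose proof (acd_zero 0 1 _ _ ltac:(lra) ltac:(lra) ltac:(lra)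
    (acd_sub (-1) 1 0 1 _ _ ltac:(lra) ltac:(lra) (dsol_wronskian q 0 0 _ _ _ _ Hc Hs))
    ltac:(apply ae_all; intros; ring)) as W. cbv beta in W. rewrite C0, C1, S0, S1 in W.
  destruct (dsol_unique q 0 _ _ _ _ (-1) Hq ltac:(unfold in_I; lra) Hy (dsol_lin q 0 _ _ _ _ (s 1) (c 1) Hc Hs)
    ltac:(rewrite Hy0, Ec, Es; ring) ltac:(rewrite Hy1, Ec1, Es1; lra) 1 ltac:(unfold in_I; lra)) as [E _].
  lra.
Qed.

(** Solutions with [u1 0 = v 0 = 0] form a real plane and have [u] even and [v] odd. Vanishing at 1
    thus implies vanishing at [-1] and is two real conditions on two real coefficients, decided by
    one real determinant. *)
Lemma imaginary_eigenvalue_exists q w : L1 q -> L1 w -> ae (fun x => w x <> 0) ->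
  ae (fun x => q x = q (- x)) -> ae (fun x => w (- x) = - w x) ->
  (exists l0, l0 < 0 /\ is_eigenvalue q (fun _ => 1) l0 0 /\
            forall a b, is_eigenvalue q (fun _ => 1) a b -> (a = l0 /\ b = 0) \/ (b = 0 /\ 0 < a)) ->
  exists al, 0 < al /\ is_eigenvalue q w 0 al /\ is_eigenvalue q w 0 (- al).
Proof.
  intros Hq Hw Hw0 Hqs Hws Hdef.
  assert (H0 : in_I 0) by (unfold in_I; lra).
  assert (Hz : L1 (fun _ => 0)) by apply L1_cont, cont_const.
  assert (HPc : forall al, L1 (fun x => q x + al * 0)) by (intros; apply L1_plus; auto; apply L1_cont, cont_const).
  assert (HSc : forall al, L1 (fun x => al * w x)) by (intros; now apply L1_scal).
  assert (Hex : forall c0 d1, exists p : R -> (R -> R) * (R -> R) * ((R -> R) * (R -> R)), forall al,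
    sol (fun x => q x + al * 0) (fun x => al * w x) (fst (fst (p al))) (snd (fst (p al))) (fst (snd (p al))) (snd (snd (p al)))
    /\ fst (fst (p al)) 0 = c0 /\ snd (fst (p al)) 0 = 0 /\ fst (snd (p al)) 0 = 0 /\ snd (snd (p al)) 0 = d1).
  { intros c0 d1.
    assert (Hx : forall al, exists p : (R -> R) * (R -> R) * ((R -> R) * (R -> R)),
      sol (fun x => q x + al * 0) (fun x => al * w x) (fst (fst p)) (snd (fst p)) (fst (snd p)) (snd (snd p))
      /\ fst (fst p) 0 = c0 /\ snd (fst p) 0 = 0 /\ fst (snd p) 0 = 0 /\ snd (snd p) 0 = d1).
    { intros al. destruct (sol_exists _ _ 0 c0 0 0 d1 (HPc al) (HSc al) H0) as (u & u1 & v & v1 & H).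
      now exists (u, u1, (v, v1)). }
    exists (fun al => proj1_sig (constructive_indefinite_description _ (Hx al))).
    intros al. exact (proj2_sig (constructive_indefinite_description _ (Hx al))). }
  (* A basis of this plane for each [al]: [f + i g] with [f 0 = 1] and [g1 0 = 0], and [h + i k]
     with [h 0 = 0] and [k1 0 = 1]. *)
  destruct (Hex 1 0) as (p & Hp). destruct (Hex 0 1) as (r & Hr). clear Hex.
  set (f := fun al => fst (fst (p al))). set (f1 := fun al => snd (fst (p al))).
  set (g := fun al => fst (snd (p al))). set (g1 := fun al => snd (snd (p al))).
  set (h := fun al => fst (fst (r al))). set (h1 := fun al => snd (fst (r al))).
  set (k := fun al => fst (snd (r al))). set (k1 := fun al => snd (snd (r al))).
  assert (HA : forall al, sol (fun x => q x + al * 0) (fun x => al * w x) (f al) (f1 al) (g al) (g1 al)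
     /\ f al 0 = 1 /\ f1 al 0 = 0 /\ g al 0 = 0 /\ g1 al 0 = 0) by exact Hp.
  assert (HB : forall al, sol (fun x => q x + al * 0) (fun x => al * w x) (h al) (h1 al) (k al) (k1 al)
     /\ h al 0 = 0 /\ h1 al 0 = 0 /\ k al 0 = 0 /\ k1 al 0 = 1) by exact Hr.
  clearbody f f1 g g1 h h1 k k1. clear p r Hp Hr.
  set (D := fun al x => f al x * k al x - h al x * g al x).
  assert (comb : forall al x, D al x = 0 -> exists u u1 v v1, sol q (fun x => al * w x) u u1 v v1 /\
     u1 0 = 0 /\ v 0 = 0 /\ u x = 0 /\ v x = 0 /\ (u 0 <> 0 \/ v1 0 <> 0)).
  { intros al x HD. destruct (singular_2x2 _ _ _ _ HD) as (a & b & Hab & E1 & E2).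
    destruct (HA al) as (A0 & A1 & A2 & A3 & A4). destruct (HB al) as (B0 & B1 & B2 & B3 & B4).
    pose proof (sol_lin _ _ _ _ _ _ _ _ _ _ a b A0 B0) as Hs.
    eexists. eexists. eexists. eexists. split.
    - eapply sol_eq_coef with (3 := Hs); intros y; ring.
    - cbv beta. rewrite A1, A2, A3, A4, B1, B2, B3, B4. split; [ring|]. split; [ring|].
      split; [easy|]. split; [easy|]. destruct Hab; [left|right]; lra. }
  assert (Hpar : forall al u u1 v v1, sol q (fun x => al * w x) u u1 v v1 -> u1 0 = 0 -> v 0 = 0 ->
    forall x, in_I x -> u (- x) = u x /\ - u1 (- x) = u1 x /\ - v (- x) = v x /\ v1 (- x) = v1 x).
  { intros al u u1 v v1 Hs Hu Hv. apply (sol_parity q (fun x => al * w x)); auto.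
    apply ae_mp with (1 := Hws). intros x _ E. rewrite E. ring. }
  assert (D0 : D 0 1 < 0).
  (* At [al = 0] the two equations decouple and [h] vanishes, so [D] is the product of the even and
     the odd solution at 1. *)
  { destruct (dirichlet_one_zero q Hq Hdef) as (y & y1 & c & Hy & Hy0 & Hy1 & Hc & _ & _ & Hneg).
    specialize (Hneg 1 ltac:(lra)).
    destruct (HA 0) as (A0 & A1 & A2 & A3 & A4). destruct (HB 0) as (B0 & B1 & B2 & B3 & B4).
    destruct (sol_dsol q _ _ 0 _ _ _ _ A0) as [A5 A6]; [intros; ring|intros; ring|].
    destruct (sol_dsol q _ _ 0 _ _ _ _ B0) as [B5 B6]; [intros; ring|intros; ring|].
    assert (I1 : in_I 1) by (unfold in_I; lra).
    destruct (dsol_zero q 0 _ _ 0 Hq H0 B5 B1 B2 1 I1) as [Eh _].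
    destruct (Hpar 0 (f 0) (f1 0) (g 0) (g1 0)) with (x := 1) as (F1 & F2 & _ & _); auto.
    { eapply sol_eq_coef with (3 := A0); intros; ring. }
    destruct (Hpar 0 (h 0) (h1 0) (k 0) (k1 0)) with (x := 1) as (_ & _ & F3 & F4); auto.
    { eapply sol_eq_coef with (3 := B0); intros; ring. }
    replace (Ropp 1) with (-1) in F1, F2, F3, F4 by lra.
    unfold D. rewrite Eh, Rmult_0_l, Rminus_0_r.
    apply (even_odd_sign q y y1 (f 0) (f1 0) (k 0) (k1 0)); auto; lra. }
  destruct (no_large_parameter q w Hq Hw Hw0) as (A & HApos & Hlarge).
  assert (Dnz : forall x, 0 < x <= 1 -> D A x <> 0).
  { intros x Hx HD. destruct (comb A x HD) as (u & u1 & v & v1 & Hs & E1 & E2 & E3 & E4 & E5).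
    destruct (Hlarge A u u1 v v1 x (Rle_refl A) Hs E1 E2 Hx E3 E4). tauto. }
  assert (D1 : 0 < D A 1).
  { destruct (HA A) as ((Df & Dg & _) & A1 & A2 & A3 & A4). destruct (HB A) as ((Dh & Dk & _) & B1 & B2 & B3 & B4).
    assert (Dd : derivable_pt_lim (D A) 0 1).
    { eapply dpl_minus; [eapply dpl_mult; [apply Df|apply Dk|reflexivity] |
        eapply dpl_mult; [apply Dh|apply Dg|reflexivity]|].
      rewrite A1, A2, A3, A4, B1, B2, B3, B4. ring. }
    destruct (sign_near (D A) 0 1 Dd) as (d & Hd & K); [unfold D; rewrite B1, B3; ring | lra |].
    set (t := Rmin 1 (d / 2)).
    assert (Ht : 0 < t) by (apply Rmin_pos; lra).
    assert (Ht1 : t <= 1) by apply Rmin_l. assert (Ht2 : t <= d / 2) by apply Rmin_r.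
    specialize (K t ltac:(rewrite Rminus_0_r, Rabs_pos_eq; lra) ltac:(lra)).
    apply pos_by_IVT with t; auto.
    - apply cont_minus; apply cont_mult; eapply cont_dpl; eauto.
    - rewrite Rmult_1_l, Rminus_0_r in K. apply Rmult_lt_reg_l with t; lra.
    - intros z Hz'. apply Dnz. lra. }
  assert (Dlip : exists C, forall s t, Rabs s <= A -> Rabs t <= A -> Rabs (D s 1 - D t 1) <= C * Rabs (s - t)).
  { destruct (sol_family_bound q (fun _ => 0) w 0 A 1 0 0 0 Hq Hz Hw H0 ltac:(lra)) as (B & HBp & Bd).
    destruct (sol_family_bound q (fun _ => 0) w 0 A 0 0 0 1 Hq Hz Hw H0 ltac:(lra)) as (B' & HBp' & Bd').
    destruct (sol_family_lipschitz q (fun _ => 0) w 0 A 1 0 0 0 Hq Hz Hw H0 ltac:(lra)) as (C & HC & Lp).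
    destruct (sol_family_lipschitz q (fun _ => 0) w 0 A 0 0 0 1 Hq Hz Hw H0 ltac:(lra)) as (C' & HC' & Lp').
    assert (I1 : in_I 1) by (unfold in_I; lra).
    exists (2 * (C * B' + B * C')). intros s t Hs Ht.
    destruct (HA s) as (S0 & S1 & S2 & S3 & S4). destruct (HB s) as (S5 & S6 & S7 & S8 & S9).
    destruct (HA t) as (T0 & T1 & T2 & T3 & T4). destruct (HB t) as (T5 & T6 & T7 & T8 & T9).
    destruct (Bd t _ _ _ _ Ht (sol_wsol _ _ _ _ _ _ T0) T1 T2 T3 T4 1 I1) as (Q1 & _ & Q2 & _).
    destruct (Bd' s _ _ _ _ Hs (sol_wsol _ _ _ _ _ _ S5) S6 S7 S8 S9 1 I1) as (Q3 & _ & Q4 & _).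
    destruct (Lp s t _ _ _ _ _ _ _ _ Hs Ht (sol_wsol _ _ _ _ _ _ S0) (sol_wsol _ _ _ _ _ _ T0)
      S1 S2 S3 S4 T1 T2 T3 T4 1 I1) as (L1' & L2').
    destruct (Lp' s t _ _ _ _ _ _ _ _ Hs Ht (sol_wsol _ _ _ _ _ _ S5) (sol_wsol _ _ _ _ _ _ T5)
      S6 S7 S8 S9 T6 T7 T8 T9 1 I1) as (L3' & L4').
    assert (prod : forall x y X Y, Rabs X <= C * Rabs (s - t) -> Rabs y <= B' -> Rabs x <= B -> Rabs Y <= C' * Rabs (s - t) ->
      Rabs (X * y + x * Y) <= (C * B' + B * C') * Rabs (s - t)).
    { intros x y X Y HX Hy Hx HY. eapply Rle_trans; [apply Rabs_triang|]. rewrite !Rabs_mult, Rmult_plus_distr_r.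
      apply Rplus_le_compat.
      - apply Rle_trans with (C * Rabs (s - t) * B'); [apply Rmult_le_compat; auto using Rabs_pos|right; ring].
      - apply Rle_trans with (B * (C' * Rabs (s - t))); [apply Rmult_le_compat; auto using Rabs_pos|right; ring]. }
    pose proof (prod (f t 1) (k s 1) _ _ L1' Q4 Q1 L4') as P1.
    pose proof (prod (g t 1) (h s 1) _ _ L2' Q3 Q2 L3') as P2.
    unfold D. replace (f s 1 * k s 1 - h s 1 * g s 1 - (f t 1 * k t 1 - h t 1 * g t 1)) with
      (((f s 1 - f t 1) * k s 1 + f t 1 * (k s 1 - k t 1)) - ((g s 1 - g t 1) * h s 1 + g t 1 * (h s 1 - h t 1))) by ring.
    apply Rabs_le_between in P1. apply Rabs_le_between in P2. apply Rabs_le. lra. }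
  destruct Dlip as (C & Dlip).
  assert (Hcl : forall al, Rabs (clamp 0 A al) <= A).
  { intros al. pose proof (clamp_in 0 A al ltac:(lra)). rewrite Rabs_pos_eq; lra. }
  (* The Lipschitz bound holds for bounded parameters only, while [IVT_cor] asks for continuity on
     the line. *)
  assert (Dc : continuity (fun al => D (clamp 0 A al) 1)).
  { apply lipschitz_cont with (Rabs C). intros s t.
    apply Rle_trans with (1 := Dlip _ _ (Hcl s) (Hcl t)).
    pose proof (clamp_lip 0 A t s). pose proof (Rle_abs C). pose proof (Rabs_pos (clamp 0 A s - clamp 0 A t)).
    apply Rle_trans with (Rabs C * Rabs (clamp 0 A s - clamp 0 A t)); [nra|].
    apply Rmult_le_compat_l; [apply Rabs_pos|easy]. }
  destruct (IVT_cor _ 0 A Dc ltac:(lra)) as (al & Hal & HDal).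
  { rewrite !clamp_id by lra. nra. }
  cbv beta in HDal. rewrite clamp_id in HDal by lra.
  assert (Hal0 : 0 < al).
  { destruct (Req_dec al 0) as [->|?]; lra. }
  destruct (comb al 1 HDal) as (u & u1 & v & v1 & Hs & E1 & E2 & E3 & E4 & E5).
  destruct (Hpar al u u1 v v1 Hs E1 E2 1 ltac:(unfold in_I; lra)) as (P1 & _ & P3 & _).
  replace (Ropp 1) with (-1) in P1, P3 by lra.
  (* What is known to be nonzero may be [v1 0] rather than a value of the solution; but if [v]
     vanished on the interval, so would [v1]. *)
  assert (Hnz : exists x, in_I x /\ (u x <> 0 \/ v x <> 0)).
  { apply NNPP. intros Hn.
    assert (Zu : forall x, in_I x -> u x = 0 /\ v x = 0).
    { intros x Hx. split; apply NNPP; intros Hne; apply Hn; exists x; tauto. }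
    destruct Hs as (_ & Dv & _ & v1c & _).
    destruct (zero_on_interval_deriv v v1 (-1) 1 ltac:(lra) ltac:(lra) ltac:(lra) Dv v1c
      ltac:(intros x Hx; apply Zu; unfold in_I; lra) 0 ltac:(lra)) as [_ Z].
    destruct E5 as [E5|E5]; [apply E5, Zu, H0 | easy]. }
  exists al. split; [easy|]. split.
  - apply sol_eigen with u u1 v v1; auto; try lra.
    eapply sol_eq_coef with (3 := Hs); intros; ring.
  - pose proof (sol_conj _ _ _ _ _ _ Hs) as Hs'.
    apply sol_eigen with u u1 (fun x => -1 * v x) (fun x => -1 * v1 x); auto; try lra.
    + eapply sol_eq_coef with (3 := Hs'); intros; ring.
    + destruct Hnz as (x & Hx & Hne). exists x. split; [easy|].
      destruct Hne; [left; easy | right; lra].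
Qed.

Theorem theorem1p5 (q w : R -> R)
  (hq : L1 q) (hw : L1 w)
  (hw0 : ae (fun x => w x <> 0))
  (hqs : ae (fun x => q x = q (- x)))
  (hws : ae (fun x => w (- x) = - w x))
  (hdef : exists l0, l0 < 0 /\ is_eigenvalue q (fun _ => 1) l0 0 /\
            forall a b, is_eigenvalue q (fun _ => 1) a b ->
              (a = l0 /\ b = 0) \/ (b = 0 /\ 0 < a)) :
  exists alpha, 0 < alpha /\
    is_eigenvalue q w 0 alpha /\ is_eigenvalue q w 0 (- alpha) /\
    forall a b, is_eigenvalue q w a b -> b <> 0 ->
      (a = 0 /\ b = alpha) \/ (a = 0 /\ b = - alpha).
Proof.
  destruct (imaginary_eigenvalue_exists q w hq hw hw0 hqs hws hdef) as (al & Hal & H1 & H2).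
  exists al. split; [easy|]. split; [easy|]. split; [easy|]. intros a b Hab Hb.
  destruct (nonreal_eigenvalue_pair q w 0 al a b hq hw hw0 hdef H1 Hab ltac:(lra) Hb) as [Ha Hb']. tauto.
Qed.
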